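(* Let $X_t=\mu t+\sigma W_t$ with $\mu\in\mathbb{R}$, $\sigma>0$, let $a>0$ and $\gamma=2\mu/\sigma^2$. Let $\tau_a^n$ and $\tilde\tau_a^n$ be the $n$-th drawdown times without and with recovery, respectively, and $N_t^a=\sum_{n=1}^\infty 1_{\{\tau_a^n\le t\}}$. For every $k\in\mathbb{N}$, $N^a_{\tilde\tau_a^k}-k$ follows a generalized Poisson distribution with parameters $\theta=(k-1)\gamma a/(e^{\gamma a}-1)$ and $\lambda=\gamma a/(e^{\gamma a}-1)$, i.e., for $m=0,1,2,\dots$, $$\mathbb{P}\{\tilde\tau_a^k=\tau_a^{k+m}\}=\mathbb{P}\{N^a_{\tilde\tau_a^k}=k+m\}=\frac{k-1}{m+k-1}\,\frac{\left(\frac{(m+k-1)\gamma a}{e^{\gamma a}-1}\right)^m}{m!}\,e^{-\frac{(m+k-1)\gamma a}{e^{\gamma a}-1}}.$$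
   Context: $X_t=\mu t+\sigma W_t$ ($X_0=0$) with $W$ a standard Brownian motion, $\mu\in\mathbb{R}$, $\sigma>0$; $M_t=\sup_{0\le s\le t}X_s$; $M_{[s,t]}=\sup_{s\le u\le t}X_u$; $a>0$ is fixed; $\mathbb{N}=\{1,2,\dots\}$; $\inf\emptyset=\infty$. Drawdown times without recovery: $\tau_a^0=0$, $\tau_a^n=\inf\{t>\tau_a^{n-1}: M_{[\tau_a^{n-1},t]}-X_t\ge a\}$ (these are almost surely finite). Drawdown times with recovery: $\tilde\tau_a^0=0$, $\tilde\tau_a^n=\inf\{t>\tilde\tau_a^{n-1}: M_t-X_t\ge a,\ M_t>M_{\tilde\tau_a^{n-1}}\}$, with $\tilde\tau_a^n=\infty$ if $\tilde\tau_a^{n-1}=\infty$. On $\{\tilde\tau_a^k=\infty\}$, $N^a_{\tilde\tau_a^k}=\infty$. A generalized Poisson$(\theta,\lambda)$ random variable has probability mass function $p(m)=\theta(\theta+\lambda m)^{m-1}e^{-\theta-\lambda m}/m!$, $m=0,1,2,\dots$; here ''follows a generalized Poisson distribution'' means precisely that the displayed formula holds for all $m\ge0$ (when $\mu<0$ and $k\ge2$ the masses sum to less than one, the remaining mass being that of $\{\tilde\tau_a^k=\infty\}$). When $\mu=0$, $\gamma a/(e^{\gamma a}-1)$ is understood as $1$. When $k=1$ and $m=0$ the factor $\frac{k-1}{m+k-1}$ and the power $0^0$ are read as $1$ (degenerate distribution at $0$). *)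

(* Defs.v *)
From HB Require Import structures.
From mathcomp Require Import all_boot all_order all_algebra.
From mathcomp Require Import all_classical all_reals all_analysis.
Set Implicit Arguments.
Unset Strict Implicit.
Unset Printing Implicit Defensive.
Import Order.TTheory GRing.Theory Num.Theory.
Import numFieldNormedType.Exports.
Local Open Scope classical_set_scope.
Local Open Scope ring_scope.

Section brownian_motion.
Context (R : realType) (d : measure_display) (T : measurableType d).
Variable P : probability T R.

(* Taking some of the [A i] to be the whole line gives the product rule for
   every subfamily. *)
Definition mutually_independent (n : nat) (Y : 'I_n -> T -> R) : Prop :=
  forall A : 'I_n -> set R, (forall i, measurable (A i)) ->
    P (\bigcap_i (Y i @^-1` A i)) = (\prod_(i < n) P (Y i @^-1` A i))%E.

(* The time index ranges over [R], but only times t >= 0 are constrained.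
   Every path starts at 0 and is continuous on [0, +oo[. *)
Record brownian_motion (W : R -> {RV P >-> R}) : Prop := {
  bm_start : forall w, W 0 w = 0;
  bm_continuous : forall w, {within `[0, +oo[, continuous (fun t : R => W t w)};
  bm_indep : forall (n : nat) (t : nat -> R), 0 <= t 0%N ->
    (forall i, t i <= t i.+1) ->
    mutually_independent (fun (i : 'I_n) w => W (t i.+1) w - W (t i) w);
  bm_normal : forall s t : R, 0 <= s -> s < t -> forall A : set R, measurable A ->
    P ((fun w => W t w - W s w) @^-1` A) = normal_prob 0 (Num.sqrt (t - s)) A
}.

Definition drifted_bm (W : R -> {RV P >-> R}) (mu sigma : R) (t : R) (w : T) : R :=
  mu * t + sigma * W t w.

End brownian_motion.

Section drawdowns.
Context (R : realType).

(* Pathwise notions: x is a path, of which only the times >= 0 matter. *)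
Definition running_max (x : R -> R) (s t : R) : R :=
  sup [set x u | u in `[s, t]].

(* Times live in \bar R, with ereal_inf set0 = +oo. When the previous time is
   +oo no real t exceeds it, so the next time is +oo too and the value of
   [fine] there is irrelevant. *)
Fixpoint dd_time (x : R -> R) (a : R) (n : nat) : \bar R :=
  if n is n'.+1 then
    ereal_inf [set t%:E | t in [set t : R |
      (dd_time x a n' < t%:E)%E /\
      a <= running_max x (fine (dd_time x a n')) t - x t]]
  else 0%E.

Fixpoint dd_time_rec (x : R -> R) (a : R) (n : nat) : \bar R :=
  if n is n'.+1 then
    ereal_inf [set t%:E | t in [set t : R |
      [/\ (dd_time_rec x a n' < t%:E)%E,
          a <= running_max x 0 t - x t &
          running_max x 0 (fine (dd_time_rec x a n')) < running_max x 0 t]]]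
  else 0%E.

(* At t = +oo every indicator is 1, so the count is +oo. *)
Definition dd_count (x : R -> R) (a : R) (t : \bar R) : \bar R :=
  (\sum_(1 <= n <oo) ((dd_time x a n <= t)%E%:R)%:E)%E.

(* The value 1 at gamma = 0 is the limit of the general expression. *)
Definition dd_rate (gamma a : R) : R :=
  if gamma == 0 then 1 else gamma * a / (expR (gamma * a) - 1).

(* theta * (theta + lambda * m) ^ (m - 1) * exp (- theta - lambda * m) / m!,
   where for m = 0 the factor theta * theta ^ (- 1) is read as 1, also in the
   degenerate case theta = 0. *)
Definition gen_poisson_pmf (theta lambda : R) (m : nat) : R :=
  (if m is m'.+1 then theta * (theta + lambda * m%:R) ^+ m' else 1) *
  expR (- theta - lambda * m%:R) / m`!%:R.

End drawdowns.

(* Main.v *)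
Require Import Defs.
From HB Require Import structures.
From mathcomp Require Import all_boot all_order all_algebra.
From mathcomp Require Import all_classical all_reals all_analysis.
From mathcomp Require Import measurable_realfun.
From mathcomp Require Import ring lra zify.
Import Order.TTheory GRing.Theory Num.Theory.
Import numFieldNormedType.Exports.
Set Implicit Arguments.
Unset Strict Implicit.
Unset Printing Implicit Defensive.
Local Open Scope classical_set_scope.
Local Open Scope ring_scope.

(** A drawdown with recovery is a drawdown at which the running maximum has increased since
the previous drawdown, a record; so the event is that the [(k + m)]-th drawdown is the [k]-th
record. Let [g] be the scale function and [f] smooth. Write [y] for the current drawdown and
[D] for the distance by which the maximum since the last drawdown time lies below the overall
maximum. Between two drawdown times, [f D + f' D * g y] as long as [D >= 0], continued by the
constant [f 0], is a martingale: [g (- X)] is one, and [D] decreases only while [y = 0], where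
the change of [f D] cancels the reflection term of [g y]. Hence the mean of [f] at a drawdown
time is the mean of [f 0] if the next drawdown is a record and of [f D + f' D * g a]
otherwise. The generalized Poisson masses solve the differential-difference equation
[f_q D + f_q' D * g a = f_{q-1} (D + a)], which makes the conditional probability of the event
a martingale along the drawdown times.

Instead of a stochastic integral, the stage is cut into [N] equal time steps: the sum of the
one-step errors is bounded, path by path, by the modulus of continuity of the path and by
the fourth moments of the increments, and both vanish as [N] grows. *)

(** * Running maxima and drawdown times *)

(** Why the law is generalized Poisson: until the next drawdown the maximum rises by an exponential
    amount of mean [g a], so, on the scale of this rise, drawdowns arrive at rate [1 / g a]. To set
    a record the path has to make up its depth [D], and every drawdown that comes earlier adds [a]
    to what is left. This is a single-server queue with initial work [D] and services of length [a];
    the number of arrivals before it empties is generalized Poisson with [theta = D / g a] and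
    [lambda = a / g a]. The depth is [0] at time zero, so the first drawdown is almost surely a
    record, and it is exactly [a] at each record; the other [k - 1] waiting periods add up to
    [theta = (k - 1) * lambda].

    Fourth moments are used because the second moments of the increments add up to the order of the
    time horizon whatever the mesh, while the fourth ones add up to [O(1 / N)]. Once the martingale
    increment is removed, a regular step leaves an error small compared with the rise of the maximum
    over it; these rises have a bounded sum on every path, so no quadratic variation enters. *)

Section running_max.
Context (R : realType).
Implicit Types (x : R -> R) (s t u : R).

Lemma running_max_attained x s t : continuous x -> s <= t ->
  exists2 u : R, s <= u <= t & x u = running_max x s t /\
    forall v, s <= v <= t -> x v <= running_max x s t.
Proof.
move=> cx st; have [u] := EVT_max st (continuous_subspaceT cx).
rewrite in_itv/= => ust umax; exists u => //.
have ub : ubound [set x v | v in `[s, t]] (x u).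
  by move=> _ [v /= vst <-]; exact: umax.
have nonempty : [set x v | v in `[s, t]] !=set0.
  by exists (x u), u => //=; rewrite in_itv.
have supE : x u = running_max x s t.
  apply/eqP; rewrite eq_le; apply/andP; split.
    apply: ub_le_sup; first by exists (x u).
    by exists u => //=; rewrite in_itv.
  exact: ge_sup.
by split=> // v vst; rewrite -supE; apply: umax; rewrite in_itv.
Qed.

Lemma running_max_ge x s t u : continuous x -> s <= u <= t ->
  x u <= running_max x s t.
Proof.
move=> cx /andP[su ut].
have [_ _ [_]] := running_max_attained cx (le_trans su ut).
by apply; rewrite su.
Qed.

Lemma running_max_le x s t c : continuous x -> s <= t ->
  (forall u, s <= u <= t -> x u <= c) -> running_max x s t <= c.
Proof. by move=> cx st xc; have [u /xc ? [<- _]] := running_max_attained cx st. Qed.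

Lemma running_max_id x s : continuous x -> running_max x s s = x s.
Proof.
move=> cx; have [u + [<- _]] := running_max_attained cx (lexx s).
by rewrite -eq_le => /eqP ->.
Qed.

Lemma running_max_split x s t u : continuous x -> s <= t -> t <= u ->
  running_max x s u = Num.max (running_max x s t) (running_max x t u).
Proof.
move=> cx st tu; have su := le_trans st tu.
apply/eqP; rewrite eq_le ge_max; apply/andP; split; last first.
  apply/andP; split; apply: running_max_le => // v /andP[v1 v2];
    apply: running_max_ge => //; apply/andP; split => //.
    exact: le_trans tu.
  exact: le_trans st v1.
apply: running_max_le => // v /andP[sv vu]; rewrite le_max.
have [vt|tv] := leP v t; first by rewrite running_max_ge ?sv.
by rewrite orbC running_max_ge ?vu ?(ltW tv).
Qed.

Lemma running_max_mono x s t u : continuous x -> s <= t -> t <= u ->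
  running_max x s t <= running_max x s u.
Proof. by move=> cx st tu; rewrite (running_max_split cx st tu) le_max lexx. Qed.

Lemma running_max_step x s t u : continuous x -> s <= t -> t <= u ->
  running_max x s u = running_max x s t \/
  exists v : R, [/\ t <= v <= u, running_max x s u = x v & running_max x s t < x v].
Proof.
move=> cx st tu; rewrite (running_max_split cx st tu).
have [v vtu [<- _]] := running_max_attained cx tu.
have [|] := leP (x v) (running_max x s t); first by left.
by right; exists v; split.
Qed.

Lemma eq_running_max x y s t : (forall u, s <= u <= t -> x u = y u) ->
  running_max x s t = running_max y s t.
Proof.
move=> xy; congr sup; apply/seteqP; split=> _ [u /= + <-];
  rewrite in_itv/= => ust; exists u; rewrite /= ?in_itv//.
  by rewrite xy.
by rewrite xy.
Qed.

Lemma continuous_at_epsilon x t e : continuous x -> 0 < e ->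
  exists2 d : R, 0 < d & forall u, `|u - t| < d -> `|x u - x t| < e.
Proof.
move=> cx e0; have /cvgrPdist_lt/(_ _ e0) := cx t.
rewrite near_nbhs => /nbhs_ballP[d /= d0 db]; exists d => // u ut.
by rewrite distrC; apply: db; rewrite /ball/= distrC.
Qed.

Lemma drawdown_right x a s e : continuous x -> 0 < a -> s <= e ->
  running_max x s e - x e < a ->
  exists2 d : R, 0 < d & forall t, e <= t -> t < e + d -> running_max x s t - x t < a.
Proof.
move=> cx a0 se hlt; set y := running_max x s e - x e in hlt.
have y0 : 0 <= y by rewrite subr_ge0 running_max_ge// se lexx.
have ep0 : 0 < (a - y) / 3 by lra.
have [d d0 hd] := continuous_at_epsilon e cx ep0.
exists d => // t et ted.
have hd' u : e <= u <= t -> `|x u - x e| < (a - y) / 3.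
  move=> /andP[eu ut]; apply: hd; rewrite ger0_norm; lra.
have xt : `|x t - x e| < (a - y) / 3 by apply: hd'; rewrite et lexx.
move: xt; rewrite ltr_norml => /andP[xt1 xt2].
have [->|[v [vt -> _]]] := running_max_step cx se et; first by rewrite /y in y0 hlt xt1 *; lra.
by move: (hd' _ vt); rewrite ltr_norml => /andP[? ?]; lra.
Qed.

(** With [drawdown_right] this makes the drawdown at the infimum exactly [a]: below [a], no time
    shortly after would qualify, and above [a], an earlier time would. *)
Lemma drawdown_left x a s e : continuous x -> 0 < a -> s <= e ->
  a < running_max x s e - x e ->
  exists t : R, [/\ s < t, t < e & a <= running_max x s t - x t].
Proof.
move=> cx a0 se hlt.
have [u /andP[su ue] [mE _]] := running_max_attained cx se.
have ep0 : 0 < running_max x s e - x e - a by lra.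
have [d d0 hd] := continuous_at_epsilon e cx ep0.
have ue' : u < e.
  by rewrite lt_neqAle ue andbT; apply/eqP => ueE; move: hlt; rewrite -mE ueE; lra.
(* A point between the argmax [u] and [e] sees the same maximum; within [d] of [e] the path has
   moved by less than the excess over [a]. *)
pose t := Num.max ((u + e) / 2) (e - d / 2).
have [tu te td] : [/\ u < t, t < e & `|t - e| < d].
  rewrite ltr_norml /t.
  by have [] := leP ((u + e) / 2) (e - d / 2); split; try (apply/andP; split); lra.
exists t; split => //; first exact: le_lt_trans tu.
have := hd _ td; rewrite ltr_norml => /andP[h1 h2].
have : running_max x s e <= running_max x s t.
  by rewrite -mE; apply: running_max_ge => //; rewrite su ltW.
lra.
Qed.

Definition drawdown_set x a s : set R :=
  [set t | s < t /\ a <= running_max x s t - x t].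

Lemma drawdown_inf x a s : continuous x -> 0 < a -> drawdown_set x a s !=set0 ->
  let e := inf (drawdown_set x a s) in
  [/\ s < e, running_max x s e - x e = a,
      forall t, s <= t -> t < e -> running_max x s t - x t < a &
      forall t, drawdown_set x a s t -> e <= t].
Proof.
move=> cx a0 ne0 e; set S := drawdown_set x a s.
have hlb : lbound S s by move=> t [/ltW].
have hi : has_inf S by split => //; exists s.
have se : s <= e by apply: lb_le_inf.
have eS t : S t -> e <= t by move=> St; apply: ge_inf => //; exists s.
have below t : s <= t -> t < e -> running_max x s t - x t < a.
  move=> st te; rewrite ltNge; apply/negP => yt.
  have : s < t.
    rewrite lt_neqAle st andbT; apply/eqP => stE; move: yt.
    by rewrite stE running_max_id//; lra.
  by move=> st'; have := eS _ (conj st' yt); lra.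
have ge_a : a <= running_max x s e - x e.
  rewrite leNgt; apply/negP => /(drawdown_right cx a0 se)[d d0 hd].
  have [t St ted] := inf_adherent d0 hi.
  have := hd _ (eS _ St) ted; case: St => _; lra.
have se' : s < e.
  rewrite lt_neqAle se andbT; apply/eqP => seE; move: ge_a.
  by rewrite -seE running_max_id//; lra.
split => //; apply/eqP; rewrite eq_le ge_a andbT leNgt; apply/negP.
move=> /(drawdown_left cx a0 se)[t [st te]].
have := below _ (ltW st) te; lra.
Qed.

End running_max.

Section drawdown_times.
Context (R : realType).
Implicit Types (x : R -> R) (a s t u : R) (n : nat).

(** Only [u] is confined to [[0, T]]: compactness is applied to a property of [u] and the radius, so
    [v] may leave the interval. *)
Lemma uniform_continuity x T e : continuous x -> 0 < e ->
  exists2 d : R, 0 < d & forall u v, 0 <= u <= T -> `|u - v| < d -> `|x u - x v| < e.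
Proof.
move=> cx e0.
have cpt : compact (`[0, T] : set R) by exact: segment_compact.
move/compact_near_coveringP : cpt => /(_ R (0^'+)
  (fun d u => forall v, `|u - v| < d -> `|x u - x v| < e) _).
case.
  move=> u0 _; have e20 : 0 < e / 2 by lra.
  have [d d0 hd] := continuous_at_epsilon u0 cx e20.
  have d20 : 0 < d / 2 by lra.
  exists (ball u0 (d / 2), [set d' | d' < d / 2]).
    by split; [exact: nbhsx_ballx|exact: nbhs_right_lt].
  move=> [u d'] [/= + d'd] v uv; rewrite /ball/= distrC => u0u.
  have hu : `|x u - x u0| < e / 2 by apply: hd; lra.
  have hv : `|x v - x u0| < e / 2.
    apply: hd; have -> : v - u0 = (u - u0) - (u - v) by ring.
    by rewrite (le_lt_trans (ler_normB _ _))//; lra.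
  have -> : x u - x v = (x u - x u0) - (x v - x u0) by ring.
  by rewrite (le_lt_trans (ler_normB _ _))//; lra.
move=> d0 /= d00 hd.
exists (d0 / 2); first by lra.
move=> u v u0T uv; apply: (hd (d0 / 2)) => //=; rewrite ?in_itv//=; last lra.
by rewrite /ball/= sub0r normrN gtr0_norm; lra.
Qed.

Lemma dd_time0 x a : dd_time x a 0 = 0%E.
Proof. by []. Qed.

Lemma dd_timeSy x a n : dd_time x a n = +oo%E -> dd_time x a n.+1 = +oo%E.
Proof.
move=> /= ->; rewrite (_ : [set t | _] = set0) ?image_set0 ?ereal_inf0//.
by apply/seteqP; split=> // t [].
Qed.

Lemma dd_timeS x a n s : continuous x -> 0 < a -> dd_time x a n = s%:E ->
  (dd_time x a n.+1 = +oo%E /\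
    forall t, s <= t -> running_max x s t - x t < a) \/
  exists e : R, [/\ dd_time x a n.+1 = e%:E, s < e, running_max x s e - x e = a &
     forall t, s <= t -> t < e -> running_max x s t - x t < a].
Proof.
move=> cx a0 /= ->; have -> : [set t | (s%:E < t%:E)%E /\
    a <= running_max x (fine s%:E) t - x t] = drawdown_set x a s.
  by apply/seteqP; split=> t /=; rewrite lte_fin.
have [S0|/set0P ne0] := eqVneq (drawdown_set x a s) set0; last first.
  right; have [se e1 e2 e3] := drawdown_inf cx a0 ne0.
  exists (inf (drawdown_set x a s)); split => //.
  by rewrite ereal_inf_EFin//; exists s => t [/ltW].
left; rewrite S0 image_set0 ereal_inf0; split=> // t.
rewrite le_eqVlt => /predU1P[<-|st]; first by rewrite running_max_id// subrr.
rewrite ltNge; apply/negP => yt.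
by have : drawdown_set x a s t by []; rewrite S0.
Qed.

Lemma dd_timeS_le x a n s t : continuous x -> 0 < a -> dd_time x a n = s%:E ->
  s <= t -> a <= running_max x s t - x t -> (dd_time x a n.+1 <= t%:E)%E.
Proof.
move=> cx a0 ns st yt; have [[_ /(_ _ st)]|[e [-> se _ ebelow]]] := dd_timeS cx a0 ns.
  by rewrite ltNge yt.
by rewrite lee_fin leNgt; apply/negP => /(ebelow _ st); rewrite ltNge yt.
Qed.

Lemma dd_time_fin x a n : continuous x -> 0 < a ->
  dd_time x a n = +oo%E \/ exists2 s : R, 0 <= s & dd_time x a n = s%:E.
Proof.
move=> cx a0; elim: n => [|n [/dd_timeSy|[s s0 ns]]]; first by right; exists 0.
  by left.
have [[-> _]|[e [-> se _ _]]] := dd_timeS cx a0 ns; first by left.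
by right; exists e => //; exact: le_trans (ltW se).
Qed.

Lemma dd_time_ge0 x a n : continuous x -> 0 < a -> (0 <= dd_time x a n)%E.
Proof. by move=> cx a0; have [->|[s s0 ->]] := dd_time_fin n cx a0. Qed.

Lemma dd_time_ltS x a n s : continuous x -> 0 < a -> dd_time x a n = s%:E ->
  (s%:E < dd_time x a n.+1)%E.
Proof.
move=> cx a0 ns.
by have [[-> _]|[e [-> se _ _]]] := dd_timeS cx a0 ns; rewrite ?ltry ?lte_fin.
Qed.

Lemma dd_time_le x a m n : continuous x -> 0 < a -> (m <= n)%N ->
  (dd_time x a m <= dd_time x a n)%E.
Proof.
move=> cx a0; elim: n => [|n IH]; first by rewrite leqn0 => /eqP ->.
rewrite leq_eqVlt => /predU1P[->//|/IH/le_trans]; apply.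
have [ny|[s _ ns]] := dd_time_fin n cx a0; first by rewrite (dd_timeSy ny) ny.
by rewrite ns ltW// dd_time_ltS.
Qed.

Lemma dd_time_fin_le x a m n e : continuous x -> 0 < a -> (m <= n)%N ->
  dd_time x a n = e%:E ->
  exists s : R, [/\ 0 <= s, s <= e & dd_time x a m = s%:E].
Proof.
move=> cx a0 mn ne; have := dd_time_le cx a0 mn; rewrite ne.
have [->//|[s s0 ->]] := dd_time_fin m cx a0.
by rewrite lee_fin; exists s.
Qed.

Lemma dd_time_lt x a m n s : continuous x -> 0 < a -> (m < n)%N ->
  dd_time x a m = s%:E -> (s%:E < dd_time x a n)%E.
Proof.
move=> cx a0 mn ms; apply: (lt_le_trans (dd_time_ltS cx a0 ms)).
exact: dd_time_le.
Qed.

(** Drawdown times cannot accumulate: between two of them the path falls by [a], which takes at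
    least the time [d] given by uniform continuity for the oscillation [a]. *)
Lemma dd_time_unbounded x a t : continuous x -> 0 < a ->
  exists n, (t%:E < dd_time x a n)%E.
Proof.
move=> cx a0; apply: contrapT => /forallNP H.
have {}H n : exists s, [/\ 0 <= s, s <= t & dd_time x a n = s%:E].
  have /negP := H n; rewrite -leNgt.
  have [->//|[s s0 ->]] := dd_time_fin n cx a0.
  by rewrite lee_fin => st; exists s.
have [d d0 hd] := uniform_continuity t cx a0.
have grow n s : dd_time x a n = s%:E -> n%:R * d <= s.
  elim: n s => [|n IH] e; first by rewrite mul0r dd_time0 => -[->].
  have [s [s0 st ns]] := H n; have [e' [e'0 e't ne]] := H n.+1.
  rewrite ne => -[<-]; have [|[e'' []]] := dd_timeS cx a0 ns; rewrite ne => -[]// <-.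
  move=> se ee _; have [u /andP[su ue] [xu _]] := running_max_attained cx (ltW se).
  have ud : d <= `|u - e'|.
    rewrite leNgt; apply/negP => /hd; rewrite (le_trans s0 su) (le_trans ue e't).
    by rewrite xu ee gtr0_norm// ltxx => /(_ isT).
  rewrite -natr1 mulrDl mul1r; have := IH _ ns.
  rewrite distrC ger0_norm in ud; lra.
have [s [s0 st ns]] := H (Num.truncn (t / d)).+1.
have := grow _ _ ns; have := truncnS_gt (t / d).
rewrite ltr_pdivrMr// => h1 h2.
by have := lt_le_trans h1 (le_trans h2 st); rewrite ltxx.
Qed.

Lemma dd_time_pred_lt x a t : continuous x -> 0 < a -> 0 < t ->
  exists n (s : R), [/\ dd_time x a n = s%:E, 0 <= s, s < t & (t%:E <= dd_time x a n.+1)%E].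
Proof.
move=> cx a0 t0.
have ex : exists n, (t%:E <= dd_time x a n)%E.
  by have [n /ltW] := dd_time_unbounded t cx a0; exists n.
have [[|n] ntt nmin] := ex_minnP ex; first by move: ntt; rewrite dd_time0 lee_fin leNgt t0.
exists n; have : (dd_time x a n < t%:E)%E.
  by rewrite ltNge; apply/negP => /nmin; rewrite ltnn.
by have [->//|[s s0 ->]] := dd_time_fin n cx a0; rewrite lte_fin => st; exists s.
Qed.

End drawdown_times.

(** * Records and drawdowns with recovery *)

Section records.
Context (R : realType).
Implicit Types (x : R -> R) (a s t u : R) (n k : nat).

(** At an infinite drawdown time [fine] returns [0] and this is [x 0]; [dd_record] therefore asks
    for finiteness. *)
Definition dd_max x a n : R := running_max x 0 (fine (dd_time x a n)).

Definition dd_record x a n : Prop :=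
  if n is n'.+1 then
    (dd_time x a n < +oo)%E /\ dd_max x a n' < dd_max x a n
  else False.

Definition dd_records x a n : nat := \sum_(i < n) `[< dd_record x a i.+1 >].

Lemma dd_recordsS x a n :
  dd_records x a n.+1 = (dd_records x a n + `[< dd_record x a n.+1 >])%N.
Proof. by rewrite /dd_records big_ord_recr. Qed.

Lemma dd_max_le x a m n e : continuous x -> 0 < a -> (m <= n)%N ->
  dd_time x a n = e%:E -> dd_max x a m <= dd_max x a n.
Proof.
move=> cx a0 mn ne; have [s [s0 se ms]] := dd_time_fin_le cx a0 mn ne.
by rewrite /dd_max ne ms /=; exact: running_max_mono.
Qed.

Lemma dd_maxS x a n s e : continuous x -> 0 < a -> dd_time x a n = s%:E ->
  dd_time x a n.+1 = e%:E ->
  dd_max x a n.+1 = Num.max (dd_max x a n) (running_max x s e).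
Proof.
move=> cx a0 ns ne; rewrite /dd_max ns ne /=.
have [s' [s0 se]] := dd_time_fin_le cx a0 (leqnSn n) ne.
by rewrite ns => -[?]; subst s'; exact: running_max_split.
Qed.

Lemma dd_max_norecord x a m n e : continuous x -> 0 < a -> (m <= n)%N ->
  dd_time x a n = e%:E ->
  (forall i, (m < i <= n)%N -> ~ dd_record x a i) -> dd_max x a n = dd_max x a m.
Proof.
move=> cx a0; elim: n e => [|n IH] e; first by rewrite leqn0 => /eqP ->.
rewrite leq_eqVlt => /predU1P[->//|]; rewrite ltnS => mn ne norec.
have [s [s0 se ns]] := dd_time_fin_le cx a0 (leqnSn n) ne.
rewrite -(IH s)//; last first.
  by move=> i /andP[mi iln]; apply: norec; rewrite mi (leq_trans iln).
apply/eqP; rewrite eq_le (dd_max_le cx a0 (leqnSn n) ne) andbT leNgt.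
apply/negP => lt; apply: (norec n.+1); first by rewrite ltnS mn leqnn.
by split => //; rewrite ne ltry.
Qed.

Lemma dd_records_norecord x a m n : (m <= n)%N ->
  (forall i, (m < i <= n)%N -> ~ dd_record x a i) ->
  dd_records x a n = dd_records x a m.
Proof.
elim: n => [|n IH]; first by rewrite leqn0 => /eqP ->.
rewrite leq_eqVlt => /predU1P[->//|]; rewrite ltnS => mn norec.
rewrite dd_recordsS asboolF ?addn0; last by apply: norec; rewrite ltnS mn leqnn.
by apply: IH => // i /andP[mi iln]; apply: norec; rewrite mi (leq_trans iln).
Qed.

Lemma dd_records_mono x a m n : (m <= n)%N ->
  (dd_records x a m <= dd_records x a n)%N.
Proof.
move/subnK => <-; elim: (n - m)%N => [|j IH]; first by rewrite add0n.
by rewrite addSn dd_recordsS (leq_trans IH)// leq_addr.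
Qed.

(* With no record at all, the index [0] plays the role of the last record. *)
Definition dd_record_index x a k n : Prop :=
  dd_records x a n = k /\ (n = 0%N \/ dd_record x a n).

Lemma dd_record_index_inj x a k m n :
  dd_record_index x a k m -> dd_record_index x a k n -> m = n.
Proof.
wlog mn : m n / (m <= n)%N.
  by move=> H; have [/H//|/ltnW/H] := leqP m n => H' ? ?; symmetry; apply: H'.
move: mn; rewrite leq_eqVlt => /predU1P[->//|mn] [rm _] [rn [n0|]].
  by rewrite n0 in mn.
case: n mn rn => // n; rewrite ltnS => mn rn recn.
have := dd_records_mono x a mn; move: rn; rewrite dd_recordsS asboolT// rm => <-.
by rewrite addn1 ltnn.
Qed.

Lemma dd_record_index_last x a n : exists2 p, (p <= n)%N &
  dd_record_index x a (dd_records x a n) p /\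
  forall i, (p < i <= n)%N -> ~ dd_record x a i.
Proof.
elim: n => [|n [p pn [[rp hp] norec]]].
  by exists 0%N => //; split; [split=> //; left|case].
have [recn|nrec] := pselect (dd_record x a n.+1).
  exists n.+1 => //; split; first by split => //; right.
  by move=> i /andP[/leq_trans h /h]; rewrite ltnn.
exists p; first exact: leqW.
split; first by split => //; rewrite dd_recordsS asboolF// addn0.
move=> i /andP[pi]; rewrite leq_eqVlt => /predU1P[->//|iln].
by apply: norec; rewrite pi.
Qed.

(** Look at the last drawdown time [q < t]. Unless a record already occurred after [p], the overall
    maximum has not moved up to [q], so the maximum at [t] is attained after [q]. The drawdown
    counted from [q] is then the global one, and the next drawdown is a record at [t]. *)
Lemma dd_time_rec_next x a k p s t : continuous x -> 0 < a ->
  dd_time_rec x a k = s%:E -> dd_time x a p = s%:E -> s < t ->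
  a <= running_max x 0 t - x t -> dd_max x a p < running_max x 0 t ->
  exists n (e : R), [/\ (p < n)%N, dd_record x a n, dd_time x a n = e%:E & e <= t].
Proof.
move=> cx a0 ks ps st yt pt.
have s0 : 0 <= s by have := dd_time_ge0 p cx a0; rewrite ps lee_fin.
have [i [q [iq q0 qt ti]]] := dd_time_pred_lt cx a0 (le_lt_trans s0 st).
have pi : (p <= i)%N.
  rewrite leqNgt; apply/negP => /(dd_time_le cx a0); rewrite ps => /(le_trans ti).
  by rewrite lee_fin leNgt st.
have [[j /andP[pj ji] recj]|nrec] := pselect (exists2 j, (p < j <= i)%N & dd_record x a j).
  have [e [e0 eq je]] := dd_time_fin_le cx a0 ji iq.
  by exists j, e; split => //; exact: le_trans (ltW qt).
have maxi : dd_max x a i = dd_max x a p.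
  by apply: (dd_max_norecord cx a0 pi iq) => j ji recj; apply: nrec; exists j.
have maxt : running_max x 0 t = running_max x q t.
  rewrite (running_max_split cx q0 (ltW qt)); apply/max_idPr.
  move: pt; rewrite -maxi /dd_max iq /= (running_max_split cx q0 (ltW qt)) lt_max ltxx/=.
  exact: ltW.
rewrite maxt in yt.
have := dd_timeS_le cx a0 iq (ltW qt) yt.
have [ny|[e e0 ne]] := dd_time_fin i.+1 cx a0; first by rewrite ny.
rewrite ne lee_fin => et; exists i.+1, e; split => //.
have {ti}te : t = e by apply/eqP; rewrite eq_le et -lee_fin -ne ti.
subst t; split; first by rewrite ne ltry.
by rewrite maxi {2}/dd_max ne.
Qed.

(** The record time is admissible for recovery, since the maximum since the previous drawdown is at
    most the global one; by [dd_time_rec_next] no earlier time is. *)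
Lemma dd_time_recS x a k p n : continuous x -> 0 < a ->
  dd_time_rec x a k = dd_time x a p ->
  (p < n)%N -> dd_record x a n -> (forall i, (p < i < n)%N -> ~ dd_record x a i) ->
  dd_time_rec x a k.+1 = dd_time x a n.
Proof.
move=> cx a0 kp; case: n => // n; rewrite ltnS => pn recn norec.
have [ny|[e e0 ne]] := dd_time_fin n.+1 cx a0; first by case: recn; rewrite ny.
have [q [q0 qe nq]] := dd_time_fin_le cx a0 (leqnSn n) ne.
have [s [s0 sq ps]] := dd_time_fin_le cx a0 pn nq.
have maxn : dd_max x a n = dd_max x a p.
  by apply: (dd_max_norecord cx a0 pn nq) => i /andP[pi iln]; apply: norec; rewrite pi ltnS.
have se : s < e.
  have := dd_time_lt cx a0 (pn : (p < n.+1)%N) ps.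
  by rewrite ne lte_fin.
have ee : running_max x q e - x e = a.
  by have [|[e' []]] := dd_timeS cx a0 nq; rewrite ne => -[]// ->.
rewrite ne /= kp ps /=; apply/eqP; rewrite eq_le; apply/andP; split.
  apply: ereal_inf_lbound; exists e => //; split.
  - by rewrite lte_fin.
  - rewrite -ee lerD2r (running_max_split cx q0 qe) le_max lexx orbT//.
  - have := recn.2; rewrite maxn {1}/dd_max ps /dd_max ne //.
apply: le_ereal_inf_tmp => _ [t [st yt pt] <-]; rewrite lte_fin in st.
have [i [e' [pi reci ie e't]]] := dd_time_rec_next cx a0 (etrans kp ps) ps st yt
  ltac:(by rewrite /dd_max ps).
rewrite lee_fin (le_trans _ e't)// -lee_fin -ne -ie; apply: dd_time_le => //.
by rewrite leqNgt; apply/negP => ni; apply: (norec i) => //; rewrite pi.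
Qed.

(** The alternative [+oo] in the second half is genuine: a path may have infinitely many drawdowns
    and still stop setting records. *)
Lemma dd_time_rec_indexP x a k : continuous x -> 0 < a ->
  (forall n, (dd_time x a n < +oo)%E -> dd_record_index x a k n ->
     dd_time_rec x a k = dd_time x a n) /\
  (dd_time_rec x a k = +oo%E \/ exists n,
     [/\ (dd_time x a n < +oo)%E, dd_record_index x a k n &
      dd_time_rec x a k = dd_time x a n]).
Proof.
move=> cx a0; elim: k => [|k [IH1 IH2]].
  have i0 : dd_record_index x a 0 0.
    by split; [rewrite /dd_records big_ord0|left].
  split; last by right; exists 0%N; split => //; rewrite dd_time0 ltry.
  by move=> n _ /(dd_record_index_inj i0) <-.
split=> [n nfin [rn [n0|recn]]|].
  by move: rn; rewrite n0 /dd_records big_ord0.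
  case: n nfin rn recn => // n nfin + recn.
  rewrite dd_recordsS asboolT// addn1 => -[rn].
  have [p pn [ip norec]] := dd_record_index_last x a n; rewrite rn in ip.
  apply: (@dd_time_recS x a k p) => //; apply: IH1 => //.
  exact: (le_lt_trans (dd_time_le cx a0 (leqW pn))).
have [//|] := eqVneq (dd_time_rec x a k.+1) +oo%E; [by left|move=> kfin; right].
case: IH2 => [ky|[p [pfin ip kp]]].
  case/eqP: kfin; rewrite /= ky (_ : [set t | _] = set0) ?image_set0 ?ereal_inf0//.
  by apply/seteqP; split=> // t [].
have [py|[s s0 ps]] := dd_time_fin p cx a0; first by rewrite py in pfin.
(* A finite infimum comes from a nonempty set, and any of its points produces a record; the first
   record after [p] is the wanted index. *)
have [t [st yt pt]] : exists t, [/\ s < t, a <= running_max x 0 t - x t &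
    dd_max x a p < running_max x 0 t].
  apply: contrapT => /forallNP H; case/eqP: kfin.
  rewrite /= kp (_ : [set t | _] = set0) ?image_set0 ?ereal_inf0//.
  apply/seteqP; split=> // t /= [st yt pt]; apply: (H t).
  by rewrite ps lte_fin in st; split.
have [i [e' [pi reci _ _]]] := dd_time_rec_next cx a0 (etrans kp ps) ps st yt pt.
have ex : exists i, (p < i)%N && `[< dd_record x a i >].
  by exists i; rewrite pi; apply/asboolP.
have [n /andP[pn /asboolP recn] nmin] := ex_minnP ex.
have norec i' : (p < i' < n)%N -> ~ dd_record x a i'.
  move=> /andP[pi' i'n] /asboolP reci'.
  by have := nmin i'; rewrite pi' reci' => /(_ isT); rewrite leqNgt i'n.
exists n; split.
- by case: (n) recn => [//|m []].
- split; last by right.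
  case: n {nmin ex} pn recn norec => // n; rewrite ltnS => pn recn norec.
  rewrite dd_recordsS asboolT// addn1 -ip.1; congr S.
  by apply: dd_records_norecord => // i' /andP[pi' i'n]; apply: norec; rewrite pi' ltnS.
- exact: (dd_time_recS cx a0 kp).
Qed.

End records.

(** * Counting drawdowns, and dependence on the path up to a given time *)

Section counts.
Context (R : realType).
Implicit Types (x : R -> R) (a s t u : R) (n k : nat).

Lemma dd_count_ge x a (t : \bar R) n : (forall i, (0 < i <= n)%N -> (dd_time x a i <= t)%E) ->
  (n%:R%:E <= dd_count x a t)%E.
Proof.
move=> le_t; rewrite /dd_count (@nneseries_split _ _ 1 n); last first.
  by move=> k _; rewrite lee_fin ler0n.
rewrite (eq_big_nat _ _ (F2 := fun=> 1%:E)).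
  rewrite sumEFin sumr_const_nat addKn leeDl//.
  by apply: nneseries_ge0 => k _ _; rewrite lee_fin ler0n.
by move=> i /andP[i0 iln]; rewrite le_t// i0 -ltnS -add1n.
Qed.

Lemma dd_count_fin x a n e : continuous x -> 0 < a -> dd_time x a n = e%:E ->
  dd_count x a e%:E = n%:R%:E.
Proof.
move=> cx a0 ne; apply/eqP; rewrite eq_le; apply/andP; split; last first.
  by apply: dd_count_ge => i /andP[_ iln]; rewrite -ne dd_time_le.
rewrite /dd_count (@nneseries_split _ _ 1 n); last first.
  by move=> k _; rewrite lee_fin ler0n.
rewrite eseries0 ?adde0; last first.
  by move=> i; rewrite add1n => ni _; rewrite leNgt (dd_time_lt cx a0 ni ne).
rewrite sumEFin lee_fin (le_trans (ler_sum_nat (G := fun=> 1) _)) ?sumr_const_nat ?addKn//.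
by move=> i _; rewrite lern1 leq_b1.
Qed.

Lemma dd_county x a : dd_count x a +oo%E = +oo%E.
Proof.
have ge_n n : (n%:R%:E <= dd_count x a +oo)%E by apply: dd_count_ge => i _; exact: leey.
apply/eqyP => r r0; apply: le_trans (ge_n (Num.truncn r).+1).
by rewrite lee_fin ltW// truncnS_gt.
Qed.

Lemma dd_count_recP x a k n : continuous x -> 0 < a ->
  dd_count x a (dd_time_rec x a k) = n%:R%:E <->
  (dd_time x a n < +oo)%E /\ dd_record_index x a k n.
Proof.
move=> cx a0; have [H1 H2] := dd_time_rec_indexP k cx a0; split; last first.
  move=> [nfin ni]; rewrite (H1 n nfin ni); move: nfin.
  have [->//|[e e0 ne] _] := dd_time_fin n cx a0.
  by rewrite ne (dd_count_fin cx a0 ne).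
case: H2 => [->|[p [pfin ip ->]]]; first by rewrite dd_county.
move: (pfin); have [->//|[e e0 pe] _] := dd_time_fin p cx a0.
rewrite pe (dd_count_fin cx a0 pe) => -[/eqP]; rewrite eqr_nat => /eqP <-.
by rewrite pe ltry.
Qed.

(** The second alternative, both times infinite, is there because the equivalence holds for every
    path; it turns out to have probability zero. *)
Lemma dd_time_recP x a k n : continuous x -> 0 < a ->
  dd_time_rec x a k = dd_time x a n <->
  ((dd_time x a n < +oo)%E /\ dd_record_index x a k n) \/
  (dd_time x a n = +oo%E /\
   forall i, (i < n)%N -> ~ ((dd_time x a i < +oo)%E /\ dd_record_index x a k i)).
Proof.
move=> cx a0; have [H1 H2] := dd_time_rec_indexP k cx a0.
have [ne|[e e0 ne]] := dd_time_fin n cx a0; rewrite ne.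
  split; last first.
    move=> [[//]|[_ none]]; case: H2 => [//|[p [pfin ip _]]].
    exfalso; apply: (none p) => //; rewrite ltnNge; apply/negP => np.
    by have := dd_time_le cx a0 np; rewrite ne leNgt pfin.
  move=> ky; right; split => // i _ [ifin ii].
  by have := ifin; rewrite -(H1 i ifin ii) ky.
rewrite ltry; split=> [ke|[[_ ni]|[]//]].
  left; split => //; case: H2 => [|[p [pfin ip kp]]]; first by rewrite ke.
  suff -> : n = p by [].
  have pe : dd_time x a p = e%:E by rewrite -kp.
  apply/eqP; rewrite eqn_leq; apply/andP; split; rewrite leqNgt; apply/negP.
    by move=> /(dd_time_lt cx a0)/(_ pe); rewrite ne ltxx.
  by move=> /(dd_time_lt cx a0)/(_ ne); rewrite pe ltxx.
by rewrite (H1 n) ?ne ?ltry.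
Qed.

Lemma dd_timeE_ge0 x a n : (0 <= dd_time x a n)%E.
Proof.
elim: n => [//|n IH] /=; apply: le_ereal_inf_tmp => _ [t [nt _] <-].
exact: le_trans IH (ltW nt).
Qed.

Lemma dd_time_recE_ge0 x a n : (0 <= dd_time_rec x a n)%E.
Proof.
elim: n => [//|n IH] /=; apply: le_ereal_inf_tmp => _ [t [nt _ _] <-].
exact: le_trans IH (ltW nt).
Qed.

Lemma eq_dd_time x y a n : (forall t, 0 <= t -> x t = y t) ->
  dd_time x a n = dd_time y a n.
Proof.
move=> xy; elim: n => [//|n IH] /=; rewrite -IH.
have n0 := dd_timeE_ge0 x a n.
have f0 : 0 <= fine (dd_time x a n) by rewrite fine_ge0.
congr (ereal_inf [set t%:E | t in _]); apply/seteqP; split=> t /= [nt].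
  rewrite (eq_running_max (y := y)) ?xy//; first by move/(le_lt_trans n0)/ltW: nt; rewrite lee_fin.
  by move=> u /andP[fu _]; apply: xy; exact: le_trans fu.
rewrite (eq_running_max (x := x) (y := y)) ?xy//.
  by move/(le_lt_trans n0)/ltW: nt; rewrite lee_fin.
by move=> u /andP[fu _]; apply: xy; exact: le_trans fu.
Qed.

Lemma eq_dd_time_rec x y a n : (forall t, 0 <= t -> x t = y t) ->
  dd_time_rec x a n = dd_time_rec y a n.
Proof.
move=> xy; have rxy t : running_max x 0 t = running_max y 0 t.
  by apply: eq_running_max => u /andP[u0 _]; exact: xy.
elim: n => [//|n IH] /=; rewrite -IH.
have n0 := dd_time_recE_ge0 x a n.
congr (ereal_inf [set t%:E | t in _]); apply/seteqP; split=> t /= [nt].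
  by rewrite !rxy ?xy//; move/(le_lt_trans n0)/ltW: nt; rewrite lee_fin.
by rewrite !rxy ?xy//; move/(le_lt_trans n0)/ltW: nt; rewrite lee_fin.
Qed.

Lemma eq_dd_count x y a (t : \bar R) : (forall t, 0 <= t -> x t = y t) ->
  dd_count x a t = dd_count y a t.
Proof.
by move=> xy; apply: eq_eseriesr => n _; rewrite (eq_dd_time _ _ xy).
Qed.

(** The stopping time property, path by path; it is what makes the stage functionals adapted. *)
Lemma dd_time_local x y a n t : continuous x -> continuous y -> 0 < a ->
  (forall u, 0 <= u <= t -> x u = y u) ->
  (dd_time x a n <= t%:E)%E -> dd_time y a n = dd_time x a n.
Proof.
elim: n x y => [//|n IH] x y cx cy a0 xy.
(* One inequality suffices: once [y] is known to have its drawdown by time [e], the same argument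
   applies with the two paths exchanged. *)
suff le_t z z' e : continuous z -> continuous z' ->
    (forall u, 0 <= u <= t -> z u = z' u) -> e <= t ->
    dd_time z a n.+1 = e%:E -> (dd_time z' a n.+1 <= e%:E)%E.
  have [->//|[e e0 ne]] := dd_time_fin n.+1 cx a0; rewrite ne lee_fin => et.
  have le1 := le_t x y e cx cy xy et ne.
  apply/eqP; rewrite eq_le le1 andTb; move: le1.
  have [->//|[e' e'0 ne']] := dd_time_fin n.+1 cy a0; rewrite ne' !lee_fin => e'e.
  rewrite -lee_fin -ne; apply: (le_t y x) => //; last exact: le_trans et.
  by move=> u ut; rewrite xy.
move=> cz cz' zz' et ne; have [s [s0 se ns]] := dd_time_fin_le cz a0 (leqnSn n) ne.
have ns' : dd_time z' a n = s%:E.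
  by rewrite -ns; apply: IH => //; rewrite ns lee_fin (le_trans se).
apply: (dd_timeS_le cz' a0 ns' se).
have [|[e' []]] := dd_timeS cz a0 ns; rewrite ne => -[]// <- _ <- _.
rewrite (eq_running_max (y := z')) ?zz' ?et ?(le_trans s0 se)//.
by move=> u /andP[su ue]; rewrite zz'// (le_trans s0 su) (le_trans ue et).
Qed.

Lemma dd_max_local x y a n t : continuous x -> continuous y -> 0 < a ->
  (forall u, 0 <= u <= t -> x u = y u) ->
  (dd_time x a n <= t%:E)%E -> dd_max y a n = dd_max x a n.
Proof.
move=> cx cy a0 xy nt; rewrite /dd_max (dd_time_local cx cy a0 xy nt).
apply: eq_running_max => u /andP[u0]; move: nt.
have [->//|[e e0 ->]] := dd_time_fin n cx a0; rewrite lee_fin/= => et ue.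
by rewrite xy// u0 (le_trans ue).
Qed.

Lemma dd_records_local x y a n t : continuous x -> continuous y -> 0 < a ->
  (forall u, 0 <= u <= t -> x u = y u) ->
  (dd_time x a n <= t%:E)%E -> dd_records y a n = dd_records x a n.
Proof.
move=> cx cy a0 xy; elim: n => [|n IH] nt; first by rewrite /dd_records !big_ord0.
have nt' := le_trans (dd_time_le cx a0 (leqnSn n)) nt.
rewrite !dd_recordsS IH//; congr (_ + nat_of_bool _)%N; apply: asbool_equiv_eq.
by rewrite /dd_record (dd_time_local cx cy a0 xy nt) !(dd_max_local cx cy a0 xy).
Qed.

End counts.

(** * Measurability of path functionals *)

Lemma continuous_running_max (R : realType) (x : R -> R) s : continuous x ->
  continuous (fun t => running_max x s (Num.max s t)).
Proof.
move=> cx t; apply/cvgrPdist_lt => e e0.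
have e30 : 0 < e / 3 by lra.
have [d d0 hd] := continuous_at_epsilon (Num.max s t) cx e30.
have close p q : s <= p -> p <= q -> `|p - Num.max s t| < d ->
    `|q - Num.max s t| < d -> `|running_max x s q - running_max x s p| < e.
  move=> sp pq pd qd.
  rewrite ger0_norm ?subr_ge0 ?running_max_mono//.
  have xp := running_max_ge cx (introT andP (conj sp (lexx p))).
  have [->|[v [/andP[pv vq] -> _]]] := running_max_step cx sp pq; first by rewrite subrr.
  have vd : `|v - Num.max s t| < d.
    move: pd qd; rewrite !ltr_norml => /andP[? ?] /andP[? ?].
    by apply/andP; split; lra.
  by move: (hd _ vd) (hd _ pd); rewrite !ltr_norml => /andP[? ?] /andP[? ?]; lra.
exists d => //= u; rewrite /ball/= => tu.
have md : `|Num.max s u - Num.max s t| < d.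
  apply: le_lt_trans tu; have [su|us] := leP s u; have [st|ts] := leP s t => //.
  - by rewrite distrC.
  - by rewrite [leRHS]distrC !ger0_norm; lra.
  - by rewrite ler0_norm ?ger0_norm; lra.
  - by rewrite subrr normr0.
have ms v : s <= Num.max s v by rewrite le_max lexx.
have md0 : `|Num.max s t - Num.max s t| < d by rewrite subrr normr0.
have [tu'|ut] := leP (Num.max s t) (Num.max s u).
  by rewrite distrC; exact: close.
by apply: close => //; exact: ltW.
Qed.

Section path_functionals.
Context (R : realType) (d : measure_display) (T : measurableType d).
Variable Y : R -> T -> R.
Hypothesis mY : forall t, measurable_fun setT (Y t).
Hypothesis cY : forall w, continuous (Y^~ w).

Lemma measurable_fun_preimage_oo (f : T -> R) :
  (forall c : R, measurable [set w | c < f w]) -> measurable_fun setT f.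
Proof.
move=> H; apply: (measurability _ (RGenOInfty.measurableE R)).
move=> _ [_ [c ->] <-]; rewrite setTI.
have -> : f @^-1` `]c, +oo[ = [set w | c < f w]; last exact: H.
by apply/seteqP; split=> w /=; rewrite in_itv/= andbT.
Qed.

Lemma emeasurable_fun_preimage_le (f : T -> \bar R) : (forall w, (0 <= f w)%E) ->
  (forall t : R, measurable [set w | (f w <= t%:E)%E]) -> measurable_fun setT f.
Proof.
move=> f0 H; apply: (measurability _ (ErealGenOInfty.measurableE R)).
move=> _ [_ [c ->] <-]; rewrite setTI.
have -> : f @^-1` `]c%:E, +oo[ = ~` [set w | (f w <= c%:E)%E].
  by apply/seteqP; split=> w /=; rewrite in_itv/= andbT ltNge => /negP.
exact: measurableC.
Qed.

(** Round the random time down to a grid of mesh [1 / n.+1]: the rounded evaluation is measurable,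
    being glued from countably many pieces, and it converges by continuity of the paths. *)
Lemma measurable_path_eval (s : T -> R) : measurable_fun setT s ->
  measurable_fun setT (fun w => Y (s w) w).
Proof.
move=> ms; pose sn (n : nat) w := (Num.floor (s w * n.+1%:R))%:~R / n.+1%:R : R.
apply: (@measurable_fun_cvg _ _ _ _ (fun n w => Y (sn n w) w)); last first.
  move=> w _; apply: (@cvg_comp _ _ _ (sn^~ w) (Y^~ w) _ (nbhs (s w))); last exact: cY.
  apply/cvgrPdist_lt => e e0; near=> n.
  have n0 : 0 < n.+1%:R :> R by [].
  have -> : s w - sn n w = (s w * n.+1%:R - (Num.floor (s w * n.+1%:R))%:~R) / n.+1%:R.
    by rewrite /sn mulrBl mulfK// gt_eqF.
  have /andP[f1 f2] := real_floor_itv (num_real (s w * n.+1%:R)).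
  rewrite ger0_norm ?divr_ge0 ?subr_ge0// ltr_pdivrMr//.
  apply: (@lt_trans _ _ 1); first by rewrite intrD in f2; lra.
  rewrite mulrC -ltr_pdivrMr// div1r -natr1.
  near: n; exists (Num.truncn e^-1) => // n /= hn.
  have := truncnS_gt e^-1; rewrite -natr1 => /lt_le_trans; apply.
  by rewrite lerD2r ler_nat.
move=> n _ B mB; rewrite setTI.
have -> : (fun w => Y (sn n w) w) @^-1` B = \bigcup_(z in [set: int])
    ([set w | z%:~R <= s w * n.+1%:R < (z + 1)%:~R] `&` (Y (z%:~R / n.+1%:R) @^-1` B)).
  apply/seteqP; split=> w /=.
    move=> Bw; exists (Num.floor (s w * n.+1%:R)) => //; split => //=.
    exact: (real_floor_itv (num_real _)).
  by move=> [z _ [/= zw]]; rewrite /sn (floor_def zw).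
apply: countable_bigcupT_measurable => // z; apply: measurableI; last first.
  by rewrite -[X in measurable X]setTI; exact: mY.
have -> : [set w | z%:~R <= s w * n.+1%:R < (z + 1)%:~R] =
   (fun w => s w * n.+1%:R) @^-1` `[z%:~R, (z + 1)%:~R[%classic.
  by apply/seteqP; split=> w /=; rewrite in_itv.
rewrite -[X in measurable X]setTI.
have mf : measurable_fun setT (fun w => s w * n.+1%:R).
  by apply: measurable_funM => //; exact: measurable_cst.
by apply: mf.
Unshelve. all: by end_near. Qed.

Lemma measurable_running_max (s t : T -> R) : measurable_fun setT s ->
  measurable_fun setT t -> (forall w, s w <= t w) ->
  measurable_fun setT (fun w => running_max (Y^~ w) (s w) (t w)).
Proof.
move=> ms mt st; apply: measurable_fun_preimage_oo => c.
(* Rational convex combinations of the two random end points are dense in the interval, and the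
   clamp keeps them inside; a strict lower bound on the maximum is witnessed at one of them. *)
pose u (q : rat) w := s w + Num.max 0 (Num.min 1 (ratr q)) * (t w - s w) : R.
have -> : [set w | c < running_max (Y^~ w) (s w) (t w)] =
    \bigcup_q [set w | c < Y (u q w) w].
  apply/seteqP; split=> w /=; last first.
    move=> [q _ /= cu]; apply: (lt_le_trans cu).
    apply: running_max_ge => //; rewrite /u.
    set z := Num.max _ _; have z0 : 0 <= z by rewrite le_max lexx.
    have z1 : z <= 1 by rewrite ge_max ler01/= ge_min lexx.
    have := st w; rewrite -subr_ge0 => ts.
    rewrite lerDl mulr_ge0//= -lerBrDl -[leRHS]mul1r ler_wpM2r//.
  have [v /andP[sv vt] [<- _]] := running_max_attained (@cY w) (st w) => cv.
  have [stE|stN] := eqVneq (s w) (t w).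
    exists 0 => //=; rewrite /u stE subrr mulr0 addr0.
    by have -> : t w = v by apply/eqP; rewrite eq_le vt -stE sv.
  have ts0 : 0 < t w - s w by rewrite subr_gt0 lt_neqAle stN st.
  have cv0 : 0 < Y v w - c by lra.
  have [e e0 he] := continuous_at_epsilon v (@cY w) cv0.
  pose z0 := (v - s w) / (t w - s w).
  have z00 : 0 <= z0 by rewrite divr_ge0 ?subr_ge0.
  have z01 : z0 <= 1 by rewrite ler_pdivrMr// mul1r lerD2r.
  have [q] : exists q : rat, ratr q \in `]z0, z0 + e / (t w - s w)[.
    by apply: rat_in_itvoo; rewrite ltrDl divr_gt0.
  rewrite in_itv/= => /andP[q1 q2]; exists q => //=.
  have : `|u q w - v| < e.
    have -> : u q w - v = (Num.max 0 (Num.min 1 (ratr q)) - z0) * (t w - s w).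
      by rewrite /u mulrBl /z0 divfK ?gt_eqF//; ring.
    rewrite normrM (gtr0_norm ts0) -ltr_pdivlMr// ger0_norm ?subr_ge0.
      rewrite ltrBlDl; apply: le_lt_trans q2.
      by rewrite ge_max ge_min lexx orbT (le_trans z00 (ltW q1)).
    by rewrite le_max le_min z01 (ltW q1) orbT.
  by move=> /he; rewrite ltr_norml => /andP[]; lra.
apply: countable_bigcupT_measurable => // q.
have mu : measurable_fun setT (fun w => Y (u q w) w).
  apply: measurable_path_eval; apply: measurable_funD => //.
  by apply: measurable_funM => //; exact: measurable_funB.
rewrite -[X in measurable X]setTI.
have -> : [set w | c < Y (u q w) w] = (fun w => Y (u q w) w) @^-1` `]c, +oo[.
  by apply/seteqP; split=> w /=; rewrite in_itv/= andbT.
exact: mu.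
Qed.



End path_functionals.

Section drawdown_measurability.
Context (R : realType) (d : measure_display) (T : measurableType d).
Variable Y : R -> T -> R.
Hypothesis mY : forall t, measurable_fun setT (Y t).
Hypothesis cY : forall w, continuous (Y^~ w).

Variable a : R.
Hypothesis a0 : 0 < a.

Lemma measurable_set_le (f g : T -> R) : measurable_fun setT f ->
  measurable_fun setT g -> measurable [set w | f w <= g w].
Proof.
move=> mf mg; rewrite -[X in measurable X]setTI.
exact: (measurable_fun_ler mf mg measurableT).
Qed.

(** The interval [[s w, t]] is reparametrized by [[0, 1]]. The drawdown becomes a process [Z] with
    continuous paths, and the existence of [r] becomes a lower bound on its maximum over a
    deterministic interval. *)
Lemma measurable_drawdown_by (s : T -> R) t : measurable_fun setT s ->
  measurable [set w | s w <= t /\ exists2 r : R, s w <= r <= t &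
     a <= running_max (Y^~ w) (s w) r - Y r w].
Proof.
move=> ms; pose z w (r : R) := s w + Num.max 0 (Num.min 1 r) * Num.max 0 (t - s w).
pose Z r w := running_max (Y^~ w) (s w) (z w r) - Y (z w r) w.
have sz w r : s w <= z w r by rewrite lerDl mulr_ge0// le_max lexx.
have mz r : measurable_fun setT (z^~ r).
  apply: measurable_funD => //; apply: measurable_funM => //.
  by apply: measurable_maxr => //; exact: measurable_funB.
have mZ r : measurable_fun setT (Z r).
  apply: measurable_funB; first exact: (measurable_running_max mY cY).
  exact: (measurable_path_eval mY cY).
have cz w : continuous (z w).
  move=> r; apply: cvgD; first exact: cvg_cst.
  apply: cvgM; last exact: cvg_cst.
  have : {for r, continuous ((fun=> 0 : R) \max ((fun=> 1 : R) \min id))}.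
    apply: continuous_max; first exact: cvg_cst.
    by apply: continuous_min; [exact: cvg_cst|exact: cvg_id].
  exact.
have crm w : continuous (fun r => running_max (Y^~ w) (s w) (z w r)).
  have -> : (fun r => running_max (Y^~ w) (s w) (z w r)) =
      (fun t => running_max (Y^~ w) (s w) (Num.max (s w) t)) \o z w.
    by apply/funext => q /=; rewrite (max_idPr _).
  move=> q; apply: continuous_comp; first exact: cz.
  by apply: continuous_running_max; exact: cY.
have cZ w : continuous (Z^~ w).
  move=> r; apply: cvgB; first exact: crm.
  by apply: (@continuous_comp _ _ _ (z w) (Y^~ w)); [exact: cz|exact: cY].
have mm : measurable_fun setT (fun w => running_max (Z^~ w) 0 1).
  exact: (measurable_running_max mZ cZ (s := fun=> 0) (t := fun=> 1)).
have -> : [set w | s w <= t /\ exists2 r : R, s w <= r <= t &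
    a <= running_max (Y^~ w) (s w) r - Y r w] =
    [set w | s w <= t] `&` [set w | a <= running_max (Z^~ w) 0 1].
  apply/seteqP; split=> w /= -[st].
    move=> [r /andP[sr rt] ar]; split => //.
    have zr : exists2 q, 0 <= q <= 1 & z w q = r.
      have ts : 0 <= t - s w by rewrite subr_ge0.
      have [stE|stN] := eqVneq (t - s w) 0.
        exists 0; first by rewrite lexx ler01.
        rewrite /z stE maxxx mulr0 addr0; lra.
      have ts0 : 0 < t - s w by rewrite lt_neqAle eq_sym stN.
      exists ((r - s w) / (t - s w)).
        by rewrite divr_ge0 ?subr_ge0//= ler_pdivrMr// mul1r lerD2r.
      rewrite /z (max_idPr ts) (min_idPr _) ?(max_idPr _) ?divr_ge0 ?subr_ge0//.
        by rewrite divfK//; ring.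
      by rewrite ler_pdivrMr// mul1r lerD2r.
    move: zr => [q q01 zq]; apply: le_trans ar _.
    by rewrite -zq; exact: (@running_max_ge _ (Z^~ w) 0 1 q (cZ w)).
  have [q /andP[q0 q1] [<- _]] := running_max_attained (cZ w) (ler01 : 0 <= 1 :> R).
  move=> ar; split => //; exists (z w q) => //; rewrite sz/=.
  rewrite /z (min_idPr q1) (max_idPr q0) (max_idPr _) ?subr_ge0//.
  by rewrite -lerBrDl ler_piMl// subr_ge0.
apply: measurableI; first exact: measurable_set_le.
exact: measurable_set_le.
Qed.

Lemma measurable_dd_time n : measurable_fun setT (fun w => dd_time (Y^~ w) a n).
Proof.
elim: n => [|n IH]; first exact: measurable_cst.
apply: emeasurable_fun_preimage_le => [w|t]; first exact: dd_timeE_ge0.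
have -> : [set w | (dd_time (Y^~ w) a n.+1 <= t%:E)%E] =
  [set w | (dd_time (Y^~ w) a n <= t%:E)%E] `&`
  [set w | fine (dd_time (Y^~ w) a n) <= t /\ exists2 r : R,
     fine (dd_time (Y^~ w) a n) <= r <= t &
     a <= running_max (Y^~ w) (fine (dd_time (Y^~ w) a n)) r - Y r w].
  apply/seteqP; split=> w.
    rewrite [X in X w -> _]/mkset => nt; split.
      by rewrite /mkset (le_trans _ nt)// dd_time_le.
    have [nE|[e e0 ne]] := dd_time_fin n.+1 (@cY w) a0; first by rewrite nE in nt.
    have [s [s0 se ns]] := dd_time_fin_le (@cY w) a0 (leqnSn n) ne.
    have et : e <= t by rewrite -lee_fin -ne.
    rewrite /mkset ns; split; first exact: le_trans et.
    exists e; first by rewrite se.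
    by have [|[e' []]] := dd_timeS (@cY w) a0 ns; rewrite ne => -[]// <- _ -> _.
  rewrite [X in _ -> X w]/mkset; case; rewrite [X in X -> _]/mkset => nt.
  move=> [_ [r /andP[sr rt] ar]].
  have [nE|[e e0 ne]] := dd_time_fin n (@cY w) a0; first by rewrite nE in nt.
  rewrite ne/= in sr ar; rewrite (le_trans (dd_timeS_le (@cY w) a0 ne sr ar))//.
apply: measurableI.
  by have := emeasurable_fun_infty_c measurableT IH t%:E; rewrite setTI.
apply: measurable_drawdown_by.
exact: (measurableT_comp (fine_measurable measurableT) IH).
Qed.

Lemma measurable_fine_dd_time n :
  measurable_fun setT (fun w => fine (dd_time (Y^~ w) a n)).
Proof.
exact: (measurableT_comp (fine_measurable measurableT) (measurable_dd_time n)).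
Qed.

Lemma measurable_dd_max n : measurable_fun setT (fun w => dd_max (Y^~ w) a n).
Proof.
apply: (measurable_running_max mY cY (s := fun=> 0)) => //; first exact: measurable_fine_dd_time.
by move=> w; rewrite fine_ge0 ?dd_timeE_ge0.
Qed.

Lemma measurable_dd_time_lty n : measurable [set w | (dd_time (Y^~ w) a n < +oo)%E].
Proof.
by have := emeasurable_fun_infty_o measurableT (measurable_dd_time n) +oo%E; rewrite setTI.
Qed.

Lemma measurable_dd_record n : measurable [set w | dd_record (Y^~ w) a n].
Proof.
case: n => [|n]; first by rewrite (_ : [set w | _] = set0).
apply: (measurableI _ _ (measurable_dd_time_lty n.+1)).
rewrite -[X in measurable X]setTI.
exact: (measurable_fun_ltr (measurable_dd_max n) (measurable_dd_max n.+1) measurableT).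
Qed.

Lemma measurable_dd_records n r : measurable [set w | dd_records (Y^~ w) a n = r].
Proof.
elim: n r => [|n IH] r.
  have [<-|r0] := eqVneq 0%N r.
    rewrite (_ : [set w | _] = setT)//; apply/seteqP; split=> // w _ /=.
    by rewrite /dd_records big_ord0.
  rewrite (_ : [set w | _] = set0)//; apply/seteqP; split=> // w /=.
  by rewrite /dd_records big_ord0 => /eqP; rewrite (negbTE r0).
have mrec := measurable_dd_record n.+1.
(* The factor [0 < r] discards the value [r.-1 = 0] at [r = 0]. *)
have -> : [set w | dd_records (Y^~ w) a n.+1 = r] =
    ([set w | dd_records (Y^~ w) a n = r] `&` ~` [set w | dd_record (Y^~ w) a n.+1])
    `|` ([set w | dd_records (Y^~ w) a n = r.-1] `&` [set w | dd_record (Y^~ w) a n.+1]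
         `&` [set w | (0 < r)%N]).
  apply/seteqP; split=> w; rewrite [X in X w -> _]/mkset ?[X in _ -> X w]/mkset dd_recordsS.
    have [rec <-|nrec] := pselect (dd_record (Y^~ w) a n.+1).
      by right; split; [split => //|]; rewrite /mkset asboolT// addn1.
    by rewrite asboolF// addn0 => nr; left; split.
  move=> [[nr nrec]|[[nr rec] r0]]; first by rewrite asboolF// addn0.
  by rewrite asboolT// nr addn1 prednK.
apply: measurableU; first by apply: measurableI => //; exact: measurableC.
apply: measurableI; first exact: measurableI.
by case: (r) => [|r']; rewrite ?ltnn ?ltn0Sn; [rewrite (_ : [set w | _] = set0)|rewrite (_ : [set w | _] = setT)];
  rewrite //; apply/seteqP; split.
Qed.

Lemma measurable_dd_record_index k n : measurable [set w |
  (dd_time (Y^~ w) a n < +oo)%E /\ dd_record_index (Y^~ w) a k n].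
Proof.
apply: (measurableI _ _ (measurable_dd_time_lty n)).
apply: (measurableI _ _ (measurable_dd_records n k)).
apply: (measurableU _ _ _ (measurable_dd_record n)).
case: (n) => [|n']; first by rewrite (_ : (fun=> _) = setT)//; apply/seteqP; split.
by rewrite (_ : (fun=> _) = set0)//; apply/seteqP; split.
Qed.

End drawdown_measurability.

(** * The stage between two consecutive drawdown times *)

Section stage.
Context (R : realType).
Implicit Types (x y : R -> R) (a t : R) (n r : nat) (h : R -> R -> R).

(* Between the [n]-th and the [n.+1]-st drawdown times, [stage_depth] is how far
   the maximum since the [n]-th drawdown time lies below the overall maximum
   at that time, and [stage_gap] is the current drawdown. *)
Definition stage_depth x a n t : R :=
  dd_max x a n - running_max x (fine (dd_time x a n)) t.

Definition stage_gap x a n t : R := running_max x (fine (dd_time x a n)) t - x t.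

Definition in_stage x a n r t : Prop :=
  [/\ (dd_time x a n <= t%:E)%E, (t%:E < dd_time x a n.+1)%E & dd_records x a n = r].

Definition stage_fun x a n r h t : R :=
  if `[< in_stage x a n r t >] then h (stage_depth x a n t) (stage_gap x a n t) else 0.

Lemma in_stage_local x y a n r t : continuous x -> continuous y -> 0 < a ->
  (forall u, 0 <= u <= t -> x u = y u) -> in_stage x a n r t -> in_stage y a n r t.
Proof.
move=> cx cy a0 xy [nt tn nr]; split.
- by rewrite (dd_time_local cx cy a0 xy).
- rewrite ltNge; apply/negP => nt'.
  have yx u : 0 <= u <= t -> y u = x u by move=> ?; rewrite xy.
  by move: tn; rewrite (dd_time_local cy cx a0 yx nt') ltNge nt'.
- by rewrite (dd_records_local cx cy a0 xy).
Qed.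

Lemma stage_fun_local x y a n r h t : continuous x -> continuous y -> 0 < a ->
  (forall u, 0 <= u <= t -> x u = y u) -> stage_fun x a n r h t = stage_fun y a n r h t.
Proof.
move=> cx cy a0 xy; rewrite /stage_fun.
have yx u : 0 <= u <= t -> y u = x u by move=> ?; rewrite xy.
have [sx|nsx] := pselect (in_stage x a n r t); last first.
  rewrite !asboolF// => sy; apply: nsx; exact: (in_stage_local cy cx a0 yx).
rewrite !asboolT//; last exact: (in_stage_local cx cy a0 xy).
case: sx => nt _ _; rewrite /stage_depth /stage_gap.
rewrite (dd_max_local cx cy a0 xy nt) (dd_time_local cx cy a0 xy nt).
have [nE|[s s0 ns]] := dd_time_fin n cx a0; first by rewrite nE in nt.
rewrite ns lee_fin/= in nt *.
rewrite (eq_running_max (x := x) (y := y)); first by rewrite xy ?lexx ?(le_trans s0 nt).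
by move=> u /andP[su ut]; rewrite xy// ut (le_trans s0 su).
Qed.

End stage.

Section stage_measurability.
Context (R : realType) (d : measure_display) (T : measurableType d).
Variable Y : R -> T -> R.
Hypothesis mY : forall t, measurable_fun setT (Y t).
Hypothesis cY : forall w, continuous (Y^~ w).
Variable a : R.
Hypothesis a0 : 0 < a.

Lemma measurable_in_stage n r t : measurable [set w | in_stage (Y^~ w) a n r t].
Proof.
have -> : [set w | in_stage (Y^~ w) a n r t] =
    [set w | (dd_time (Y^~ w) a n <= t%:E)%E] `&`
    [set w | (t%:E < dd_time (Y^~ w) a n.+1)%E] `&` [set w | dd_records (Y^~ w) a n = r].
  by apply/seteqP; split=> w; [case=> ? ? ?|move=> [[? ?] ?]].
apply: measurableI; last exact: (measurable_dd_records mY cY a0).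
apply: measurableI.
  have := emeasurable_fun_infty_c measurableT (measurable_dd_time mY cY a0 n) t%:E.
  by rewrite setTI.
have := emeasurable_fun_o_infty measurableT (measurable_dd_time mY cY a0 n.+1) t%:E.
by rewrite setTI.
Qed.

Lemma measurable_stage_fun n r h t :
  measurable_fun setT (fun p : R * R => h p.1 p.2) ->
  measurable_fun setT (fun w => stage_fun (Y^~ w) a n r h t).
Proof.
(* The minimum with [t] keeps the interval from [s w] to [t] ordered outside the stage as well, and
   changes nothing inside it. *)
move=> mh; pose s w := Num.min (fine (dd_time (Y^~ w) a n)) t.
have ms : measurable_fun setT s.
  by apply: measurable_minr => //; exact: (measurable_fine_dd_time mY cY a0).
have mrm : measurable_fun setT (fun w => running_max (Y^~ w) (s w) t).
  apply: (measurable_running_max mY cY) => // w.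
  by rewrite /s ge_min lexx orbT.
have -> : (fun w => stage_fun (Y^~ w) a n r h t) = (fun w =>
    if `[< in_stage (Y^~ w) a n r t >] then
      (fun p : R * R => h p.1 p.2) (dd_max (Y^~ w) a n - running_max (Y^~ w) (s w) t,
        running_max (Y^~ w) (s w) t - Y t w) else 0).
  apply/funext => w; rewrite /stage_fun; case: asboolP => //= -[nt _ _].
  rewrite /stage_depth /stage_gap /s.
  have [nE|[s' s0 ns]] := dd_time_fin n (@cY w) a0; first by rewrite nE in nt.
  by rewrite ns/= (min_idPl _)// -lee_fin -ns.
apply: measurable_fun_ifT => //.
  apply: (measurable_fun_bool true).
  rewrite setTI (_ : _ @^-1` _ = [set w | in_stage (Y^~ w) a n r t]).
    exact: measurable_in_stage.
  by apply/seteqP; split=> w /=; [move/asboolP|move=> ?; apply/asboolP].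
apply: (measurableT_comp mh); apply: measurable_fun_pair; apply: measurable_funB => //.
exact: (measurable_dd_max mY cY a0).
Qed.

End stage_measurability.

(** * Independence of the past *)

Section past_independence.
Context (R : realType) (d : measure_display) (T : measurableType d).
Variable P : probability T R.

(** Dynkin's argument: the sets independent of a fixed [D] form a lambda-system. *)
Lemma independent_of_sigma (G : set (set T)) (D : set T) : measurable D ->
  setI_closed G -> G `<=` measurable ->
  (forall A, G A -> P (A `&` D) = (P A * P D)%E) ->
  forall A, <<s G >> A -> measurable A /\ P (A `&` D) = (P A * P D)%E.
Proof.
move=> mD GI Gm GP.
suff : <<s G >> `<=` [set A | measurable A /\ P (A `&` D) = (P A * P D)%E] by [].
apply: lambda_system_subset => //; last by move=> A GA; split; [exact: Gm|exact: GP].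
apply/dynkin_lambda_system; split.
- by split => //; rewrite setTI probability_setT mul1e.
- move=> A [mA AD]; split; first exact: measurableC.
  rewrite probability_setC// setIC -setDE measureD//; last first.
    by rewrite -ge0_fin_numE// fin_num_measure.
  transitivity (P D - P A * P D)%E; first by congr (_ - _)%E; rewrite setIC.
  rewrite muleBl ?fin_num_measure ?mul1e//.
- move=> F tF H; have mF k : measurable (F k) := (H k).1.
  split; first exact: bigcup_measurable.
  rewrite setI_bigcupl measure_bigcup//; last 2 first.
  + by move=> k _; exact: measurableI.
  + exact: trivIset_setIr.
  rewrite (measure_bigcup P)// [RHS]muleC -[X in (X * _)%E]fineK ?fin_num_measure//.
  rewrite -nneseriesZl//; apply: eq_eseriesr => k _.
  by rewrite fineK ?fin_num_measure// muleC; exact: (H k).2.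
Qed.

Variable W : R -> {RV P >-> R}.
Hypothesis hW : brownian_motion W.

Let inc (v : nat -> R) i w : R := W (v i.+1) w - W (v i) w.

Definition increment_rectangle (v : nat -> R) (n : nat) : set (set T) :=
  [set A | exists2 C : nat -> set R, (forall i, measurable (C i)) &
    A = [set w | forall i, (i < n)%N -> C i (inc v i w)]].

Lemma increment_rectangleI v n : setI_closed (increment_rectangle v n).
Proof.
move=> _ _ [C mC ->] [C' mC' ->]; exists (fun i => C i `&` C' i).
  by move=> i; exact: measurableI.
apply/seteqP; split=> w /=; first by move=> [H H'] i ni; split; [exact: H|exact: H'].
by move=> H; split=> i /H[].
Qed.

Let measurable_inc v i : measurable_fun setT (inc v i).
Proof. by apply: measurable_funB; exact: measurable_funPT. Qed.

Lemma increment_rectangle_measurable v n : increment_rectangle v n `<=` measurable.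
Proof.
move=> _ [C mC ->].
rewrite (_ : [set w | _] = \bigcap_(i in [set i | (i < n)%N]) (inc v i @^-1` C i))//.
case: n => [|n].
  by rewrite (_ : [set i | _] = set0) ?bigcap_set0//; apply/seteqP; split.
apply: bigcap_measurable; first by exists 0%N.
by move=> i _; rewrite -[X in measurable X]setTI; exact: measurable_inc.
Qed.

Lemma increment_rectangle_independent v n h (D : set R) :
  0 <= v 0%N -> (forall i, v i <= v i.+1) -> 0 <= h -> measurable D ->
  forall A, increment_rectangle v n A ->
  let xi w := W (v n + h) w - W (v n) w in
  P (A `&` xi @^-1` D) = (P A * P (xi @^-1` D))%E.
Proof.
move=> v0 vS h0 mD _ [C mC ->] xi.
(* The grid is followed up to [v n] and then sent to [v n + h], so that the future increment becomes
   the last one of a mutually independent family. *)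
pose v' i := if (i <= n)%N then v i else v n + h.
have v'S i : v' i <= v' i.+1.
  rewrite /v'; have [ni|ni|->] := ltngtP i n.
  - by rewrite vS.
  - by rewrite lexx.
  - by rewrite lerDl.
have key (E : set R) : measurable E ->
    P ([set w | forall i, (i < n)%N -> C i (inc v i w)] `&` xi @^-1` E) =
    (\prod_(i < n) P (inc v i @^-1` C i) * P (xi @^-1` E))%E.
  move=> mE.
  have := bm_indep hW (n := n.+1) (t := v') v0 v'S
    (A := fun i => if (i < n)%N then C i else E).
  move=> Heq.
  transitivity (P (\bigcap_(i : 'I_n.+1) ((fun w => W (v' i.+1) w - W (v' i) w) @^-1`
      (if (i < n)%N then C i else E)))).
    congr (P _); apply/seteqP; split=> w.
      move=> [HC HE] i _ /=; have := ltn_ord i; rewrite ltnS /v' => iln.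
      rewrite iln; case: ltnP => [i_n|ni]; first exact: HC.
      by have -> : nat_of_ord i = n by apply/eqP; rewrite eqn_leq iln ni.
    move=> H; split.
      move=> i ni; have := H (Ordinal (leqW ni : i < n.+1)%N) I.
      by rewrite /= /v' ni (ltnW ni).
    by have := H ord_max I; rewrite /= /v' ltnn leqnn.
  rewrite Heq; last by move=> i; case: ifP.
  rewrite big_ord_recr/= /v' !ltnn leqnn; congr (_ * _)%E; apply: eq_bigr => i _.
  by rewrite (ltn_ord i) (ltnW (ltn_ord i)).
(* With the whole line in place of [D], the product over [i] is seen to be the probability of the
   rectangle. *)
rewrite key//; congr (_ * _)%E.
by have := key setT measurableT; rewrite preimage_setT setIT probability_setT mule1.
Qed.


(** A pi-system generating the past up to [t]. Its times come in any order, possibly repeated; a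
    sorted grid is chosen only in [past_independent]. *)
Inductive cylinder (t : R) : set T -> Prop :=
| cylinderT : cylinder t setT
| cylinderI s (C : set R) A : 0 <= s <= t -> measurable C -> cylinder t A ->
    cylinder t (W s @^-1` C `&` A).

Lemma cylinder_setI t : setI_closed (cylinder t).
Proof.
move=> A B + cB; elim=> [|s C A' st mC _ IH]; first by rewrite setTI.
by rewrite -setIA; exact: cylinderI.
Qed.

(* The times of a cylinder, sorted, form a grid whose increments are independent
   of the future. *)
Lemma cylinder_grid t A : 0 <= t -> cylinder t A -> exists L : seq R,
  all (fun s => 0 <= s <= t) L /\
  forall v n, v 0%N = 0 -> (forall s, s \in L -> exists2 i, (i <= n)%N & v i = s) ->
    <<s increment_rectangle v n >> A.
Proof.
move=> t0; elim=> [|s C A' st mC _ [L [Lt LH]]].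
  exists [::]; split => // v n _ _.
  exact: (@measurableT _ (g_sigma_algebraType (increment_rectangle v n))).
exists (s :: L); split; first by rewrite /= st.
move=> v n v0 vL.
have IH : <<s increment_rectangle v n >> A'.
  by apply: LH => // s' s'L; apply: vL; rewrite inE s'L orbT.
pose S : measurableType _ := g_sigma_algebraType (increment_rectangle v n).
have minc i : (i < n)%N -> measurable_fun [set: S] (inc v i : S -> R).
  move=> i_n _ B mB; rewrite setTI; apply: sub_sigma_algebra.
  exists (fun j => if j == i then B else setT).
    by move=> j; case: ifP.
  apply/seteqP; split=> w /=; first by move=> Bw j _; case: eqP => [->|].
  by move=> /(_ _ i_n); rewrite eqxx.
(* The grid starts at time [0], where [W] vanishes, so the values of [W] on it are sums of
   increments. *)
have mW i : (i <= n)%N -> measurable_fun [set: S] (W (v i) : S -> R).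
  elim: i => [_|i IHi i_n].
    by rewrite v0 (_ : W 0 = cst 0 :> (T -> R)) //; apply/funext => w; rewrite (bm_start hW).
  rewrite (_ : (W (v i.+1) : T -> R) = W (v i) \+ inc v i); last first.
    by apply/funext => w /=; rewrite /inc addrC subrK.
  by apply: measurable_funD; [exact: IHi (ltnW i_n)|exact: minc].
have [i i_n vis] := vL s (mem_head _ _).
have mA : measurable (W s @^-1` C : set S).
  by rewrite -vis -[X in measurable X]setTI; exact: mW.
exact: (measurableI _ _ mA IH).
Qed.

Lemma past_independent t h (D : set R) A : 0 <= t -> 0 <= h -> measurable D ->
  <<s cylinder t >> A ->
  let xi w := W (t + h) w - W t w in
  measurable A /\ P (A `&` xi @^-1` D) = (P A * P (xi @^-1` D))%E.
Proof.
move=> t0 h0 mD FA xi.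
have mxi : measurable (xi @^-1` D).
  rewrite -[X in measurable X]setTI; apply: measurable_funB => //; exact: measurable_funPT.
suff H : forall B, cylinder t B -> measurable B /\
    P (B `&` xi @^-1` D) = (P B * P (xi @^-1` D))%E.
  apply: (independent_of_sigma mxi (@cylinder_setI t)) FA.
    by move=> B /H[].
  by move=> B /H[].
move=> B /(cylinder_grid t0)[L [Lt LH]].
(* The default value [t] of [nth] prolongs the sorted list by the constant [t], so that the grid
   ends at the present time. *)
pose v := nth t (0 :: sort <=%R L).
have v0 : v 0%N = 0 by [].
have sz : size (0 :: sort <=%R L) = (size L).+1 by rewrite /= size_sort.
have vn : v (size L).+1 = t by rewrite /v nth_default// sz.
have vS i : v i <= v i.+1.
  have [iL|Li] := ltnP i.+1 (size L).+1; last first.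
    rewrite {2}/v nth_default ?sz//.
    have [iL|Li'] := ltnP i (size L).+1; last by rewrite /v nth_default ?sz.
    have : v i \in 0 :: sort <=%R L by rewrite mem_nth// sz.
    rewrite inE mem_sort => /predU1P[->//|/(allP Lt)/andP[]//].
  rewrite /v; case: i iL => [|i] iL.
    have : nth t (sort <=%R L) 0 \in L by rewrite -(mem_sort <=%R) mem_nth// size_sort.
    by move=> /(allP Lt)/andP[].
  have := sort_le_sorted L => /(sortedP t)/(_ i); apply.
  by rewrite size_sort.
have HB : <<s increment_rectangle v (size L).+1 >> B.
  apply: LH => // s sL.
  exists (index s (0 :: sort <=%R L)).
    by rewrite -sz index_size.
  by rewrite /v nth_index// inE mem_sort sL orbT.
apply: (independent_of_sigma mxi (@increment_rectangleI v (size L).+1)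
  (@increment_rectangle_measurable v (size L).+1)) HB => A' rA'.
have := increment_rectangle_independent (n := (size L).+1) (lexx _ : 0 <= v 0%N) vS h0 mD rA'.
by rewrite vn.
Qed.

End past_independence.

Section independent_product.
Context (R : realType) (d d1 : measure_display) (T : measurableType d).
Context (S : measurableType d1) (P : probability T R).

(** Fubini for the product of the two laws. The type [S] is general because [X] will be the identity
    from [T] to [T] equipped with the sigma-algebra of the past. *)
Lemma integral_independent_mean0 (X : T -> S) (Z : T -> R) (f : S -> R) (g : R -> R) (c : R) :
  measurable_fun setT X -> measurable_fun setT Z ->
  measurable_fun setT f -> measurable_fun setT g ->
  (forall A D, measurable A -> measurable D ->
     P (X @^-1` A `&` Z @^-1` D) = (P (X @^-1` A) * P (Z @^-1` D))%E) ->
  (forall s, `|f s| <= c) -> P.-integrable setT (EFin \o (g \o Z)) ->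
  (\int[P]_w (g (Z w))%:E = 0)%E ->
  (\int[P]_w (f (X w) * g (Z w))%:E = 0)%E.
Proof.
move=> mX mZ mf mg ind fc ig g0.
pose pX : {mfun T >-> S} := mfun_Sub (mem_set mX).
pose pZ : {mfun T >-> R} := mfun_Sub (mem_set mZ).
have mXZ : measurable_fun setT (fun w => (X w, Z w)) by exact: measurable_fun_pair.
pose pXZ : {mfun T >-> (S * R)%type} := mfun_Sub (mem_set mXZ).
pose F (p : S * R) : \bar R := (f p.1 * g p.2)%:E.
have mF : measurable_fun setT F.
  apply/measurable_EFinP; apply: measurable_funM.
    exact: (measurableT_comp mf measurable_fst).
  exact: (measurableT_comp mg measurable_snd).
pose m1 := distribution P pX; pose m2 := distribution P pZ.
have prodE (A : set (S * R)) : measurable A -> (m1 \x m2)%E A = distribution P pXZ A.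
  by move=> mA; exact: product_measure_unique.
have iFP : P.-integrable setT (F \o pXZ).
  have -> : F \o pXZ = (fun w => (f (X w) * g (Z w))%:E) by [].
  have mfg : measurable_fun setT (fun w => f (X w) * g (Z w)).
    by apply: measurable_funM; [exact: (measurableT_comp mf)|exact: (measurableT_comp mg)].
  apply: (@le_integrable _ _ _ _ _ _ _ (fun w => c%:E * (g (Z w))%:E)%E) => //.
  - exact/measurable_EFinP.
  - move=> w _; rewrite -EFinM !abse_EFin lee_fin !normrM ler_wpM2r//.
    exact: (le_trans (fc _) (ler_norm _)).
  - exact: integrableZl.
have iF : (m1 \x m2)%E.-integrable setT F.
  apply/integrableP; split => //.
  rewrite (eq_measure_integral (distribution P pXZ)); last by move=> A mA _; exact: prodE.
  rewrite ge0_integral_distribution//; last exact: measurableT_comp.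
  by case/integrableP : iFP.
transitivity (\int[P]_w (F \o pXZ) w)%E; first by [].
rewrite -integral_distribution//.
transitivity (\int[(m1 \x m2)%E]_z F z)%E.
  by apply: eq_measure_integral => A mA _; symmetry; exact: prodE.
rewrite -integral12_prod_meas1//.
transitivity (\int[m1]_x (cst 0 x))%E; last by rewrite integral0.
apply: eq_integral => x _; rewrite /fubini_F /F/=.
under eq_integral do rewrite EFinM.
rewrite integralZl//.
  rewrite integral_distribution//; first by rewrite g0 mule0.
  exact/measurable_EFinP.
apply/integrableP; split; first exact/measurable_EFinP.
rewrite ge0_integral_distribution//; last first.
  by apply: measurableT_comp => //; exact/measurable_EFinP.
by case/integrableP : ig.
Qed.

End independent_product.

(** * The scale function of an increment *)

Section normal_moments.
Context (R : realType).
Implicit Types (s c h : R).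

Lemma ge0_integral_normal_prob s (f : R -> \bar R) : (forall x, (0 <= f x)%E) ->
  measurable_fun setT f ->
  (\int[normal_prob 0 s]_x f x =
   \int[lebesgue_measure]_x (f x * (normal_pdf 0 s x)%:E))%E.
Proof.
move=> f0 mf; have dom := normal_prob_dominates 0 s.
rewrite -(Radon_Nikodym_SigmaFinite.change_of_variables dom)//.
have mpdf : measurable_fun setT (fun x => (normal_pdf 0 s x)%:E).
  by apply/measurable_EFinP; exact: measurable_normal_pdf.
have iRN := Radon_Nikodym_SigmaFinite.f_integrable dom.
apply: ae_eq_integral => //.
- by apply: emeasurable_funM => //; exact: (measurable_int _ iRN).
- exact: emeasurable_funM.
- apply: ae_eqe_mul2l => /=; apply: integral_ae_eq => //.
  by move=> E _ mE; rewrite -Radon_Nikodym_SigmaFinite.f_integral.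
Qed.

(** Completing the square turns the integrand into a constant times the normal density of mean
    [c * s ^+ 2]. *)
Lemma normal_mgf s c : s != 0 ->
  (\int[normal_prob 0 s]_x (expR (c * x))%:E = (expR (c ^+ 2 * s ^+ 2 / 2))%:E)%E.
Proof.
move=> s0; have s20 : s ^+ 2 != 0 by rewrite sqrf_eq0.
have mexp : measurable_fun setT (fun x : R => expR (c * x)).
  by apply: measurableT_comp => //; exact: mulrl_measurable.
rewrite ge0_integral_normal_prob; last 2 first.
- by move=> x; rewrite lee_fin expR_ge0.
- exact/measurable_EFinP.
transitivity (\int[lebesgue_measure]_x ((expR (c ^+ 2 * s ^+ 2 / 2))%:E *
    (normal_pdf (c * s ^+ 2) s x)%:E))%E.
  apply: eq_integral => x _; rewrite -!EFinM; congr EFin.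
  rewrite !normal_pdfE// mulrCA [RHS]mulrCA; congr (_ * _).
  rewrite /normal_fun -!expRD; congr expR.
  by field.
rewrite ge0_integralZl//; first by rewrite integral_normal_pdf mule1.
- by apply/measurable_EFinP; exact: measurable_normal_pdf.
- by move=> x _; rewrite lee_fin normal_pdf_ge0.
Qed.

Lemma normal_prob_Ny_gt0 s y : s != 0 -> (0 < normal_prob 0 s `]-oo, y])%E.
Proof.
move=> s0.
(* [expR (- M)] bounds the exponential factor of the density from below on [[y - 1, y]]. *)
pose M := (`|y| + 1) ^+ 2 / (s ^+ 2 *+ 2).
pose m := normal_peak s * expR (- M).
have m0 : 0 < m by rewrite mulr_gt0 ?expR_gt0// normal_peak_gt0.
have sub : (`[y - 1, y] : set R) `<=` `]-oo, y].
  by move=> x /=; rewrite !in_itv/= => /andP[].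
have mpdf : measurable_fun setT (fun x => (normal_pdf 0 s x)%:E).
  by apply/measurable_EFinP; exact: measurable_normal_pdf.
apply: (@lt_le_trans _ _ (normal_prob 0 s `[y - 1, y])); last first.
  by apply: le_measure => //; rewrite inE.
apply: (@lt_le_trans _ _ (\int[lebesgue_measure]_(x in `[(y - 1)%R, y]) m%:E)%E).
  rewrite integral_cst//= lebesgue_measure_itv/= lte_fin ltrBlDr ltrDl ltr01.
  by rewrite -EFinB -EFinM lte_fin mulr_gt0//; lra.
rewrite /normal_prob; apply: ge0_le_integral => //.
- by move=> x _; rewrite lee_fin ltW.
- exact: measurable_funTS.
move=> x /=; rewrite in_itv/= => /andP[x1 x2]; rewrite lee_fin normal_pdfE//.
rewrite /m ler_wpM2l ?normal_peak_ge0// /normal_fun ler_expR subr0 /M mulNr lerN2.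
rewrite ler_wpM2r ?invr_ge0 ?mulrn_wge0 ?sqr_ge0//.
rewrite -real_normK ?num_real// lerXn2r ?nnegrE ?addr_ge0//.
rewrite ler_norml; have := ler_norm y; have := ler_norm (- y); rewrite normrN.
by move=> ? ?; apply/andP; split; lra.
Qed.

End normal_moments.

Section brownian_increments.
Context (R : realType) (d : measure_display) (T : measurableType d).
Variables (P : probability T R) (W : R -> {RV P >-> R}).
Hypothesis hW : brownian_motion W.
Implicit Types (t h c : R).

Lemma ge0_integral_brownian_increment t h (f : R -> \bar R) : 0 <= t -> 0 < h ->
  measurable_fun setT f -> (forall x, (0 <= f x)%E) ->
  (\int[P]_w f (W (t + h) w - W t w)%R =
   \int[normal_prob 0 (Num.sqrt h)]_x f x)%E.
Proof.
move=> t0 h0 mf f0.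
have mxi : measurable_fun setT (fun w => W (t + h) w - W t w).
  by apply: measurable_funB; exact: measurable_funPT.
have mxi' : measurable_fun setT ((fun w => W (t + h) w - W t w) : T -> measurableTypeR R) by [].
pose xi : {mfun T >-> measurableTypeR R} :=
  @mfun_Sub _ _ T (measurableTypeR R) _ (mem_set mxi').
transitivity (\int[distribution P xi]_x f x)%E.
  by rewrite ge0_integral_distribution.
apply: eq_measure_integral => A mA _.
have := bm_normal hW t0 (_ : t < t + h) mA; rewrite ltrDl addrAC subrr add0r.
exact.
Qed.

Lemma brownian_mgf t h c : 0 <= t -> 0 < h ->
  (\int[P]_w (expR (c * (W (t + h) w - W t w)))%:E = (expR (c ^+ 2 * h / 2))%:E)%E.
Proof.
move=> t0 h0; rewrite (ge0_integral_brownian_increment (f := fun x => (expR (c * x))%:E))//.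
- rewrite normal_mgf ?sqr_sqrtr ?(ltW h0)//.
  by rewrite gt_eqF// sqrtr_gt0.
- apply/measurable_EFinP; apply: measurableT_comp => //; exact: mulrl_measurable.
Qed.



Lemma integrable_expR_increment t h c : 0 <= t -> 0 < h ->
  P.-integrable setT (fun w => (expR (c * (W (t + h) w - W t w)))%:E).
Proof.
move=> t0 h0; apply/integrableP; split.
  apply/measurable_EFinP; apply: measurableT_comp => //.
  by apply: measurable_funM => //; apply: measurable_funB; exact: measurable_funPT.
under eq_integral do rewrite abse_EFin (ger0_norm (expR_ge0 _)).
by rewrite brownian_mgf// ltry.
Qed.

(** The mean [r] is read off the moment generating function: [c * r <= expR (c ^+ 2 * h / 2) - 1]
    for [c] of either sign, and the right-hand side is quadratic in [c] near zero. *)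
Lemma brownian_increment_mean0 t h : 0 <= t -> 0 < h ->
  P.-integrable setT (fun w => (W (t + h) w - W t w)%:E) /\
  (\int[P]_w (W (t + h) w - W t w)%:E = 0)%E.
Proof.
move=> t0 h0; set xi := fun w => W (t + h) w - W t w.
have mxi : measurable_fun setT xi by apply: measurable_funB; exact: measurable_funPT.
have i1 := integrable_expR_increment 1 t0 h0.
have iN1 := integrable_expR_increment (-1) t0 h0.
have ixi : P.-integrable setT (fun w => (xi w)%:E).
  apply: (@le_integrable _ _ _ _ _ _ _ (fun w => (expR (1 * xi w))%:E + (expR (-1 * xi w))%:E)%E) => //.
  - exact/measurable_EFinP.
  - move=> w _; rewrite -EFinD !abse_EFin lee_fin.
    rewrite [leRHS]ger0_norm ?addr_ge0 ?expR_ge0// mul1r mulN1r.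
    have := expR_ge1Dx (xi w); have := expR_ge1Dx (- xi w).
    have := expR_ge0 (xi w); have := expR_ge0 (- xi w).
    by move=> *; rewrite ler_norml; apply/andP; split; lra.
  - exact: integrableD.
split => //.
have [r rE] : exists r : R, (\int[P]_w (xi w)%:E = r%:E)%E.
  exists (fine (\int[P]_w (xi w)%:E)%E); rewrite fineK//.
  exact: integrable_fin_num.
have bound c : c * r <= expR (c ^+ 2 * h / 2) - 1.
  rewrite -lee_fin EFinM -rE -integralZl// EFinB -(brownian_mgf _ t0 h0).
  rewrite -[X in (_ - X)%E](_ : \int[P]_w 1%:E = 1)%E; last first.
    by rewrite integral_cst// mul1e; exact: probability_setT.
  rewrite -integralB//; last 2 first.
  - exact: integrable_expR_increment.
  - by apply: finite_measure_integrable_cst.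
  apply: le_integral => //.
  - exact: integrableZl.
  - apply: integrableB => //; first exact: integrable_expR_increment.
    by apply: finite_measure_integrable_cst.
  move=> w _; rewrite -EFinM -EFinB lee_fin.
  by have := expR_ge1Dx (c * xi w); rewrite /xi; lra.
have bound2 c : 0 < c -> c ^+ 2 * h <= 1 -> c * `|r| <= c ^+ 2 * h.
  move=> c0 ch.
  have : expR (c ^+ 2 * h / 2) - 1 <= c ^+ 2 * h.
    set y := c ^+ 2 * h / 2; have y0 : 0 <= y by rewrite /y divr_ge0// mulr_ge0 ?sqr_ge0 ?ltW.
    have y1 : y <= 1 / 2 by rewrite /y; lra.
    have -> : c ^+ 2 * h = 2 * y by rewrite /y; lra.
    have := expR_ge1Dx (- y); rewrite expRN => ey.
    have e0 : 0 < expR y by exact: expR_gt0.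
    have : (1 - y) * expR y <= 1.
      by rewrite -ler_pdivlMr// div1r.
    nra.
  have := bound c; have := bound (- c); rewrite sqrrN.
  by case: (ger0P r) => r0; lra.
rewrite rE; congr EFin; apply/eqP; rewrite -normr_le0 leNgt; apply/negP => r0.
(* The first bound contradicts the conclusion of [bound2], that [|r| <= c * h]; the other two ensure
   [c ^+ 2 * h <= 1]. *)
pose c := Num.min (`|r| / (2 * h)) (Num.min 1 h^-1).
have c0 : 0 < c by rewrite /c !lt_min invr_gt0 h0 ltr01 divr_gt0// mulr_gt0.
have c1 : c <= 1 by rewrite /c !ge_min lexx !orbT.
have ch : c * h <= 1 by rewrite -ler_pdivlMr// div1r /c !ge_min lexx !orbT.
have cr : c * h <= `|r| / 2.
  rewrite -ler_pdivlMr//; apply: (@le_trans _ _ (`|r| / (2 * h))).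
    by rewrite /c ge_min lexx.
  by rewrite invfM mulrA.
have := bound2 _ c0; rewrite expr2 -mulrA ler_pM2l//.
have c2 : c * (c * h) <= 1 by nra.
by move=> /(_ c2); lra.
Qed.

End brownian_increments.

Section scale_function.
Context (R : realType).
Implicit Types (gamma y z : R).

(* A scale function of the reversed process [- X]: [scale_fun gamma (- X_t)] is
   a martingale. *)
Definition scale_fun gamma y : R :=
  if gamma == 0 then y else (expR (gamma * y) - 1) / gamma.

Lemma scale_fun0 gamma : scale_fun gamma 0 = 0.
Proof. by rewrite /scale_fun; case: ifP; rewrite // mulr0 expR0 subrr mul0r. Qed.

(** By this identity the scale function moves over a step by a factor known at its beginning times a
    centered variable. *)
Lemma scale_funD gamma y z :
  scale_fun gamma (y + z) = scale_fun gamma y + expR (gamma * y) * scale_fun gamma z.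
Proof.
rewrite /scale_fun; have [->|g0] := eqVneq gamma 0; first by rewrite mul0r expR0 mul1r.
by rewrite mulrDr expRD; field.
Qed.

Lemma measurable_scale_fun gamma : measurable_fun setT (scale_fun gamma).
Proof.
rewrite /scale_fun; have [_|g0] := eqVneq gamma 0; first exact: measurable_id.
apply: measurable_funM => //; apply: measurable_funB => //.
by apply: measurableT_comp => //; exact: mulrl_measurable.
Qed.

Lemma scale_fun_norm_le gamma y :
  `|scale_fun gamma y| <= `|y| * expR (`|gamma| * `|y|).
Proof.
rewrite /scale_fun; have [->|g0] := eqVneq gamma 0.
  by rewrite normr0 mul0r expR0 mulr1.
have ng : 0 < `|gamma| by rewrite normr_gt0.
rewrite normrM normfV ler_pdivrMr// -normrM mulrAC -normrM.
set z := gamma * y; rewrite [y * gamma]mulrC -/z.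
have e0 := expR_gt0 z; have := expR_ge1Dx (- z); rewrite expRN => h1.
have {}h1 : (1 - z) * expR z <= 1 by rewrite -ler_pdivlMr// div1r.
have h2 := expR_ge1Dx z.
have [z0|z0] := ger0P z.
  by rewrite ger0_norm; nra.
have z1 : 1 <= expR (- z) by rewrite -expR0 ler_expR; lra.
have z1' : expR z <= 1 by rewrite -expR0 ler_expR ltW.
by rewrite ler0_norm; nra.
Qed.

Lemma scale_fun_gt0 gamma y : 0 < y -> 0 < scale_fun gamma y.
Proof.
move=> y0; rewrite /scale_fun; have [//|g0] := eqVneq gamma 0.
have [gp|gn] := ltP 0 gamma.
  by rewrite divr_gt0// subr_gt0 -expR0 ltr_expR mulr_gt0.
have {}gn : gamma < 0 by rewrite lt_neqAle g0 gn.
by rewrite nmulr_lgt0 ?invr_lt0// subr_lt0 -expR0 ltr_expR nmulr_rlt0.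
Qed.

Lemma expr4_le_expR z : 0 <= z -> z ^+ 4 <= 4 ^+ 4 * expR z.
Proof.
move=> z0; have : (z / 4) ^+ 4 <= expR (z / 4) ^+ 4.
  rewrite lerXn2r ?nnegrE ?divr_ge0 ?expR_ge0//.
  by have := expR_ge1Dx (z / 4); lra.
rewrite -expRM_natl (_ : 4%:R * (z / 4) = z); last by field.
by rewrite expr_div_n ler_pdivrMr ?exprn_gt0// mulrC.
Qed.

End scale_function.

Section drifted_increments.
Context (R : realType) (d : measure_display) (T : measurableType d).
Variables (P : probability T R) (W : R -> {RV P >-> R}).
Hypothesis hW : brownian_motion W.
Variables (mu sigma : R).
Hypothesis sigma0 : 0 < sigma.
Implicit Types (t h c : R).

Let gamma := 2 * mu / sigma ^+ 2.
Let X := drifted_bm W mu sigma.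

Lemma drifted_bm_increment t h w :
  X (t + h) w - X t w = mu * h + sigma * (W (t + h) w - W t w).
Proof. by rewrite /X /drifted_bm; ring. Qed.

Lemma measurable_drifted_bm t : measurable_fun setT (X t).
Proof.
apply: measurable_funD => //; apply: measurable_funM => //; exact: measurable_funPT.
Qed.

Lemma measurable_drifted_increment t h :
  measurable_fun setT (fun w => X (t + h) w - X t w).
Proof. by apply: measurable_funB; exact: measurable_drifted_bm. Qed.

Lemma drifted_mgf t h c : 0 <= t -> 0 < h ->
  P.-integrable setT (fun w => (expR (c * (X (t + h) w - X t w)))%:E) /\
  (\int[P]_w (expR (c * (X (t + h) w - X t w)))%:E =
   (expR (h * (c * mu + c ^+ 2 * sigma ^+ 2 / 2)))%:E)%E.
Proof.
move=> t0 h0; have E w : (expR (c * (X (t + h) w - X t w)))%:E =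
    ((expR (c * mu * h))%:E * (expR ((c * sigma) * (W (t + h) w - W t w)))%:E)%E.
  by rewrite -EFinM -expRD drifted_bm_increment; congr (expR _)%:E; ring.
have i1 := integrable_expR_increment hW (c * sigma) t0 h0.
split; first by under eq_fun do rewrite E; exact: integrableZl.
under eq_integral do rewrite E.
by rewrite integralZl// brownian_mgf// -EFinM -expRD; congr (expR _)%:E; field.
Qed.

Lemma drifted_scale_mean0 t h : 0 <= t -> 0 < h ->
  let u w := scale_fun gamma (- (X (t + h) w - X t w)) in
  P.-integrable setT (fun w => (u w)%:E) /\ (\int[P]_w (u w)%:E = 0)%E.
Proof.
move=> t0 h0 u; rewrite /u /scale_fun; have s20 : sigma ^+ 2 != 0 by rewrite gt_eqF ?exprn_gt0.
have [g0|g0] := eqVneq gamma 0.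
  have mu0 : mu = 0.
    by move/eqP: g0; rewrite /gamma !mulf_eq0 invr_eq0 (negbTE s20) pnatr_eq0/= orbF => /eqP.
  have [i1 m0] := brownian_increment_mean0 hW t0 h0.
  have E w : (- (X (t + h) w - X t w))%:E = ((- sigma)%:E * (W (t + h) w - W t w)%:E)%E.
    by rewrite drifted_bm_increment mu0 mul0r add0r -EFinM mulNr.
  split; first by under eq_fun do rewrite E; exact: integrableZl.
  by under eq_integral do rewrite E; rewrite integralZl// m0 mule0.
have [i1 m1] := drifted_mgf (- gamma) t0 h0.
have E w : ((expR (gamma * (- (X (t + h) w - X t w))) - 1) / gamma)%:E =
    ((gamma^-1)%:E * ((expR (- gamma * (X (t + h) w - X t w)))%:E - 1%:E))%E.
  by rewrite -EFinB -EFinM mulrC mulrN mulNr.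
have i2 : P.-integrable setT (fun=> 1%:E : \bar R) by exact: finite_measure_integrable_cst.
split.
  under eq_fun do rewrite E; apply: integrableZl => //; exact: integrableB.
under eq_integral do rewrite E.
rewrite integralZl//; last exact: integrableB.
rewrite integralB// m1 integral_cst// mul1e.
rewrite [X in (_ - X)%E](_ : _ = 1%:E); last exact: probability_setT.
(* This is where the value of [gamma] matters: [- gamma * mu + gamma ^+ 2 * sigma ^+ 2 / 2 = 0]. *)
rewrite (_ : h * _ = 0) ?expR0 ?subee ?mule0//.
by rewrite /gamma; field; rewrite gt_eqF.
Qed.

(** The order [h ^+ 2] comes from comparing on the scale [q], the square root of [h]: [|eta| ^+ 4 <=
    4 ^+ 4 * h ^+ 2 * expR (|eta| / q)]. The exponent [k = q^-1 + G] is unbounded as [h] decreases,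
    but [h * k] and [h * k ^+ 2], through which it enters the moment generating function, stay
    bounded for [h <= H]. *)
Lemma drifted_scale_moment4 (H : R) : 0 < H -> exists C : R, forall t h, 0 <= t -> 0 < h ->
  h <= H ->
  let u w := scale_fun gamma (- (X (t + h) w - X t w)) in
  P.-integrable setT (fun w => (u w ^+ 4)%:E) /\
  (\int[P]_w (u w ^+ 4)%:E <= (C * h ^+ 2)%:E)%E.
Proof.
move=> H0; pose G := 4 * `|gamma|.
pose B := (1 + H + G * H) * `|mu| + (1 + G * (1 + H)) ^+ 2 * sigma ^+ 2 / 2.
pose K : R := 4 ^+ 4; have K0 : 0 <= K by rewrite exprn_ge0.
exists (2 * K * expR B) => t h t0 h0 hH u.
pose eta w := X (t + h) w - X t w.
have [q sh0 shE] : exists2 q : R, 0 < q & q ^+ 2 = h.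
  by exists (Num.sqrt h); rewrite ?sqrtr_gt0// sqr_sqrtr// ltW.
pose k := q^-1 + G.
have G0 : 0 <= G by rewrite mulr_ge0.
have Kh0 : 0 <= K * h ^+ 2 by rewrite mulr_ge0 ?sqr_ge0.
have k0 : 0 < k by rewrite ltr_pwDl ?invr_gt0.
have ub w : u w ^+ 4 <= K * h ^+ 2 * (expR (k * eta w) + expR (- k * eta w)).
  have : u w ^+ 4 <= `|eta w| ^+ 4 * expR (G * `|eta w|).
    have -> : u w ^+ 4 = `|u w| ^+ 4 by rewrite -normrX ger0_norm ?exprn_even_ge0.
    have -> : `|eta w| ^+ 4 * expR (G * `|eta w|) = (`|eta w| * expR (`|gamma| * `|eta w|)) ^+ 4.
      by rewrite exprMn -expRM_natl /G mulrA.
    rewrite lerXn2r ?nnegrE ?mulr_ge0 ?expR_ge0//.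
    by have := scale_fun_norm_le gamma (- eta w); rewrite normrN.
  move=> /le_trans; apply.
  have e4 : `|eta w| ^+ 4 <= K * h ^+ 2 * expR (`|eta w| / q).
    have -> : `|eta w| ^+ 4 = h ^+ 2 * (`|eta w| / q) ^+ 4.
      by rewrite -shE; field; rewrite gt_eqF.
    rewrite [leRHS](_ : _ = h ^+ 2 * (K * expR (`|eta w| / q))); last by ring.
    rewrite ler_wpM2l ?sqr_ge0//.
    exact: (expr4_le_expR (divr_ge0 (normr_ge0 _) (ltW sh0))).
  apply: (@le_trans _ _ (K * h ^+ 2 * expR (k * `|eta w|))).
    apply: le_trans (ler_wpM2r (expR_ge0 _) e4) _.
    rewrite -[leLHS]mulrA -expRD ler_wpM2l//.
    by rewrite ler_expR /k [leRHS]mulrDl [_ / q]mulrC.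
  rewrite ler_wpM2l// mulNr.
  have := expR_ge0 (k * eta w); have := expR_ge0 (- (k * eta w)).
  by case: (ger0P (eta w)) => _; rewrite ?mulrN; lra.
have mu4 : measurable_fun setT (fun w => u w ^+ 4).
  apply: measurable_funX; apply: (measurableT_comp (measurable_scale_fun gamma)).
  by apply: measurable_funN; exact: measurable_drifted_increment.
have [ik mk] := drifted_mgf k t0 h0; have [iNk mNk] := drifted_mgf (- k) t0 h0.
have iub : P.-integrable setT (fun w =>
    ((K * h ^+ 2)%:E * ((expR (k * eta w))%:E + (expR (- k * eta w))%:E))%E).
  by apply: integrableZl => //; exact: integrableD.
have u40 w : 0 <= u w ^+ 4 by rewrite exprn_even_ge0.
split.
  apply: (le_integrable _ _ _ iub) => //; first exact/measurable_EFinP.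
  move=> w _; rewrite -EFinD -EFinM !abse_EFin lee_fin (ger0_norm (u40 w)).
  exact: (le_trans (ub w) (ler_norm _)).
apply: (@le_trans _ _ (\int[P]_w ((K * h ^+ 2)%:E *
    ((expR (k * eta w))%:E + (expR (- k * eta w))%:E)))%E).
  apply: ge0_le_integral => //.
  - by move=> w _; rewrite lee_fin.
  - exact/measurable_EFinP.
  - exact: (measurable_int _ iub).
  - by move=> w _; rewrite -EFinD -EFinM lee_fin.
rewrite integralZl//; last exact: integrableD.
rewrite integralD// mk mNk -EFinD -EFinM lee_fin.
have hk : h * k <= 1 + H + G * H.
  have -> : h * k = q + G * h by rewrite /k -shE; field; rewrite gt_eqF.
  have : G * h <= G * H by rewrite ler_wpM2l.
  have : q <= 1 + h.
    by rewrite -shE; have := sqr_ge0 (q - 1); nra.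
  lra.
have hk2 : h * k ^+ 2 <= (1 + G * (1 + H)) ^+ 2.
  have -> : h * k ^+ 2 = (1 + G * q) ^+ 2.
    by rewrite /k -shE; field; rewrite gt_eqF.
  have q1 : q <= 1 + h by rewrite -shE; have := sqr_ge0 (q - 1); nra.
  have Gq : G * q <= G * (1 + H) by rewrite ler_wpM2l//; lra.
  have Gq0 : 0 <= G * q by rewrite mulr_ge0// ltW.
  by rewrite lerXn2r ?nnegrE; lra.
have eB c : c = k \/ c = - k -> expR (h * (c * mu + c ^+ 2 * sigma ^+ 2 / 2)) <= expR B.
  move=> ck; rewrite ler_expR /B.
  have -> : h * (c * mu + c ^+ 2 * sigma ^+ 2 / 2) = h * c * mu + h * c ^+ 2 * (sigma ^+ 2 / 2) by ring.
  have -> : c ^+ 2 = k ^+ 2 by case: ck => ->; rewrite ?sqrrN.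
  rewrite -mulrA; apply: lerD.
    apply: (@le_trans _ _ (h * k * `|mu|)); last by rewrite ler_wpM2r.
    apply: (le_trans (ler_norm _)); rewrite !normrM (gtr0_norm h0).
    by case: ck => ->; rewrite ?normrN (gtr0_norm k0) mulrA.
  by rewrite -[leRHS]mulrA ler_wpM2r// divr_ge0 ?sqr_ge0.
have := eB k (or_introl erefl); have := eB (- k) (or_intror erefl).
move=> e1 e2; rewrite [leRHS](_ : _ = K * h ^+ 2 * (2 * expR B)); last by ring.
by rewrite ler_wpM2l//; lra.
Qed.

Lemma drifted_increment_neg (a : R) : exists2 p : R, 0 < p & forall t, 0 <= t ->
  P [set w | X (t + 1) w - X t w <= - a] = p%:E.
Proof.
pose y := (- a - mu) / sigma.
have s0 : Num.sqrt 1 != 0 :> R by rewrite sqrtr1 oner_eq0.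
have p0 := normal_prob_Ny_gt0 y s0.
have pfin : normal_prob 0 (Num.sqrt 1) `]-oo, y] \is a fin_num.
  by apply: (fin_num_measure (normal_prob 0 (Num.sqrt 1))).
exists (fine (normal_prob 0 (Num.sqrt 1) `]-oo, y])).
  by rewrite -lte_fin fineK.
move=> t t0; rewrite fineK//.
have := bm_normal hW t0 (_ : t < t + 1) (@measurable_itv R `]-oo, y]).
rewrite ltrDl ltr01 addrAC subrr add0r => <-//; congr (P _).
apply/seteqP; split=> w /=; rewrite in_itv/= drifted_bm_increment mulr1 /y ler_pdivlMr// => ?;
  lra.
Qed.

End drifted_increments.

(** * Approximation of a stage by a sum of martingale increments *)

Section stage_error.
Context (R : realType).
Variables (gamma a K L : R) (f f1 : R -> R).
Let g := scale_fun gamma.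

(** One constant [L] serves all estimates. The error in [sb_g_taylor] carries the factor [y + D]
    because the derivative of [g] is [1] at the origin: the approximation is good near zero, and [y]
    is small at the steps where the maximum moves. *)
Record stage_bounds : Prop := {
  sb_L : [/\ 1 <= L, K <= L & a <= L];
  sb_f1 : forall D, 0 <= D <= K -> `|f1 D| <= L;
  sb_f_lip : forall D D', 0 <= D <= K -> 0 <= D' <= K -> `|f D' - f D| <= L * `|D' - D|;
  sb_f1_lip : forall D D', 0 <= D <= K -> 0 <= D' <= K ->
    `|f1 D' - f1 D| <= L * `|D' - D|;
  sb_f_taylor : forall D D', 0 <= D <= K -> 0 <= D' <= K ->
    `|f D' - f D - f1 D * (D' - D)| <= L * (D' - D) ^+ 2;
  sb_g : forall y, 0 <= y <= a -> `|g y| <= L * y;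
  sb_g_lip : forall y y', 0 <= y <= a -> 0 <= y' <= a -> `|g y' - g y| <= L * `|y' - y|;
  sb_g_taylor : forall y D, 0 <= y <= a -> 0 <= D <= K ->
    `|g y - g (y - D) - D| <= L * D * (y + D);
  sb_exp : forall y, 0 <= y <= a -> expR (gamma * y) <= L
}.

Definition stage_value (D y : R) : R := if 0 <= D then f D + f1 D * g y else f 0.

(** The coefficient of the centered increment, from [g (y + z) - g y = expR (gamma * y) * g z]. *)
Definition stage_slope (D y : R) : R := if 0 <= D then f1 D * expR (gamma * y) else 0.

Hypothesis sb : stage_bounds.
Variables (x : R -> R) (s e G : R).
Hypotheses (cx : continuous x) (se : s <= e) (G0 : x s <= G) (GK : G - x s <= K).
Hypothesis gap_le : forall t, s <= t <= e -> running_max x s t - x t <= a.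

Let clamp t := Num.min (Num.max t s) e.
Let D t := G - running_max x s (clamp t).
Let y t := running_max x s (clamp t) - x (clamp t).

Definition stage_path_value t := stage_value (D t) (y t).

Definition stage_path_slope t := if (s <= t) && (t < e) then stage_slope (D t) (y t) else 0.

Definition stage_error t t' := stage_path_value t' - stage_path_value t -
  stage_path_slope t * g (- (x t' - x t)).

(** Capping the maximum at [G] bounds the total increase independently of the path: at most [K],
    hence [L], from the maximum, and [1] from each indicator. *)
Definition stage_potential t :=
  Num.min G (running_max x s (clamp t)) + (s <= t)%R%:R + (e <= t)%R%:R + (D t < 0)%R%:R.

Let clamp_ge t : s <= clamp t.
Proof. by rewrite /clamp le_min le_max lexx orbT. Qed.

Let clamp_le t : clamp t <= e.
Proof. by rewrite /clamp ge_min lexx orbT. Qed.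

Let clamp_mono t t' : t <= t' -> clamp t <= clamp t'.
Proof.
move=> tt'; rewrite /clamp le_min !ge_min lexx orbT andbT.
by rewrite ge_max !le_max tt' lexx orbT.
Qed.

Let D_leK t : D t <= K.
Proof.
apply: le_trans GK; rewrite /D lerD2l lerN2.
by apply: running_max_ge => //; rewrite lexx clamp_ge.
Qed.

Let y_bounds t : 0 <= y t <= a.
Proof.
rewrite /y subr_ge0 running_max_ge ?clamp_ge ?lexx//=.
by rewrite gap_le// clamp_ge clamp_le.
Qed.

Let D_mono t t' : t <= t' -> D t' <= D t.
Proof. by move=> tt'; rewrite /D lerD2l lerN2 running_max_mono// clamp_mono. Qed.

Lemma stage_potential_mono t t' : t <= t' -> stage_potential t <= stage_potential t'.
Proof.
move=> tt'; rewrite /stage_potential !lerD//.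
- by rewrite le_min !ge_min lexx/= running_max_mono ?orbT// clamp_mono.
- by rewrite ler_nat; case: (leP s t) => // st; rewrite (le_trans st tt').
- by rewrite ler_nat; case: (leP e t) => // st; rewrite (le_trans st tt').
- by rewrite ler_nat; case: ltP => // D0; rewrite (le_lt_trans (D_mono tt') D0).
Qed.

Lemma stage_potential_range t t' : stage_potential t' - stage_potential t <= L + 3.
Proof.
have [L1 KL _] := sb_L sb.
have h1 : Num.min G (running_max x s (clamp t')) <= G by rewrite ge_min lexx.
have h2 : x s <= Num.min G (running_max x s (clamp t)).
  by rewrite le_min G0/= running_max_ge// lexx clamp_ge.
have hb (b b' : bool) : (b'%:R : R) - b%:R <= 1 by case: b; case: b' => /=; lra.
have -> : stage_potential t' - stage_potential t =
    (Num.min G (running_max x s (clamp t')) - Num.min G (running_max x s (clamp t))) +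
    ((s <= t')%R%:R - (s <= t)%R%:R) + ((e <= t')%R%:R - (e <= t)%R%:R) +
    ((D t' < 0)%R%:R - (D t < 0)%R%:R) by rewrite /stage_potential; ring.
have -> : L + 3 = L + 1 + 1 + 1 by ring.
by apply: lerD; [apply: lerD; [apply: lerD; [|exact: hb]|exact: hb]|exact: hb];
  rewrite (le_trans _ KL)// (le_trans _ GK)// lerB.
Qed.

Variables (t t' om del : R).
Hypotheses (tt' : t <= t') (om0 : 0 <= om) (del0 : 0 < del).
Hypothesis modulus : forall p q, clamp t <= p <= clamp t' -> clamp t <= q <= clamp t' ->
  Num.min 1 `|x p - x q| <= om.

(** Truncating the modulus at [1] makes [om = 1] admissible for every path and every mesh, which
    later gives the uniform bound for dominated convergence. For quantities at most [L] the
    truncation costs only the factor [L]. *)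
Let small z : 0 <= z <= L -> Num.min 1 z <= om -> z <= L * om.
Proof.
have [L1 _ _] := sb_L sb; move=> /andP[z0 zL].
by rewrite ge_min => /orP[] zo; nra.
Qed.

(** If the maximum moves, its new value is a value [x v] of the path inside the step, so the change
    of [D] and the drawdowns at both ends are bounded by the oscillation of the path around [v]. *)
Let step : D t' = D t \/ [/\ D t' < D t, Num.min 1 (D t - D t') <= om,
  Num.min 1 (y t) <= om & Num.min 1 (y t') <= om].
Proof.
have ct := clamp_mono tt'.
have [rmE|[v [/andP[v1 v2] rmE rml]]] := running_max_step cx (clamp_ge t) ct.
  by left; rewrite /D rmE.
right; rewrite -rmE in rml.
have cin : clamp t <= clamp t <= clamp t' by rewrite lexx ct.
have cin' : clamp t <= clamp t' <= clamp t' by rewrite lexx ct.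
have vin : clamp t <= v <= clamp t' by rewrite v1 v2.
have rmx : x (clamp t) <= running_max x s (clamp t).
  by rewrite running_max_ge// clamp_ge lexx.
have m1 := modulus vin cin; have m2 := modulus vin cin'.
have y'0 : 0 <= x v - x (clamp t').
  by rewrite subr_ge0 -rmE running_max_ge// clamp_ge lexx.
rewrite -rmE in m1 m2 y'0.
split.
- by rewrite /D ltrD2l ltrN2.
- apply: le_trans m1; rewrite /D le_min ge_min lexx/= ge_min.
  by rewrite [X in _ || X](_ : _ = true) ?orbT// ger0_norm; lra.
- apply: le_trans m1; rewrite /y le_min ge_min lexx/= ge_min.
  by rewrite [X in _ || X](_ : _ = true) ?orbT// ger0_norm; lra.
- apply: le_trans m2; rewrite /y le_min ge_min lexx/= ge_min.
  by rewrite [X in _ || X](_ : _ = true) ?orbT// ger0_norm; lra.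
Qed.

Let gap_step : `|y t' - y t| <= 2 * L * om.
Proof.
have [L1 KL aL] := sb_L sb.
have /andP[y0 ya] := y_bounds t; have /andP[y'0 y'a] := y_bounds t'.
have [om1'|om1'] := ltP om 1; last by rewrite ler_norml; nra.
have ct := clamp_mono tt'.
have := modulus (introT andP (conj ct (lexx _))) (introT andP (conj (lexx _) ct)).
rewrite ge_min leNgt om1'/= => xx.
have dd : `|D t' - D t| <= om.
  case: step => [->|[DD m _ _]]; first by rewrite subrr normr0.
  by rewrite ltr0_norm ?subr_lt0// opprB; move: m; rewrite ge_min => /orP[]; lra.
have -> : y t' - y t = - (D t' - D t) - (x (clamp t') - x (clamp t)).
  by rewrite /y /D; ring.
have oL : om <= L * om by rewrite ler_peMl.
by apply: (le_trans (ler_normB _ _)); rewrite normrN; lra.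
Qed.

Let in0K D0 : 0 <= D0 -> D0 <= K -> 0 <= D0 <= K.
Proof. by move=> ->. Qed.

Lemma stage_value_step :
  `|stage_path_value t' - stage_path_value t| <= 4 * L ^+ 4 * om.
Proof.
have [L1 KL aL] := sb_L sb.
have L0 : 0 <= L by lra.
have L2 : L <= L ^+ 2 by rewrite expr2; nra.
have L3 : L ^+ 2 <= L ^+ 3 by rewrite !exprS expr0 mulr1; nra.
have L4 : L ^+ 3 <= L ^+ 4 by rewrite (exprS _ 3); have : 0 <= L ^+ 3; [rewrite exprn_ge0|nra].
have Lp n : 0 <= L ^+ n by rewrite exprn_ge0.
have o2 : L ^+ 2 * om <= L ^+ 4 * om by rewrite ler_wpM2r// (le_trans L3).
have o3 : L ^+ 3 * om <= L ^+ 4 * om by rewrite ler_wpM2r.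
have o4 : 0 <= L ^+ 4 * om by rewrite mulr_ge0.
have /andP[y0 ya] := y_bounds t; have /andP[y'0 y'a] := y_bounds t'.
rewrite /stage_path_value /stage_value.
have DD := D_mono tt'.
have [D'0|D'0] := leP 0 (D t').
  have D0 : 0 <= D t by exact: le_trans DD.
  rewrite D0.
  have Dd : `|D t' - D t| <= L * om.
    case: step => [->|[lt m _ _]]; first by rewrite subrr normr0 mulr_ge0.
    rewrite ltr0_norm ?subr_lt0// opprB small//.
    by rewrite subr_ge0 DD/=; have := D_leK t; lra.
  have -> : f (D t') + f1 (D t') * g (y t') - (f (D t) + f1 (D t) * g (y t)) =
     (f (D t') - f (D t)) + f1 (D t') * (g (y t') - g (y t)) +
     (f1 (D t') - f1 (D t)) * g (y t) by ring.
  have DtK := in0K D0 (D_leK t); have Dt'K := in0K D'0 (D_leK t').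
  have e1 : `|f (D t') - f (D t)| <= L ^+ 2 * om.
    apply: (le_trans (sb_f_lip sb DtK Dt'K)).
    by rewrite expr2 -mulrA ler_wpM2l.
  have e2 : `|f1 (D t') * (g (y t') - g (y t))| <= 2 * L ^+ 3 * om.
    rewrite normrM; apply: (@le_trans _ _ (L * (L * (2 * L * om)))); last by lra.
    rewrite ler_pM//; first exact: (sb_f1 sb).
    by apply: (le_trans (sb_g_lip sb (y_bounds t) (y_bounds t'))); rewrite ler_wpM2l.
  have e3 : `|(f1 (D t') - f1 (D t)) * g (y t)| <= L ^+ 4 * om.
    rewrite normrM; apply: (@le_trans _ _ ((L * (L * om)) * (L * L))); last by lra.
    rewrite ler_pM//.
      by apply: (le_trans (sb_f1_lip sb DtK Dt'K)); rewrite ler_wpM2l.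
    by apply: (le_trans (sb_g sb (y_bounds t))); rewrite ler_wpM2l//; lra.
  apply: (le_trans (ler_normD _ _)); apply: (le_trans (lerD (ler_normD _ _) (lexx _))).
  lra.
have [D0|D0] := leP 0 (D t); last by rewrite subrr normr0 !mulr_ge0.
(* The overall maximum is passed during this step. Since the maximum moves, depth and drawdown
   before the step are both small, and the old value is close to [f 0]. *)
case: step => [E|[lt m my _]]; first lra.
have DtK := in0K D0 (D_leK t).
have Ds : D t <= L * om.
  apply: small; first by rewrite D0; have := D_leK t; lra.
  by apply: le_trans m; rewrite le_min !ge_min lexx/= lerDl oppr_ge0 (ltW D'0) orbT.
have ys : y t <= L * om.
  by apply: small => //; rewrite y0; lra.
have e1 : `|f 0 - f (D t)| <= L ^+ 2 * om.
  have K0 : 0 <= (0 : R) <= K by rewrite lexx (le_trans D0 (D_leK t)).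
  apply: (le_trans (sb_f_lip sb DtK K0)); rewrite sub0r normrN ger0_norm//.
  by rewrite expr2 -mulrA ler_wpM2l.
have e2 : `|f1 (D t) * g (y t)| <= L ^+ 3 * om.
  rewrite normrM; apply: (@le_trans _ _ (L * (L * (L * om)))); last by lra.
  rewrite ler_pM//; first exact: (sb_f1 sb).
  by apply: (le_trans (sb_g sb (y_bounds t))); rewrite ler_wpM2l.
rewrite opprD addrA; apply: (le_trans (ler_normB _ _)).
lra.
Qed.

Let u := g (- (x t' - x t)).

(** An increment larger than [del] is at most its fourth power over [del ^+ 3]; the expected sum of
    the fourth powers over all steps vanishes with the mesh. *)
Let u_le : `|u| <= del + u ^+ 4 / del ^+ 3.
Proof.
have d3 : 0 < del ^+ 3 by rewrite exprn_gt0.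
have u4 : 0 <= u ^+ 4 by rewrite exprn_even_ge0.
have [ud|du] := leP `|u| del; first by rewrite ler_wpDr// divr_ge0// ltW.
rewrite ler_wpDl ?(ltW del0)// ler_pdivlMr//.
have -> : u ^+ 4 = `|u| * `|u| ^+ 3 by rewrite -exprS -normrX ger0_norm.
by rewrite ler_wpM2l// lerXn2r ?nnegrE ?(ltW del0) ?(ltW du).
Qed.

(* The martingale increment removes the first order term, and the remainder is
   quadratic except at the steps where the stage starts, ends, or produces a
   new overall maximum, each of which increases the potential by one. *)
Lemma stage_error_step : `|stage_error t t'| <=
  4 * L ^+ 4 * ((om + del) * (stage_potential t' - stage_potential t) + u ^+ 4 / del ^+ 3).
Proof.
have [L1 KL aL] := sb_L sb.
have L0 : 0 <= L by lra.
have L2 : L <= L ^+ 2 by rewrite expr2; nra.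
have L3 : L ^+ 2 <= L ^+ 3 by rewrite !exprS expr0 mulr1; nra.
have L4 : L ^+ 3 <= L ^+ 4 by rewrite (exprS _ 3); have : 0 <= L ^+ 3; [rewrite exprn_ge0|nra].
have L40 : 0 <= 4 * L ^+ 4 by rewrite mulr_ge0// exprn_ge0.
have u40 : 0 <= u ^+ 4 / del ^+ 3 by apply: divr_ge0; [exact: exprn_even_ge0|exact/exprn_ge0/ltW].
have pot := stage_potential_mono tt'.
have vs := stage_value_step.
have trivial_step : stage_error t t' = 0 -> `|stage_error t t'| <=
  4 * L ^+ 4 * ((om + del) * (stage_potential t' - stage_potential t) + u ^+ 4 / del ^+ 3).
  by move=> ->; rewrite normr0 mulr_ge0// addr_ge0// mulr_ge0 ?subr_ge0// addr_ge0// ltW.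
have slope_le : `|stage_path_slope t| <= L ^+ 2.
  rewrite /stage_path_slope /stage_slope; case: ifP => _; last by rewrite normr0 exprn_ge0.
  have [D0|_] := leP 0 (D t); last by rewrite normr0 exprn_ge0.
  rewrite normrM expr2 ler_pM//; first by apply: (sb_f1 sb); exact: in0K.
  by rewrite ger0_norm ?expR_ge0// (sb_exp sb).
have special : 1 <= stage_potential t' - stage_potential t -> `|stage_error t t'| <=
  4 * L ^+ 4 * ((om + del) * (stage_potential t' - stage_potential t) + u ^+ 4 / del ^+ 3).
  move=> p1; rewrite /stage_error -/u.
  apply: (le_trans (ler_normB _ _)); rewrite normrM.
  have b1 : `|stage_path_slope t| * `|u| <= 4 * L ^+ 4 * (del + u ^+ 4 / del ^+ 3).
    apply: ler_pM => //; have : 0 <= L ^+ 4 by rewrite exprn_ge0.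
    lra.
  have b2 : 4 * L ^+ 4 * (om + (del + u ^+ 4 / del ^+ 3)) <=
     4 * L ^+ 4 * ((om + del) * (stage_potential t' - stage_potential t) + u ^+ 4 / del ^+ 3).
    rewrite ler_wpM2l// addrA lerD2r ler_peMr//; rewrite addr_ge0// ltW//.
  by apply: le_trans b2; rewrite mulrDr lerD.
have potE : stage_potential t' - stage_potential t =
    (Num.min G (running_max x s (clamp t')) - Num.min G (running_max x s (clamp t))) +
    ((s <= t')%R%:R - (s <= t)%R%:R) + ((e <= t')%R%:R - (e <= t)%R%:R) +
    ((D t' < 0)%R%:R - (D t < 0)%R%:R) by rewrite /stage_potential; ring.
have pm : 0 <= Num.min G (running_max x s (clamp t')) - Num.min G (running_max x s (clamp t)).
  by rewrite subr_ge0 le_min !ge_min lexx/= running_max_mono ?orbT// clamp_mono.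
have ps : 0 <= (s <= t')%R%:R - (s <= t)%R%:R :> R.
  by rewrite subr_ge0 ler_nat; case: (leP s t) => // st; rewrite (le_trans st tt').
have pe : 0 <= (e <= t')%R%:R - (e <= t)%R%:R :> R.
  by rewrite subr_ge0 ler_nat; case: (leP e t) => // et; rewrite (le_trans et tt').
have pD : 0 <= (D t' < 0)%R%:R - (D t < 0)%R%:R :> R.
  by rewrite subr_ge0 ler_nat; case: ltP => // D0; rewrite (le_lt_trans (D_mono tt') D0).
have sum_ge (A B C E : R) : 0 <= A -> 0 <= B -> 0 <= C -> 0 <= E ->
    [\/ 1 <= A, 1 <= B, 1 <= C | 1 <= E] -> 1 <= A + B + C + E.
  by move=> ? ? ? ? []; lra.
have [ts|st] := ltP t s.
  have sl0 : stage_path_slope t = 0 by rewrite /stage_path_slope leNgt ts.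
  have [t's|st'] := leP t' s.
    apply: trivial_step; rewrite /stage_error sl0 mul0r subr0.
    rewrite /stage_path_value /D /y /clamp (max_idPr (ltW ts)) (max_idPr t's).
    by rewrite subrr.
  by apply: special; rewrite potE sum_ge//; apply: Or42; rewrite (ltW st') (leNgt s t) ts subr0.
have [et|te] := leP e t.
  apply: trivial_step.
  have sl0 : stage_path_slope t = 0 by rewrite /stage_path_slope ltNge et andbF.
  rewrite /stage_error sl0 mul0r subr0 /stage_path_value /D /y /clamp.
  have st' := le_trans st tt'; have et' := le_trans et tt'.
  by rewrite !max_l// !min_r// subrr.
have [et'|t'e] := leP e t'.
  by apply: special; rewrite potE sum_ge//; apply: Or43; rewrite et' (leNgt e t) te subr0.
have ct : clamp t = t by rewrite /clamp max_l// min_l// ltW.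
have ct' : clamp t' = t'.
  by rewrite /clamp max_l ?(le_trans st tt')// min_l// ltW.
have [D0|D0] := ltP (D t) 0.
  apply: trivial_step; have D'0 := le_lt_trans (D_mono tt') D0.
  rewrite /stage_error /stage_path_value /stage_value /stage_path_slope /stage_slope.
  by rewrite !leNgt D0 D'0/= if_same mul0r !subrr.
have [D'0|D'0] := ltP (D t') 0.
  by apply: special; rewrite potE sum_ge//; apply: Or44; rewrite D'0 (ltNge (D t)) D0 subr0.
rewrite /stage_error /stage_path_value /stage_path_slope /stage_value /stage_slope.
rewrite st te/= D0 D'0.
pose dl := D t - D t'.
have dl0 : 0 <= dl by rewrite subr_ge0 D_mono.
(* [y t' - dl] is the new drawdown measured from the old maximum. By [scale_funD] the martingale
   increment accounts exactly for the passage of [g] from [y t] to this value, and three remainders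
   are left. *)
have yE : y t' - dl = y t + - (x t' - x t) by rewrite /dl /y /D ct ct'; ring.
have DtK := in0K D0 (D_leK t); have Dt'K := in0K D'0 (D_leK t').
have gE : g (y t' - dl) = g (y t) + expR (gamma * y t) * u by rewrite yE /g scale_funD.
have -> : f (D t') + f1 (D t') * g (y t') - (f (D t) + f1 (D t) * g (y t)) -
    f1 (D t) * expR (gamma * y t) * u =
   (f (D t') - f (D t) - f1 (D t) * (D t' - D t)) + (f1 (D t') - f1 (D t)) * g (y t') +
   f1 (D t) * (g (y t') - g (y t' - dl) - dl) by rewrite gE /dl; ring.
have /andP[y'0 y'a] := y_bounds t'.
have dlK : 0 <= dl <= K by rewrite dl0/= /dl; have := D_leK t; lra.
have dlpot : dl <= stage_potential t' - stage_potential t.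
  have -> : dl = running_max x s (clamp t') - running_max x s (clamp t).
    by rewrite /dl /D; ring.
  have m' : running_max x s (clamp t') <= G by rewrite -subr_ge0.
  have m : running_max x s (clamp t) <= G by rewrite -subr_ge0.
  by rewrite potE !min_r//; do 3 apply: ler_wpDr => //.
have bound : `|f (D t') - f (D t) - f1 (D t) * (D t' - D t)| +
    `|(f1 (D t') - f1 (D t)) * g (y t')| + `|f1 (D t) * (g (y t') - g (y t' - dl) - dl)| <=
    4 * L ^+ 4 * om * dl.
  have [dl_eq0|dl_neq0] := eqVneq dl 0.
    have E : D t' = D t by move: dl_eq0; rewrite /dl; lra.
    by rewrite dl_eq0 E !subrr !(mulr0, mul0r, normr0, subr0) subrr mulr0 normr0 !addr0.
  have [om_dl om_y'] : dl <= L * om /\ y t' <= L * om.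
    case: step => [E|[_ m _ m']]; first by move: dl_neq0; rewrite /dl E subrr eqxx.
    by split; apply: small => //; [case/andP: dlK; lra|rewrite y'0; lra].
  have e1 : `|f (D t') - f (D t) - f1 (D t) * (D t' - D t)| <= L ^+ 2 * om * dl.
    apply: (le_trans (sb_f_taylor sb DtK Dt'K)).
    have -> : (D t' - D t) ^+ 2 = dl * dl by rewrite /dl; ring.
    have -> : L ^+ 2 * om * dl = L * (L * om * dl) by ring.
    by rewrite ler_wpM2l// ler_wpM2r.
  have e2 : `|(f1 (D t') - f1 (D t)) * g (y t')| <= L ^+ 3 * om * dl.
    rewrite normrM; have -> : L ^+ 3 * om * dl = (L * dl) * (L * (L * om)) by ring.
    apply: ler_pM => //.
      apply: (le_trans (sb_f1_lip sb DtK Dt'K)).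
      by rewrite ler_wpM2l// distrC ger0_norm.
    by apply: (le_trans (sb_g sb (y_bounds t'))); rewrite ler_wpM2l.
  have e3 : `|f1 (D t) * (g (y t') - g (y t' - dl) - dl)| <= 2 * L ^+ 3 * om * dl.
    rewrite normrM; have -> : 2 * L ^+ 3 * om * dl = L * (L * dl * (2 * (L * om))) by ring.
    apply: ler_pM => //; first exact: (sb_f1 sb).
    apply: (le_trans (sb_g_taylor sb (y_bounds t') dlK)).
    by rewrite ler_wpM2l ?mulr_ge0//; lra.
  have o2 : L ^+ 2 * (om * dl) <= L ^+ 4 * (om * dl).
    by rewrite ler_wpM2r ?mulr_ge0// (le_trans L3).
  have o3 : L ^+ 3 * (om * dl) <= L ^+ 4 * (om * dl) by rewrite ler_wpM2r ?mulr_ge0.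
  by rewrite -!mulrA in e1 e2 e3 *; lra.
apply: (le_trans (ler_normD _ _)); apply: (le_trans (lerD (ler_normD _ _) (lexx _))).
apply: (le_trans bound); rewrite -[leLHS]mulrA ler_wpM2l// ler_wpDr//.
apply: (@le_trans _ _ ((om + del) * dl)); first by rewrite ler_wpM2r// lerDl ltW.
by rewrite ler_wpM2l// addr_ge0// ltW.
Qed.

End stage_error.

(** * Lipschitz and Taylor constants for smooth functions *)

Section taylor_bounds.
Context (R : realType).
Implicit Types (f df : R -> R) (A B L : R).

Lemma is_derive_continuous f df : (forall x : R, is_derive x (1 : R) f (df x)) -> continuous f.
Proof.
move=> fdf x; apply: differentiable_continuous; apply/derivable1_diffP.
by have := fdf x; case.
Qed.

Lemma continuous_norm_bounded f A B : continuous f ->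
  exists2 L : R, 0 <= L & forall c, A <= c <= B -> `|f c| <= L.
Proof.
move=> cf; have [AB|BA] := leP A B; last first.
  by exists 0 => // c /andP[Ac /(le_trans Ac)]; rewrite leNgt BA.
have cnf : continuous (fun x => `|f x|).
  by move=> x; apply: continuous_comp; [exact: cf|exact: norm_continuous].
have [c _ cmax] := EVT_max AB (continuous_subspaceT cnf).
by exists `|f c| => // z zAB; apply: cmax; rewrite in_itv.
Qed.

Lemma derive_bounded_lipschitz f df A B L : (forall x : R, is_derive x (1 : R) f (df x)) ->
  (forall c, A <= c <= B -> `|df c| <= L) ->
  forall x y, A <= x <= B -> A <= y <= B -> `|f y - f x| <= L * `|y - x|.
Proof.
move=> fdf dL x y; wlog xy : x y / x <= y.
  move=> H xAB yAB; have [/H|/ltW/H] := leP x y; first exact.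
  by rewrite distrC [`|y - x|]distrC; exact.
move=> /andP[Ax xB] /andP[Ay yB].
have [c] := MVT_segment xy (fun z _ => fdf z) (continuous_subspaceT (is_derive_continuous fdf)).
rewrite in_itv/= => /andP[xc cy] ->.
by rewrite normrM ler_wpM2r// dL// (le_trans Ax xc) (le_trans cy yB).
Qed.

Lemma derive_lipschitz_taylor f df A B L : (forall x : R, is_derive x (1 : R) f (df x)) ->
  (forall x y, A <= x <= B -> A <= y <= B -> `|df y - df x| <= L * `|y - x|) -> 0 <= L ->
  forall x y, A <= x <= B -> A <= y <= B ->
    `|f y - f x - df x * (y - x)| <= L * (y - x) ^+ 2.
Proof.
move=> fdf dL L0 x y xAB yAB.
have [c [cAB cxy fE]] : exists c, [/\ A <= c <= B, `|c - x| <= `|y - x| &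
    f y - f x = df c * (y - x)].
  move: xAB yAB => /andP[Ax xB] /andP[Ay yB].
  have cf := continuous_subspaceT (is_derive_continuous fdf).
  have [xy|/ltW yx] := leP x y.
    have [c] := MVT_segment xy (fun z _ => fdf z) (cf _).
    rewrite in_itv/= => /andP[xc cy] fE; exists c; split => //.
      by rewrite (le_trans Ax xc) (le_trans cy yB).
    by rewrite !ger0_norm ?subr_ge0// lerD2r.
  have [c] := MVT_segment yx (fun z _ => fdf z) (cf _).
  rewrite in_itv/= => /andP[yc cx] fE; exists c; split => //.
  - by rewrite (le_trans Ay yc) (le_trans cx xB).
  - by rewrite !ler0_norm ?subr_le0// lerN2 lerD2r.
  - by rewrite -opprB fE; ring.
rewrite fE -mulrBl normrM; have -> : (y - x) ^+ 2 = `|y - x| * `|y - x|.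
  by rewrite -normrM -expr2 ger0_norm ?sqr_ge0.
rewrite mulrA ler_wpM2r//; apply: (le_trans (dL _ _ xAB cAB)).
by rewrite ler_wpM2l.
Qed.

Lemma is_derive_expRM gamma y :
  is_derive y (1 : R) (fun y : R => expR (gamma * y)) (gamma * expR (gamma * y)).
Proof.
have dl : is_derive y (1 : R) (fun y : R => gamma * y) gamma.
  have := is_deriveZ gamma (is_derive_id y (1 : R)).
  by rewrite /GRing.scale/= mulr1.
by have := is_derive1_comp (is_derive_expR (gamma * y)) dl; rewrite mulrC.
Qed.

Lemma is_derive_scale_fun gamma y : is_derive y (1 : R) (scale_fun gamma) (expR (gamma * y)).
Proof.
rewrite /scale_fun; have [->|g0] := eqVneq gamma 0.
  by rewrite mul0r expR0; exact: is_derive_id.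
have d1 := is_derive_expRM gamma y.
have d2 := is_deriveB d1 (is_derive_cst (1 : R) y (1 : R)).
have := is_deriveZ gamma^-1 d2.
rewrite subr0 /GRing.scale/= mulrA mulVf// mul1r.
by congr is_derive; apply/funext => z /=; rewrite /GRing.scale/= mulrC.
Qed.

Lemma stage_bounds_exist gamma a K (f f1 f2 : R -> R) :
  (forall x : R, is_derive x (1 : R) f (f1 x)) ->
  (forall x : R, is_derive x (1 : R) f1 (f2 x)) -> continuous f2 ->
  exists L : R, stage_bounds gamma a K L f f1.
Proof.
move=> ff1 f1f2 cf2.
pose g := scale_fun gamma; pose g1 y := expR (gamma * y).
have gg1 y : is_derive y (1 : R) g (g1 y) by exact: is_derive_scale_fun.
have g1g2 y : is_derive y (1 : R) g1 (gamma * g1 y) by exact: is_derive_expRM.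
have cg2 : continuous (fun y => gamma * g1 y).
  move=> y; apply: cvgM; first exact: cvg_cst.
  exact: (is_derive_continuous g1g2).
have cf1 := is_derive_continuous f1f2; have cg1 := is_derive_continuous g1g2.
have [L1 L10 H1] := continuous_norm_bounded 0 K cf1.
have [L2 L20 H2] := continuous_norm_bounded 0 K cf2.
(* The interval has to contain [y - D] and [0] besides [y]. *)
have [L3 L30 H3] := continuous_norm_bounded (- `|K|) `|a| cg1.
have [L4 L40 H4] := continuous_norm_bounded (- `|K|) `|a| cg2.
have nK := ler_norm K; have na := ler_norm a.
have K0 := normr_ge0 K; have a0 := normr_ge0 a.
pose L := 1 + `|K| + `|a| + L1 + L2 + L3 + L4.
have mono (X Y c : R) : 0 <= Y -> c <= L -> X <= c * Y -> X <= L * Y.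
  by move=> Y0 cL /le_trans; apply; rewrite ler_wpM2r.
have L2L : L2 <= L by rewrite /L; lra.
have inA y : 0 <= y <= a -> - `|K| <= y <= `|a|.
  by move=> /andP[? ?]; apply/andP; split; lra.
have g_lip := derive_bounded_lipschitz gg1 H3.
have g1_lip := derive_bounded_lipschitz g1g2 H4.
have g0 : - `|K| <= (0 : R) <= `|a| by rewrite oppr_le0 K0 a0.
exists L; split.
- by split; rewrite /L; lra.
- by move=> D /H1 h; apply: (le_trans h); rewrite /L; lra.
- move=> D D' Dk D'k; apply: mono (derive_bounded_lipschitz ff1 H1 Dk D'k) => //.
  by rewrite /L; lra.
- by move=> D D' Dk D'k; apply: mono (derive_bounded_lipschitz f1f2 H2 Dk D'k).
- move=> D D' Dk D'k; apply: mono (derive_lipschitz_taylor ff1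
    (derive_bounded_lipschitz f1f2 H2) L20 Dk D'k) => //.
  exact: sqr_ge0.
- move=> y ya; have /andP[y0 _] := ya.
  have := g_lip _ _ g0 (inA _ ya); rewrite /g scale_fun0 !subr0 (ger0_norm y0).
  by apply: mono => //; rewrite /L; lra.
- move=> y y' ya y'a; apply: mono (g_lip _ _ (inA _ ya) (inA _ y'a)) => //.
  by rewrite /L; lra.
- move=> y D ya /andP[D0 DK]; have /andP[y0 ya'] := ya.
  have ydin : - `|K| <= y - D <= `|a| by apply/andP; split; lra.
  have yDy : y - D <= y by rewrite gerBl.
  have [c] := MVT_segment yDy (fun z _ => gg1 z)
    (continuous_subspaceT (is_derive_continuous gg1)).
  have -> : y - (y - D) = D by ring.
  rewrite in_itv/= => /andP[c1 c2] ->.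
  have cin : - `|K| <= c <= `|a| by apply/andP; split; lra.
  rewrite -[X in _ - X]mul1r -mulrBl normrM (ger0_norm D0) mulrAC ler_wpM2r//.
  (* The derivative of the scale function is [1] at [0], so at [c] it differs from [1] by at most
     [L4] times the absolute value of [c]. *)
  have := g1_lip _ _ g0 cin; rewrite /g1 mulr0 expR0 subr0 => h.
  apply: (le_trans h); apply: (@le_trans _ _ (L4 * (y + D))); last first.
    by rewrite ler_wpM2r ?addr_ge0// /L; lra.
  rewrite ler_wpM2l// ler_norml; apply/andP; split; lra.
- move=> y ya; have := H3 _ (inA _ ya); rewrite ger0_norm ?expR_ge0// => h.
  by apply: (le_trans h); rewrite /L; lra.
Qed.

End taylor_bounds.

Section stage_error_sum.
Context (R : realType).
Variables (gamma a K L : R) (f f1 : R -> R).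
Hypothesis sb : stage_bounds gamma a K L f f1.
Variables (x : R -> R) (s e G : R).
Hypotheses (cx : continuous x) (s0 : 0 <= s) (se : s <= e) (G0 : x s <= G) (GK : G - x s <= K).
Hypothesis gap_le : forall t, s <= t <= e -> running_max x s t - x t <= a.

Let Z := stage_path_value gamma f f1 x s e G.
Let A := stage_path_slope gamma f1 x s e G.

Lemma stage_error_sum (N : nat) (h om del : R) (u : nat -> R) :
  (forall i, u i = scale_fun gamma (- (x (i%:R * h + h) - x (i%:R * h)))) ->
  0 <= h -> 0 <= om -> 0 < del ->
  (forall p q, 0 <= p <= e -> 0 <= q <= e -> `|p - q| <= h -> Num.min 1 `|x p - x q| <= om) ->
  `|Z (N%:R * h) - Z 0 - \sum_(i < N) A (i%:R * h) * u i| <=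
  4 * L ^+ 4 * ((om + del) * (L + 3) + (\sum_(i < N) u i ^+ 4) / del ^+ 3).
Proof.
move=> uE h0 om0 del0 modulus.
pose psi := stage_potential x s e G.
have step i : `|Z (i%:R * h + h) - Z (i%:R * h) - A (i%:R * h) * u i| <=
    4 * L ^+ 4 * ((om + del) * (psi (i%:R * h + h) - psi (i%:R * h)) + u i ^+ 4 / del ^+ 3).
  rewrite !uE; apply: (stage_error_step sb cx se GK gap_le) => //; first by rewrite lerDl.
  set t := i%:R * h; move=> p q /andP[p1 p2] /andP[q1 q2].
  (* Clamping does not expand distances, so the clamped ends of a step are at most [h] apart. *)
  have cl : Num.min (Num.max (t + h) s) e - Num.min (Num.max t s) e <= h.
    have [ts|ts] := leP t s; have [ths|ths] := leP (t + h) s.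
    - by rewrite subrr.
    - by rewrite (min_l se); have [h1|h1] := leP (t + h) e; lra.
    - by lra.
    - by have [h1|h1] := leP (t + h) e; have [h2|h2] := leP t e; lra.
  have cs t' : s <= Num.min (Num.max t' s) e by rewrite le_min le_max lexx orbT.
  have ce t' : Num.min (Num.max t' s) e <= e by rewrite ge_min lexx orbT.
  apply: modulus.
  - by rewrite (le_trans s0 (le_trans (cs t) p1)) (le_trans p2 (ce _)).
  - by rewrite (le_trans s0 (le_trans (cs t) q1)) (le_trans q2 (ce _)).
  - by rewrite ler_norml; apply/andP; split; lra.
have {}step : `|Z (N%:R * h) - Z 0 - \sum_(i < N) A (i%:R * h) * u i| <=
  4 * L ^+ 4 * ((om + del) * (psi (N%:R * h) - psi 0) + (\sum_(i < N) u i ^+ 4) / del ^+ 3).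
  elim: N => [|N IH].
    by rewrite !big_ord0 mul0r !subrr normr0 !(mulr0, mul0r, addr0).
  rewrite !big_ord_recr/= -natr1 mulrDl mul1r.
  set S := \sum_(i < N) _ in IH *; set S4 := \sum_(i < N) u i ^+ 4 in IH *.
  have -> : Z (N%:R * h + h) - Z 0 - (S + A (N%:R * h) * u N) =
     (Z (N%:R * h) - Z 0 - S) + (Z (N%:R * h + h) - Z (N%:R * h) - A (N%:R * h) * u N) by ring.
  apply: (le_trans (ler_normD _ _)); apply: (le_trans (lerD IH (step N))).
  by rewrite -mulrDr le_eqVlt; apply/orP; left; apply/eqP; ring.
have L0 : 0 <= L by have [? _ _] := sb_L sb; lra.
apply: (le_trans step); rewrite ler_wpM2l ?mulr_ge0 ?exprn_ge0//.
by rewrite lerD2r ler_wpM2l ?addr_ge0 ?(ltW del0)// (stage_potential_range sb cx se G0 GK).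
Qed.

End stage_error_sum.

(** * The drifted process and its past *)

Section drifted_path.
Context (R : realType) (d : measure_display) (T : measurableType d).
Variables (P : probability T R) (W : R -> {RV P >-> R}).
Hypothesis hW : brownian_motion W.
Variables (mu sigma : R).
Hypothesis sigma0 : 0 < sigma.

Let gamma := 2 * mu / sigma ^+ 2.
Let X := drifted_bm W mu sigma.

(* The process frozen at its initial value at negative times, so that its paths
   are continuous on the whole line. *)
Definition extended_bm (t : R) (w : T) : R := X (Num.max t 0) w.

Lemma extended_bmE t w : 0 <= t -> extended_bm t w = X t w.
Proof. by move=> t0; rewrite /extended_bm max_l. Qed.

Lemma measurable_extended_bm t : measurable_fun setT (extended_bm t).
Proof. exact: measurable_drifted_bm. Qed.

Lemma continuous_extended_bm w : continuous (extended_bm^~ w).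
Proof.
have cW : {within `[0, +oo[, continuous (fun t : R => W t w)} by exact: (bm_continuous hW).
have cWm : continuous (fun t : R => W (Num.max t 0) w : R).
  move=> t; apply/cvgrPdist_lt => e e0.
  have m0 : `[0, +oo[%classic (Num.max t 0) by rewrite /= in_itv/= andbT le_max lexx orbT.
  have /cvgrPdist_lt/(_ _ e0) := (subspace_continuousP _ _).1 cW _ m0.
  rewrite near_withinE near_nbhs => /nbhs_ballP[r /= r0 rb].
  exists r => //= u; rewrite /ball/= => tu; apply: rb; last first.
    by rewrite /= in_itv/= andbT le_max lexx orbT.
  rewrite /ball/=; apply: le_lt_trans tu.
  have [t0|t0] := leP t 0; have [u0|u0] := leP u 0 => //.
  - by rewrite subrr normr0.
  - by rewrite sub0r normrN [leRHS]distrC !ger0_norm; lra.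
  - by rewrite subr0 !gtr0_norm; lra.
move=> t; apply: cvgD; last by apply: cvgM; [exact: cvg_cst|exact: cWm].
apply: cvgM; first exact: cvg_cst.
by apply: (@continuous_max _ _ id (fun=> 0)); [exact: cvg_id|exact: cvg_cst].
Qed.

Let Y := extended_bm.

Lemma measurable_past (t : R) s : 0 <= s <= t ->
  measurable_fun setT (W s : g_sigma_algebraType (cylinder W t) -> R).
Proof.
move=> st _ B mB; rewrite setTI; apply: sub_sigma_algebra.
rewrite -[X in cylinder _ _ X]setIT; apply: cylinderI => //; exact: cylinderT.
Qed.

Lemma measurable_past_extended (t s : R) : 0 <= t ->
  measurable_fun setT (Y (Num.min s t) : g_sigma_algebraType (cylinder W t) -> R).
Proof.
move=> t0; apply: measurable_funD => //; apply: measurable_funM => //.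
by apply: measurable_past; rewrite le_max lexx orbT/= ge_max t0 ge_min lexx orbT.
Qed.

(** Since the value at [t] depends only on the path up to [t], the path may be replaced by the one
    stopped at [t], all of whose values are measurable for the past. *)
Lemma measurable_past_stage_fun (a : R) n r h t : 0 < a -> 0 <= t ->
  measurable_fun setT (fun p : R * R => h p.1 p.2) ->
  measurable_fun setT ((fun w => stage_fun (Y^~ w) a n r h t) :
    g_sigma_algebraType (cylinder W t) -> R).
Proof.
move=> a0 t0 mh.
pose Yt s w := Y (Num.min s t) w.
have cYt w : continuous (Yt^~ w).
  move=> s; apply: (@continuous_comp _ _ _ (fun s => Num.min s t) (Y^~ w)).
    by apply: (@continuous_min _ _ id (fun=> t)); [exact: cvg_id|exact: cvg_cst].
  exact: continuous_extended_bm.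
have -> : (fun w => stage_fun (Y^~ w) a n r h t) = (fun w => stage_fun (Yt^~ w) a n r h t).
  apply/funext => w; apply: stage_fun_local => //; first exact: continuous_extended_bm.
  by move=> u /andP[_ ut]; rewrite /Yt min_l.
apply: (@measurable_stage_fun _ _ (g_sigma_algebraType (cylinder W t)) Yt) => //.
by move=> s; exact: measurable_past_extended.
Qed.

(* The value of the scale function at the next increment is independent of the
   past and centered. *)
Lemma stage_increment_mean0 (a c : R) n r k t h : 0 < a -> 0 <= t -> 0 < h ->
  measurable_fun setT (fun p : R * R => k p.1 p.2) ->
  (forall w, `|stage_fun (Y^~ w) a n r k t| <= c) ->
  let u w := scale_fun gamma (- (Y (t + h) w - Y t w)) in
  P.-integrable setT (fun w => (stage_fun (Y^~ w) a n r k t * u w)%:E) /\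
  (\int[P]_w (stage_fun (Y^~ w) a n r k t * u w)%:E = 0)%E.
Proof.
move=> a0 t0 h0 mk bc u.
have [iu u0] := drifted_scale_mean0 hW mu sigma0 t0 h0.
have uE w : u w = scale_fun gamma (- (mu * h + sigma * (W (t + h) w - W t w))).
  by rewrite /u /Y !extended_bmE ?addr_ge0 ?(ltW h0)// drifted_bm_increment.
have uE' w : u w = scale_fun gamma (- (X (t + h) w - X t w)).
  by rewrite /u /Y !extended_bmE ?addr_ge0 ?(ltW h0).
split.
  apply: (@le_integrable _ _ _ _ _ _ _ (fun w => c%:E * (u w)%:E)%E) => //.
  - apply/measurable_EFinP; apply: measurable_funM.
      exact: (measurable_stage_fun measurable_extended_bm continuous_extended_bm).
    apply: (measurableT_comp (measurable_scale_fun gamma)); apply: measurable_funN.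
    by apply: measurable_funB; exact: measurable_extended_bm.
  - move=> w _; rewrite -EFinM !abse_EFin lee_fin !normrM ler_wpM2r//.
    exact: (le_trans (bc w) (ler_norm _)).
  - by apply: integrableZl => //; under eq_fun do rewrite uE'.
pose S := g_sigma_algebraType (cylinder W t).
have idm : measurable_fun setT (id : T -> S).
  move=> _ B mB; rewrite setTI preimage_id.
  by have [] := past_independent hW t0 (ltW h0) (@measurableT _ R) mB.
under eq_integral do rewrite uE.
apply: (@integral_independent_mean0 _ _ _ _ S P id (fun w => W (t + h) w - W t w)
  (fun w => stage_fun (Y^~ w) a n r k t)
  (fun z => scale_fun gamma (- (mu * h + sigma * z))) c) => //.
- by apply: measurable_funB; exact: measurable_funPT.
- exact: measurable_past_stage_fun.
- apply: (measurableT_comp (measurable_scale_fun gamma)); apply: measurable_funN.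
  by apply: measurable_funD => //; exact: mulrl_measurable.
- move=> A D mA mD; rewrite preimage_id.
  by have [_] := past_independent hW t0 (ltW h0) mD mA.
- rewrite (_ : _ \o _ = (fun w => (scale_fun gamma (- (X (t + h) w - X t w)))%:E))//.
  by apply/funext => w /=; rewrite -drifted_bm_increment.
- by under eq_integral do rewrite -(drifted_bm_increment W); exact: u0.
Qed.

End drifted_path.

Lemma max_depth_step (R : realType) (a d r u v c : R) : 0 < a -> 0 <= d - u -> d - u <= c ->
  r - v = a -> u <= r -> 0 <= Num.max d r - v <= c + a.
Proof. by move=> *; case: (leP d r) => h; apply/andP; split; lra. Qed.

(** * The mean over a stage *)

Section stage_path.
Context (R : realType).
Variables (a : R) (x : R -> R) (n : nat).
Hypotheses (a0 : 0 < a) (cx : continuous x).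

(** A stage adds at most [a] to the depth: it ends exactly [a] below a maximum that is not lower
    than its starting point. This supplies the range [K = n * a] of the depths in the stage. *)
Lemma dd_depth_bound m s : dd_time x a m = s%:E ->
  0 <= dd_max x a m - x s <= m%:R * a.
Proof.
elim: m s => [|m IH] e.
  rewrite dd_time0 => -[<-]; rewrite /dd_max dd_time0/= running_max_id// subrr mul0r.
  by rewrite lexx.
move=> me; have [s [s0 se ms]] := dd_time_fin_le cx a0 (leqnSn m) me.
have /andP[d0 IHs] := IH _ ms; rewrite (dd_maxS cx a0 ms me).
have [|[e' []]] := dd_timeS cx a0 ms; rewrite me => -[]// <- _ ea _.
have xs := running_max_ge cx (introT andP (conj (lexx s) se)).
rewrite -natr1 mulrDl mul1r.
exact: max_depth_step a0 d0 IHs ea xs.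
Qed.

Variable (t1 : R).

(** The minimum with [t1] is finite even when the next drawdown time is not, so [fine] loses
    nothing. [stage_start] is cut likewise, to keep the interval ordered when the stage begins after
    [t1]. *)
Definition stage_end : R := fine (Order.min (dd_time x a n.+1) t1%:E).

Definition stage_start : R := Num.min (fine (dd_time x a n)) stage_end.

Hypothesis nt1 : (dd_time x a n <= t1%:E)%E.

Lemma stage_startE : dd_time x a n = stage_start%:E.
Proof.
have [nE|[s s0 ns]] := dd_time_fin n cx a0; first by have := nt1; rewrite nE.
rewrite /stage_start /stage_end ns [fine s%:E]/= min_l//.
have := dd_time_ltS cx a0 ns; move: nt1; rewrite ns lee_fin => st1.
have [->|[e e0 ->]] := dd_time_fin n.+1 cx a0.
  by rewrite min_r ?leey.
by rewrite lte_fin -EFin_min/= le_min st1 andbT => /ltW.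
Qed.

Lemma stage_end_facts : [/\ 0 <= stage_start, stage_start <= stage_end & stage_end <= t1].
Proof.
split; first by rewrite -lee_fin -stage_startE dd_time_ge0.
- by rewrite /stage_start ge_min lexx orbT.
- rewrite /stage_end; have [->|[e e0 ->]] := dd_time_fin n.+1 cx a0.
    by rewrite min_r ?leey.
  by rewrite -EFin_min/= ge_min lexx orbT.
Qed.

Lemma stage_end_lt t : t < t1 -> (t < stage_end) = (t%:E < dd_time x a n.+1)%E.
Proof.
move=> tt1; rewrite /stage_end; have [->|[e e0 ->]] := dd_time_fin n.+1 cx a0.
  by rewrite min_r ?leey//= tt1 ltry.
by rewrite -EFin_min/= lt_min tt1 andbT lte_fin.
Qed.

Lemma stage_gap_le t : stage_start <= t <= stage_end -> running_max x stage_start t - x t <= a.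
Proof.
move=> /andP[st te].
have [[_ /(_ t st)/ltW//]|[e [ne se ea lt_e]]] := dd_timeS cx a0 stage_startE.
have : t <= e.
  by apply: (le_trans te); rewrite /stage_end ne -EFin_min/= ge_min lexx.
by rewrite le_eqVlt => /predU1P[->|/(lt_e _ st)/ltW//]; rewrite ea.
Qed.

Lemma stage_max_start : x stage_start <= dd_max x a n.
Proof. by have /andP[+ _] := dd_depth_bound stage_startE; rewrite subr_ge0. Qed.

Lemma stage_depth_start : dd_max x a n - x stage_start <= n%:R * a.
Proof. by have /andP[] := dd_depth_bound stage_startE. Qed.

(** The left-hand side uses the end of the stage, which lies in the future of [t]; on the right
    stands an adapted functional, which can be multiplied by the independent next increment. *)
Lemma stage_path_slopeE gamma f1 r t : dd_records x a n = r -> t < t1 ->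
  stage_path_slope gamma f1 x stage_start stage_end (dd_max x a n) t =
  stage_fun x a n r (stage_slope gamma f1) t.
Proof.
move=> nr tt1; rewrite /stage_path_slope /stage_fun stage_end_lt//.
have -> : `[< in_stage x a n r t >] = (stage_start <= t) && (t%:E < dd_time x a n.+1)%E.
  apply/asboolP/andP; rewrite /in_stage.
    by rewrite {1}stage_startE lee_fin => -[].
  by rewrite {1}stage_startE lee_fin => -[].
case: ifP => // /andP[st te].
rewrite /stage_depth /stage_gap max_l// min_l; last by rewrite ltW// stage_end_lt.
by rewrite stage_startE.
Qed.

Lemma stage_path_value0 gamma f f1 :
  stage_path_value gamma f f1 x stage_start stage_end (dd_max x a n) 0 =
  f (dd_max x a n - x stage_start).
Proof.
have [s0 se _] := stage_end_facts; rewrite /stage_path_value (max_r s0) (min_l se).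
rewrite running_max_id// subrr /stage_value subr_ge0 stage_max_start.
by rewrite scale_fun0 mulr0 addr0.
Qed.

Lemma stage_path_value_end gamma f f1 :
  stage_path_value gamma f f1 x stage_start stage_end (dd_max x a n) t1 =
  stage_value gamma f f1 (dd_max x a n - running_max x stage_start stage_end)
    (running_max x stage_start stage_end - x stage_end).
Proof.
have [s0 se et] := stage_end_facts; rewrite /stage_path_value.
by rewrite (max_l (le_trans se et)) (min_r et).
Qed.

End stage_path.

Section stage_variables.
Context (R : realType).
Variables (gamma a : R) (f f1 : R -> R) (n r : nat).

Definition stage_init (x : R -> R) (t1 : R) : R :=
  if `[< (dd_time x a n <= t1%:E)%E /\ dd_records x a n = r >]
  then f (dd_max x a n - x (stage_start a x n t1)) else 0.

Definition stage_final (x : R -> R) (t1 : R) : R :=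
  if `[< (dd_time x a n <= t1%:E)%E /\ dd_records x a n = r >] then
    stage_value gamma f f1
      (dd_max x a n - running_max x (stage_start a x n t1) (stage_end a x n t1))
      (running_max x (stage_start a x n t1) (stage_end a x n t1) - x (stage_end a x n t1))
  else 0.

Hypothesis a0 : 0 < a.
Variable (L : R).
Hypothesis sb : stage_bounds gamma a (n%:R * a) L f f1.

Let L0 : 0 <= L.
Proof. by have [? _ _] := sb_L sb; lra. Qed.

Lemma stage_fun_bound (x : R -> R) (t : R) : continuous x ->
  `|stage_fun x a n r (stage_slope gamma f1) t| <= L ^+ 2.
Proof.
move=> cx; rewrite /stage_fun; case: asboolP => [[nt tn _]|_]; last by rewrite normr0 exprn_ge0.
have sE := stage_startE a0 cx nt.
have [s0 se et] := stage_end_facts a0 cx nt.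
have eE : stage_end a x n t = t.
  rewrite /stage_end; have [->|[e e0 ne]] := dd_time_fin n.+1 cx a0.
    by rewrite min_r ?leey.
  by rewrite ne -EFin_min/= min_r// ltW// -lte_fin -ne.
rewrite /stage_slope; have [D0|_] := leP 0 (stage_depth x a n t); last by rewrite normr0 exprn_ge0.
rewrite normrM expr2 ler_pM//.
  apply: (sb_f1 sb); rewrite D0/= /stage_depth.
  apply: le_trans (stage_depth_start a0 cx nt); rewrite lerD2l lerN2 sE/=.
  by rewrite running_max_ge// lexx -{2}eE.
rewrite ger0_norm ?expR_ge0// (sb_exp sb)//.
rewrite /stage_gap sE/= subr_ge0 running_max_ge ?lexx ?andbT//; last by rewrite -{2}eE.
by rewrite (stage_gap_le a0 cx nt)//= eE lexx andbT -{2}eE.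
Qed.

Lemma stage_value_bound (D y : R) : D <= n%:R * a -> 0 <= y <= a ->
  `|stage_value gamma f f1 D y| <= `|f 0| + L ^+ 2 + L ^+ 3.
Proof.
have [L1 KL aL] := sb_L sb; move=> DK ya; rewrite /stage_value.
have [D0|_] := leP 0 D; last first.
  by rewrite -addrA lerDl addr_ge0// exprn_ge0.
have DK' : 0 <= D <= n%:R * a by rewrite D0.
have K0 : 0 <= (0 : R) <= n%:R * a by rewrite lexx (le_trans D0 DK).
apply: (le_trans (ler_normD _ _)); apply: lerD.
  have -> : f D = f 0 + (f D - f 0) by ring.
  apply: (le_trans (ler_normD _ _)); rewrite lerD2l.
  apply: (le_trans (sb_f_lip sb K0 DK')); rewrite subr0 ger0_norm// expr2 ler_wpM2l//.
  exact: le_trans KL.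
rewrite normrM exprS ler_pM//; first exact: (sb_f1 sb).
apply: (le_trans (sb_g sb ya)); rewrite expr2 ler_wpM2l//.
by case/andP: ya => _ /le_trans; apply.
Qed.

Lemma stage_final_bound (x : R -> R) (t1 : R) : continuous x ->
  `|stage_final x t1| <= `|f 0| + L ^+ 2 + L ^+ 3.
Proof.
move=> cx; rewrite /stage_final; case: asboolP => [[nt _]|_]; last first.
  by rewrite normr0 !addr_ge0// exprn_ge0.
have [s0 se et] := stage_end_facts a0 cx nt.
apply: stage_value_bound.
  apply: le_trans (stage_depth_start a0 cx nt); rewrite lerD2l lerN2.
  by rewrite running_max_ge// lexx se.
by rewrite subr_ge0 running_max_ge ?lexx ?se//= (stage_gap_le a0 cx nt)// lexx se.
Qed.

Lemma stage_init_bound (x : R -> R) (t1 : R) : continuous x ->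
  `|stage_init x t1| <= `|f 0| + L ^+ 2 + L ^+ 3.
Proof.
move=> cx; rewrite /stage_init; case: asboolP => [[nt _]|_]; last first.
  by rewrite normr0 !addr_ge0// exprn_ge0.
have := @stage_value_bound (dd_max x a n - x (stage_start a x n t1)) 0.
rewrite /stage_value subr_ge0 (stage_max_start a0 cx nt) scale_fun0 mulr0 addr0.
by apply; rewrite ?(stage_depth_start a0 cx nt)// lexx ltW.
Qed.

Lemma stage_path_error (x : R -> R) (t1 : R) (N : nat) (h om del : R) (u : nat -> R) :
  continuous x -> 0 < t1 -> 0 <= om -> 0 < del ->
  h = t1 / N.+1%:R ->
  (forall i, u i = scale_fun gamma (- (x (i%:R * h + h) - x (i%:R * h)))) ->
  (forall p q : R, 0 <= p <= t1 -> `|p - q| <= h -> Num.min 1 `|x p - x q| <= om) ->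
  `|stage_final x t1 - stage_init x t1 -
    \sum_(i < N.+1) stage_fun x a n r (stage_slope gamma f1) (i%:R * h) * u i| <=
  4 * L ^+ 4 * ((om + del) * (L + 3) + (\sum_(i < N.+1) u i ^+ 4) / del ^+ 3).
Proof.
move=> cx t10 om0 del0 hE uE modulus.
have h0 : 0 < h by rewrite hE divr_gt0.
have ih (i : 'I_N.+1) : i%:R * h < t1.
  by rewrite hE mulrCA mulrA ltr_pdivrMr// ltr_pM2l// ltr_nat.
rewrite /stage_final /stage_init; case: asboolP => [[nt nr]|nB].
  have [s0 se et] := stage_end_facts a0 cx nt.
  rewrite -(stage_path_value_end a0 cx nt) -(stage_path_value0 a0 cx nt gamma f f1).
  under eq_bigr do rewrite -(stage_path_slopeE a0 cx nt gamma f1 nr (ih _)).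
  have {3}<- : N.+1%:R * h = t1 by rewrite hE mulrC divfK.
  apply: (stage_error_sum sb cx s0 se (stage_max_start a0 cx nt) (stage_depth_start a0 cx nt)
    (stage_gap_le a0 cx nt)) => //; first exact: ltW.
  move=> p q /andP[p0 pe] _; apply: modulus; by rewrite p0 (le_trans pe et).
(* Off the event the stage has not started at any grid time or has another number of records, so
   every slope is zero. *)
rewrite big1 ?subrr ?normr0.
  rewrite !mulr_ge0 ?exprn_ge0// addr_ge0// ?mulr_ge0 ?addr_ge0 ?invr_ge0 ?exprn_ge0// ?(ltW del0)//.
  by rewrite ?sumr_ge0// => i _; rewrite exprn_even_ge0.
move=> i _; rewrite /stage_fun asboolF ?mul0r// => -[nt _ nr]; apply: nB; split => //.
by apply: (le_trans nt); rewrite lee_fin ltW.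
Qed.

End stage_variables.

(** * Means of bounded and approximated variables *)

Section mean.
Context (R : realType) (d : measure_display) (T : measurableType d).
Variable P : probability T R.

Lemma Rintegral_prob_cst (c : R) : \int[P]_w c = c.
Proof.
rewrite Rintegral_cst// [X in fine X](_ : _ = 1%E) ?mulr1//; exact: probability_setT.
Qed.

Lemma integrable_bounded (f : T -> R) (c : R) : measurable_fun setT f ->
  (forall w, `|f w| <= c) -> P.-integrable setT (EFin \o f).
Proof.
move=> mf bf; apply: (@le_integrable _ _ _ _ _ _ _ (EFin \o cst c)) => //.
- exact/measurable_EFinP.
- by move=> w _; rewrite !abse_EFin lee_fin (le_trans (bf w))// ler_norm.
- exact: finite_measure_integrable_cst.
Qed.

Lemma integrable_EFinD (f g : T -> R) : P.-integrable setT (EFin \o f) ->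
  P.-integrable setT (EFin \o g) -> P.-integrable setT (EFin \o (fun w => f w + g w)).
Proof.
move=> intf intg; rewrite (_ : _ \o _ = (EFin \o f) \+ (EFin \o g))%E; first exact: integrableD.
exact/funext.
Qed.

Lemma integrable_EFinB (f g : T -> R) : P.-integrable setT (EFin \o f) ->
  P.-integrable setT (EFin \o g) -> P.-integrable setT (EFin \o (fun w => f w - g w)).
Proof.
move=> intf intg; rewrite (_ : _ \o _ = (EFin \o f) \- (EFin \o g))%E; first exact: integrableB.
exact/funext.
Qed.

Lemma integrable_EFinZl (f : T -> R) (c : R) : P.-integrable setT (EFin \o f) ->
  P.-integrable setT (EFin \o (fun w => c * f w)).
Proof.
move=> intf; rewrite (_ : _ \o _ = fun w => (c%:E * (EFin \o f) w)%E); first exact: integrableZl.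
exact/funext.
Qed.

Lemma integrable_fsum (I : Type) (s : seq I) (p : pred I) (f : I -> T -> R) :
  (forall i, p i -> P.-integrable setT (EFin \o f i)) ->
  P.-integrable setT (EFin \o (fun w => \sum_(i <- s | p i) f i w)).
Proof.
move=> intf; rewrite (_ : _ \o _ = (fun w => (\sum_(i <- s | p i) (EFin \o f i) w)%E)).
  exact: integrable_sum.
by apply/funext => w /=; rewrite sumEFin.
Qed.

Lemma Rintegral_fsum (I : Type) (s : seq I) (p : pred I) (f : I -> T -> R) :
  (forall i, p i -> P.-integrable setT (EFin \o f i)) ->
  \int[P]_w (\sum_(i <- s | p i) f i w) = \sum_(i <- s | p i) \int[P]_w f i w.
Proof.
move=> intf; elim: s => [|i s IH].
  by rewrite big_nil; under eq_Rintegral do rewrite big_nil; rewrite Rintegral_cst// mul0r.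
rewrite big_cons; under eq_Rintegral do rewrite big_cons; case: ifPn => pi //.
rewrite RintegralD//; first by rewrite IH.
- exact: intf.
- exact: integrable_fsum.
Qed.

Lemma bounded_cvg_mean (fn : nat -> T -> R) (f : T -> R) (c : R) :
  (forall n, measurable_fun setT (fn n)) -> measurable_fun setT f ->
  (forall n w, `|fn n w| <= c) ->
  {ae P, forall w, fn n w @[n --> \oo] --> f w} ->
  P.-integrable setT (EFin \o f) /\
  (\int[P]_w fn n w) @[n --> \oo] --> \int[P]_w f w.
Proof.
move=> mfn mf bfn fnf.
have ic : P.-integrable setT (EFin \o cst c) by exact: finite_measure_integrable_cst.
have [] := @dominated_convergence _ _ _ P setT measurableT (fun n => EFin \o fn n)
  (EFin \o f) (EFin \o cst c).
- by move=> n; exact/measurable_EFinP.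
- exact/measurable_EFinP.
- by apply: filterS fnf => w h _; apply: cvg_EFin => //; exact: nearW.
- exact: ic.
- by apply: aeW => w n _; rewrite lee_fin.
move=> intf _ cv; split => //; apply: fine_cvg.
rewrite /Rintegral fineK; last exact: integrable_fin_num.
exact: cv.
Qed.

Lemma ae_eq_Rintegral (f g : T -> R) : measurable_fun setT f -> measurable_fun setT g ->
  {ae P, forall w, f w = g w} -> \int[P]_w f w = \int[P]_w g w.
Proof.
move=> mf mg fg; congr fine; apply: ae_eq_integral => //; try exact/measurable_EFinP.
by apply: filterS fg => w -> _.
Qed.

(* The excess of the approximation error over its non-vanishing part is bounded by [c]
   and tends to [0], so dominated convergence applies to it. *)
Lemma approx_mean0 (Z : T -> R) (S U : nat -> T -> R) (b c : R) :
  0 <= c -> measurable_fun setT Z -> (forall w, `|Z w| <= b) ->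
  (forall n, P.-integrable setT (EFin \o S n)) -> (forall n, \int[P]_w S n w = 0) ->
  (forall n, P.-integrable setT (EFin \o U n)) ->
  (\int[P]_w U n w) @[n --> \oo] --> 0 ->
  (forall (e : R) n w, 0 < e -> `|Z w - S n w| <= c * (1 + e + U n w / e ^+ 3)) ->
  (forall e om w, 0 < e -> 0 < om ->
    \forall n \near \oo, `|Z w - S n w| <= c * (om + e + U n w / e ^+ 3)) ->
  \int[P]_w Z w = 0.
Proof.
move=> c0 mZ bZ iS S0 iU EU err1 err.
have iZ := integrable_bounded mZ bZ.
have mS n : measurable_fun setT (S n) by exact/measurable_EFinP/(measurable_int P).
have mU n : measurable_fun setT (U n) by exact/measurable_EFinP/(measurable_int P).
suff bound (e : R) : 0 < e -> `|\int[P]_w Z w| <= c * e.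
  apply/eqP; rewrite -normr_le0; apply/ler_addgt0Pl => e e0; rewrite addr0.
  have c1 : 0 < c + 1 by lra.
  apply: (le_trans (bound (e / (c + 1)) _)); first by rewrite divr_gt0.
  by rewrite mulrA ler_pdivrMr// mulrC ler_wpM2l// ?(ltW e0)//; lra.
move=> e0; pose Q n w := Num.max 0 (`|Z w - S n w| - c * (e + U n w / e ^+ 3)).
have mQ n : measurable_fun setT (Q n).
  apply: measurable_maxr => //; apply: measurable_funB.
    by apply: measurableT_comp => //; exact: measurable_funB.
  by apply: measurable_funM => //; apply: measurable_funD => //; exact: measurable_funM.
have bQ n w : `|Q n w| <= c.
  rewrite ger0_norm ?le_max ?lexx// ge_max c0/= lerBlDr.
  by apply: (le_trans (err1 e n w e0)); rewrite -{2}(mulr1 c) -mulrDr addrA.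
have EQ : (\int[P]_w Q n w) @[n --> \oo] --> 0.
  have -> : (0 : R) = \int[P]_w 0 by rewrite Rintegral_prob_cst.
  apply: (proj2 (bounded_cvg_mean (c := c) _ _ _ _)) => //; apply: aeW => w.
  apply/cvgrPdist_le => /= om om0; have c1 : 0 < c + 1 by lra.
  have om1 : 0 < om / (c + 1) by rewrite divr_gt0.
  near=> n; rewrite sub0r normrN ger0_norm ?le_max ?lexx// ge_max (ltW om0)/= lerBlDr.
  apply: (@le_trans _ _ (c * (om / (c + 1) + e + U n w / e ^+ 3))).
    by near: n; exact: err.
  rewrite -addrA mulrDr lerD2r mulrA ler_pdivrMr// mulrC ler_wpM2l ?(ltW om0)//.
  lra.
have main n : `|\int[P]_w Z w| <= \int[P]_w Q n w + c * e + (c / e ^+ 3) * \int[P]_w U n w.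
  have iZS := integrable_EFinB iZ (iS n).
  have iQ := integrable_bounded (mQ n) (bQ n).
  have -> : \int[P]_w Z w = \int[P]_w (Z w - S n w) by rewrite RintegralB// S0 subr0.
  apply: (le_trans (le_normr_Rintegral measurableT iZS)).
  have ice : P.-integrable setT (EFin \o (fun=> c * e)) by exact: finite_measure_integrable_cst.
  have iV := integrable_EFinZl (c / e ^+ 3) (iU n).
  have iQc := integrable_EFinD iQ ice.
  have -> : \int[P]_w Q n w + c * e + c / e ^+ 3 * \int[P]_w U n w =
      \int[P]_w (Q n w + c * e + c / e ^+ 3 * U n w).
    rewrite (RintegralD measurableT iQc iV) (RintegralD measurableT iQ ice).
    by rewrite (RintegralZl _ measurableT (iU n)) Rintegral_prob_cst.
  apply: le_Rintegral => //.
  - exact: integrable_norm.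
  - exact: integrable_EFinD.
  - move=> w _; rewrite /Q -lerBlDr -lerBlDr le_max; apply/orP; right.
    by rewrite le_eqVlt; apply/orP; left; apply/eqP; ring.
have lim : (\int[P]_w Q n w + c * e + (c / e ^+ 3) * \int[P]_w U n w) @[n --> \oo] -->
    0 + c * e + (c / e ^+ 3) * 0.
  apply: cvgD; last by apply: cvgM => //; exact: cvg_cst.
  by apply: cvgD => //; exact: cvg_cst.
rewrite mulr0 addr0 add0r in lim.
rewrite -(cvg_lim _ lim)//; apply: limr_ge; first by apply/cvg_ex; eexists; exact: lim.
by apply: nearW => n; exact: main.
Unshelve. all: by end_near. Qed.

End mean.

Lemma measurable_asbool (d : measure_display) (T : measurableType d) (A : T -> Prop) :
  measurable [set w | A w] -> measurable_fun setT (fun w => `[< A w >]).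
Proof.
move=> mA; apply: (measurable_fun_bool true).
rewrite setTI (_ : _ @^-1` _ = [set w | A w])//.
by apply/seteqP; split=> w /=; [move/asboolP|move=> ?; apply/asboolP].
Qed.

Section stage_expectation_measurability.
Context (R : realType) (d : measure_display) (T : measurableType d).
Variable Y : R -> T -> R.
Hypothesis mY : forall t, measurable_fun setT (Y t).
Hypothesis cY : forall w, continuous (Y^~ w).
Variables (a gamma : R) (f f1 : R -> R).
Hypotheses (a0 : 0 < a) (mf : measurable_fun setT f) (mf1 : measurable_fun setT f1).

Lemma measurable_stage_value (D y : T -> R) :
  measurable_fun setT D -> measurable_fun setT y ->
  measurable_fun setT (fun w => stage_value gamma f f1 (D w) (y w)).
Proof.
move=> mD my; apply: measurable_fun_ifT.
- exact: (measurable_fun_ler (@measurable_cst _ _ T _ setT (0 : R)) mD).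
- apply: measurable_funD; first exact: measurableT_comp.
  apply: measurable_funM; first exact: measurableT_comp.
  exact: (measurableT_comp (measurable_scale_fun gamma)).
- exact: measurable_cst.
Qed.

Lemma measurable_stage_slope :
  measurable_fun setT (fun p : R * R => stage_slope gamma f1 p.1 p.2).
Proof.
apply: measurable_fun_ifT.
- exact: (measurable_fun_ler (@measurable_cst _ _ _ _ setT (0 : R)) measurable_fst).
- apply: measurable_funM; first exact: (measurableT_comp mf1 measurable_fst).
  apply: (measurableT_comp (@measurable_expR R)).
  by apply: measurable_funM => //; exact: measurable_snd.
- exact: measurable_cst.
Qed.

Lemma measurable_stage_end n t : measurable_fun setT (fun w => stage_end a (Y^~ w) n t).
Proof.
apply: (measurableT_comp (fine_measurable measurableT)).
apply: (measurable_mine (measurable_dd_time mY cY a0 n.+1)); exact: measurable_cst.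
Qed.

Lemma measurable_stage_start n t : measurable_fun setT (fun w => stage_start a (Y^~ w) n t).
Proof.
apply: measurable_minr; first exact: (measurable_fine_dd_time mY cY a0).
exact: measurable_stage_end.
Qed.

Lemma measurable_dd_started n r (t : R) : measurable
  [set w | (dd_time (Y^~ w) a n <= t%:E)%E /\ dd_records (Y^~ w) a n = r].
Proof.
apply: measurableI; last exact: (measurable_dd_records mY cY a0).
have := emeasurable_fun_infty_c measurableT (measurable_dd_time mY cY a0 n) t%:E.
by rewrite setTI.
Qed.

Lemma measurable_stage_init n r t :
  measurable_fun setT (fun w => stage_init a f n r (Y^~ w) t).
Proof.
apply: measurable_fun_ifT => //.
  exact/measurable_asbool/measurable_dd_started.
apply: (measurableT_comp mf); apply: measurable_funB; first exact: (measurable_dd_max mY cY a0).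
exact: (measurable_path_eval mY cY (measurable_stage_start n t)).
Qed.

Lemma measurable_stage_final n r t :
  measurable_fun setT (fun w => stage_final gamma a f f1 n r (Y^~ w) t).
Proof.
have mrm : measurable_fun setT (fun w =>
    running_max (Y^~ w) (stage_start a (Y^~ w) n t) (stage_end a (Y^~ w) n t)).
  apply: (measurable_running_max mY cY (measurable_stage_start n t) (measurable_stage_end n t)).
  by move=> w; rewrite /stage_start ge_min lexx orbT.
apply: measurable_fun_ifT => //.
  exact/measurable_asbool/measurable_dd_started.
apply: measurable_stage_value; apply: measurable_funB => //.
  exact: (measurable_dd_max mY cY a0).
exact: (measurable_path_eval mY cY (measurable_stage_end n t)).
Qed.

End stage_expectation_measurability.

Section stage_mean.
Context (R : realType) (d : measure_display) (T : measurableType d).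
Variables (P : probability T R) (W : R -> {RV P >-> R}).
Hypothesis hW : brownian_motion W.
Variables (mu sigma : R).
Hypothesis sigma0 : 0 < sigma.

Let gamma := 2 * mu / sigma ^+ 2.
Let Y := extended_bm W mu sigma.
Let mY t : measurable_fun setT (Y t) := measurable_extended_bm W mu sigma t.
Let cY w : continuous (Y^~ w) := @continuous_extended_bm _ _ _ _ _ hW mu sigma w.

Variables (a : R) (f f1 f2 : R -> R).
Hypothesis a0 : 0 < a.
Hypothesis ff1 : forall x : R, is_derive x (1 : R) f (f1 x).
Hypothesis f1f2 : forall x : R, is_derive x (1 : R) f1 (f2 x).
Hypothesis cf2 : continuous f2.

Let mf : measurable_fun setT f.
Proof. by apply: continuous_measurable_fun; exact: (is_derive_continuous ff1). Qed.

Let mf1 : measurable_fun setT f1.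
Proof. by apply: continuous_measurable_fun; exact: (is_derive_continuous f1f2). Qed.

Lemma stage_mean_bounded n r (t1 : R) : 0 < t1 ->
  \int[P]_w stage_final gamma a f f1 n r (Y^~ w) t1 = \int[P]_w stage_init a f n r (Y^~ w) t1.
Proof.
move=> t10; have [L sb] := stage_bounds_exist gamma a (n%:R * a) ff1 f1f2 cf2.
have [L1 _ _] := sb_L sb; have L0 : 0 <= L by lra.
set VT := fun w => stage_final _ _ _ _ _ _ _ _; set V0 := fun w => stage_init _ _ _ _ _ _.
have mVT : measurable_fun setT VT by exact: (measurable_stage_final mY cY).
have mV0 : measurable_fun setT V0 by exact: (measurable_stage_init mY cY).
pose b := `|f 0| + L ^+ 2 + L ^+ 3.
have bVT w : `|VT w| <= b by apply: (stage_final_bound r a0 sb).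
have bV0 w : `|V0 w| <= b by apply: (stage_init_bound r a0 sb).
apply/eqP; rewrite -subr_eq0 -RintegralB//; last 2 first.
- exact: integrable_bounded bVT.
- exact: integrable_bounded bV0.
pose h (N : nat) : R := t1 / N.+1%:R.
have h0 N : 0 < h N by rewrite divr_gt0.
pose u N (i : nat) w := scale_fun gamma (- (Y (i%:R * h N + h N) w - Y (i%:R * h N) w)).
pose A N (i : nat) w := stage_fun (Y^~ w) a n r (stage_slope gamma f1) (i%:R * h N).
have ih0 N (i : nat) : 0 <= i%:R * h N by rewrite mulr_ge0 ?(ltW (h0 N)).
have [C moment] := drifted_scale_moment4 hW mu sigma t10.
have uE N i w : u N i w = scale_fun gamma (- (drifted_bm W mu sigma (i%:R * h N + h N) w -
    drifted_bm W mu sigma (i%:R * h N) w)).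
  by rewrite /u /Y !extended_bmE// addr_ge0// ltW.
have mom N i : P.-integrable setT (EFin \o (fun w => u N i w ^+ 4)) /\
    \int[P]_w (u N i w ^+ 4) <= C * h N ^+ 2.
  have hle : h N <= t1 by rewrite ler_pdivrMr// ler_peMr ?(ltW t10)// ler1n.
  have [i4 le4] := moment _ _ (ih0 N i) (h0 N) hle.
  split; first by under eq_fun do rewrite uE; exact: i4.
  rewrite -lee_fin /Rintegral fineK.
    by under eq_integral do rewrite uE; exact: le4.
  by apply: integrable_fin_num => //; under eq_fun do rewrite uE; exact: i4.
have Au N i := stage_increment_mean0 hW sigma0 a0 (ih0 N i) (h0 N)
  (measurable_stage_slope gamma mf1) (fun w => stage_fun_bound r a0 sb (i%:R * h N) (@cY w)).
have iA N i : P.-integrable setT (EFin \o (fun w => A N i w * u N i w)).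
  by have [] := Au N i.
pose c := 4 * L ^+ 4 * (L + 3); have c0 : 0 <= c.
  by rewrite !mulr_ge0 ?exprn_ge0// addr_ge0.
have err (e om : R) N w : 0 < e -> 0 <= om -> (forall p q : R, 0 <= p <= t1 -> `|p - q| <= h N ->
    Num.min 1 `|Y p w - Y q w| <= om) ->
  `|VT w - V0 w - \sum_(i < N.+1) A N i w * u N i w| <=
  c * (om + e + (\sum_(i < N.+1) u N i w ^+ 4) / e ^+ 3).
  move=> e0 om0 modulus.
  have := stage_path_error (u := fun i => u N i w) r a0 sb (@cY w) t10 om0 e0 (erefl (h N))
    (fun i => erefl) modulus.
  move/le_trans; apply.
  rewrite /c -[leRHS]mulrA; apply: ler_wpM2l; first by rewrite mulr_ge0 ?exprn_ge0.
  rewrite (mulrDr (L + 3)) [(L + 3) * (om + e)]mulrC lerD2l ler_peMl//; last by lra.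
  rewrite mulr_ge0 ?invr_ge0 ?exprn_ge0 ?(ltW e0)// sumr_ge0// => i _.
  by rewrite exprn_even_ge0.
apply/eqP; apply: (approx_mean0 (S := fun N w => \sum_(i < N.+1) A N i w * u N i w)
  (U := fun N w => \sum_(i < N.+1) u N i w ^+ 4) (b := b + b) c0) => //.
- exact: measurable_funB.
- by move=> w; apply: (le_trans (ler_normB _ _)); exact: lerD (bVT w) (bV0 w).
- by move=> N; apply: integrable_fsum => i _.
- move=> N; rewrite Rintegral_fsum => [|i _]; last exact: iA.
  by apply: big1 => i _; have [_] := Au N i; rewrite /Rintegral => ->.
- by move=> N; apply: integrable_fsum => i _; have [] := mom N i.
(* The [N.+1] steps of length [t1 / N.+1] contribute at most [C * h N ^+ 2] each, in total
   [C * t1 ^+ 2 / N.+1]. *)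
- apply: (@squeeze_cvgr _ _ _ _ (fun=> 0) (fun N => C * t1 ^+ 2 * harmonic N)).
  + apply: nearW => N; rewrite Rintegral_ge0/=; last first.
      by move=> w _; rewrite sumr_ge0// => i _; rewrite exprn_even_ge0.
    rewrite Rintegral_fsum => [|i _]; last by have [] := mom N i.
    apply: (@le_trans _ _ (\sum_(i < N.+1) C * h N ^+ 2)).
      by apply: ler_sum => i _; have [] := mom N i.
    rewrite sumr_const card_ord /h /harmonic/= le_eqVlt; apply/orP; left.
    by apply/eqP; rewrite -[LHS]mulr_natr; field; rewrite addrC natr1 pnatr_eq0.
  + exact: cvg_cst.
  + rewrite -[X in _ --> X](mulr0 (C * t1 ^+ 2)).
    by apply: cvgM; [exact: cvg_cst|exact: cvg_harmonic].
(* The truncated modulus is at most [1], uniformly in [N] and in the path. *)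
- by move=> e N w e0; apply: err => // p q _ _; rewrite ge_min lexx.
- move=> e om w e0 om0.
  have [dl dl0 unif] := uniform_continuity t1 (@cY w) om0.
  near=> N; apply: err => //; first exact: ltW.
  move=> p q p0 pq; rewrite ge_min; apply/orP; right; apply/ltW/unif => //.
  apply: (le_lt_trans pq); near: N.
  have : t1 * harmonic N @[N --> \oo] --> t1 * 0.
    by apply: cvgM; [exact: cvg_cst|exact: cvg_harmonic].
  by rewrite mulr0 => /cvgr_lt; apply.
Unshelve. all: by end_near. Qed.

End stage_mean.

(** * Almost sure finiteness of the drawdown times *)

Section finiteness.
Context (R : realType) (d : measure_display) (T : measurableType d).
Variables (P : probability T R) (W : R -> {RV P >-> R}).
Hypothesis hW : brownian_motion W.
Variables (mu sigma a : R).
Hypotheses (sigma0 : 0 < sigma) (a0 : 0 < a).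

Let X := drifted_bm W mu sigma.
Let Y := extended_bm W mu sigma.
Let mY t : measurable_fun setT (Y t) := measurable_extended_bm W mu sigma t.
Let cY w : continuous (Y^~ w) := @continuous_extended_bm _ _ _ _ _ hW mu sigma w.

(** The increments over disjoint unit intervals are independent and each avoids a fall by [a] with
    the same probability [1 - p < 1], so [k] of them do so with probability [(1 - p) ^+ k]. *)
Lemma no_large_decrease_null (i0 : nat) : P.-negligible
  [set w | forall i, (i0 <= i)%N -> - a < X (i%:R + 1) w - X i%:R w].
Proof.
have [p p0 Pp] := drifted_increment_neg hW mu sigma0 a.
pose B := (fun z => mu * 1 + sigma * z) @^-1` `]- a, +oo[.
have mB : measurable B.
  rewrite -[B]setTI; apply: measurable_funD => //; exact: measurable_funM.
have PB (t : R) : 0 <= t -> P ((fun w => W (t + 1) w - W t w) @^-1` B) = (1 - p)%:E.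
  move=> t0; pose D := [set w | X (t + 1) w - X t w <= - a].
  have mD : measurable D.
    apply: measurable_set_le; [exact: measurable_drifted_increment|exact: measurable_cst].
  rewrite (_ : _ @^-1` B = ~` D).
    by rewrite probability_setC// (Pp t t0) EFinB.
  apply/seteqP; split=> w; rewrite /B /D /X /= drifted_bm_increment in_itv/= andbT.
    by rewrite ltNge => /negP.
  by move/negP; rewrite -ltNge.
have p1 : p <= 1.
  rewrite -lee_fin -(Pp 0)// probability_le1//.
  apply: measurable_set_le; [exact: measurable_drifted_increment|exact: measurable_cst].
pose A k : set T := \bigcap_(j in [set: 'I_k])
  ((fun w => W (i0 + j)%N.+1%:R w - W (i0 + j)%N%:R w) @^-1` B).
have mA k : measurable (A k).
  apply: fin_bigcap_measurable => // j _; rewrite -[X in measurable X]setTI.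
  by apply: measurable_funB => //; exact: measurable_funPT.
have PA k : P (A k) = ((1 - p) ^+ k)%:E.
  have := bm_indep hW (n := k) (t := fun j => (i0 + j)%N%:R) (ler0n _ _).
  move=> /(_ _ (fun=> B) (fun=> mB)); rewrite /A.
  under eq_bigcapr do rewrite addnS.
  move=> ->; last by move=> i; rewrite ler_nat addnS.
  under eq_bigr do rewrite addnS -natr1 PB//.
  by rewrite prodEFin prodr_const card_ord.
exists (\bigcap_k A k); split.
- exact: bigcapT_measurable.
- apply/eqP; rewrite eq_le measure_ge0 andbT.
  apply/lee_addgt0Pr => e e0; rewrite add0e.
  have [k ke] : exists k, (1 - p) ^+ k <= e.
    have q1 : `|1 - p| < 1 by rewrite ger0_norm; lra.
    have /cvgrPdist_le/(_ _ e0)[k _ /(_ k (leqnn k))/=] := cvg_expr q1.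
    by rewrite sub0r normrN ger0_norm ?exprn_ge0 ?subr_ge0// => ke; exists k.
  apply: (@le_trans _ _ (P (A k))); last by rewrite PA lee_fin.
  apply: le_measure; rewrite ?inE//; first exact: bigcapT_measurable.
  exact: bigcap_inf.
- move=> w Dw k _ j _ /=; rewrite /B/= in_itv/= andbT.
  have := Dw (i0 + j)%N (leq_addr _ _).
  by rewrite /X drifted_bm_increment natr1.
Qed.

Lemma dd_time_lty_ae : {ae P, forall w, forall n, (dd_time (Y^~ w) a n < +oo)%E}.
Proof.
have null : P.-negligible (\bigcup_i0 [set w | forall i, (i0 <= i)%N ->
    - a < X (i%:R + 1) w - X i%:R w]).
  by apply: negligible_bigcup => i0; exact: no_large_decrease_null.
apply: negligibleS null => w nf; apply: contrapT => nD; apply: nf => n.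
elim: n => [|n IH]; first by rewrite dd_time0 ltry.
have [nE|[s s0 ns]] := dd_time_fin n (@cY w) a0; first by rewrite nE ltxx in IH.
(* A fall by [a] over a unit interval after [s] forces the next drawdown by the end of that
   interval. *)
have /existsNP[i /not_implyP[ni /negP]] : ~ forall i, ((Num.truncn s).+1 <= i)%N ->
    - a < X (i%:R + 1) w - X i%:R w.
  by move=> D; apply: nD; exists (Num.truncn s).+1.
rewrite -leNgt => inc.
have si : s <= i%:R.
  apply: ltW; apply: (lt_le_trans (truncnS_gt s)); by rewrite ler_nat.
have i0 : (0 : R) <= i%:R by [].
apply: (@le_lt_trans _ _ (i%:R + 1)%:E); last exact: ltry.
apply: (dd_timeS_le (@cY w) a0 ns); first by rewrite (le_trans si)// lerDl.
have := running_max_ge (@cY w) (s := s) (t := i%:R + 1) (u := i%:R).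
rewrite si lerDl ler01 => /(_ isT).
have -> : Y i%:R w = X i%:R w by exact: extended_bmE.
have -> : Y (i%:R + 1) w = X (i%:R + 1) w by apply: extended_bmE; rewrite addr_ge0.
by move: (running_max _ _ _) inc => z; lra.
Qed.

End finiteness.

(** * The mean over a complete stage *)

Section stage_outcome.
Context (R : realType).
Implicit Types (x : R -> R) (a : R).

Definition dd_depth x a n : R := dd_max x a n - x (fine (dd_time x a n)).

(** A stage without record ends with drawdown [a], so its maximum lies below the overall one by the
    new depth minus [a]. This writes the final value in terms of drawdown times only. *)
Definition stage_outcome gamma a (f f1 : R -> R) n x : R :=
  if `[< dd_record x a n.+1 >] then f 0
  else f (dd_depth x a n.+1 - a) + f1 (dd_depth x a n.+1 - a) * scale_fun gamma a.

Lemma dd_recordE x a n s e : continuous x -> 0 < a -> dd_time x a n = s%:E ->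
  dd_time x a n.+1 = e%:E -> `[< dd_record x a n.+1 >] = (dd_max x a n < running_max x s e).
Proof.
move=> cx a0 ns ne; apply/asboolP/idP; rewrite /dd_record (dd_maxS cx a0 ns ne) lt_max ltxx orFb.
  by case.
by rewrite ne ltry.
Qed.

(** Through [Num.max 0] a record resets the depth to exactly [a], however far it exceeds the old
    maximum. *)
Lemma dd_depthS x a n s e : continuous x -> 0 < a -> dd_time x a n = s%:E ->
  dd_time x a n.+1 = e%:E ->
  dd_depth x a n.+1 = Num.max 0 (dd_max x a n - running_max x s e) + a.
Proof.
move=> cx a0 ns ne; rewrite /dd_depth (dd_maxS cx a0 ns ne) ne [fine _]/=.
have [|[e' []]] := dd_timeS cx a0 ns; rewrite ne => -[]// <- _ + _.
move: (dd_max _ _ _) (running_max _ _ _) => u v <-; rewrite addrA; congr (_ - _).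
case: (leP u v) => uv; [rewrite max_l ?subr_le0// add0r//|rewrite max_r ?subrK// subr_ge0 ltW//].
Qed.

Lemma stage_valueE gamma f f1 x a n s e : continuous x -> 0 < a ->
  dd_time x a n = s%:E -> dd_time x a n.+1 = e%:E ->
  stage_value gamma f f1 (dd_max x a n - running_max x s e) (running_max x s e - x e) =
  stage_outcome gamma a f f1 n x.
Proof.
move=> cx a0 ns ne; rewrite /stage_outcome /stage_value (dd_recordE cx a0 ns ne).
rewrite (dd_depthS cx a0 ns ne) addrK subr_ge0 leNgt.
have [|[e' []]] := dd_timeS cx a0 ns; rewrite ne => -[]// <- _ -> _.
case: ltP => //= h; by rewrite max_r// subr_ge0.
Qed.

End stage_outcome.

Section stage_mean_limit.
Context (R : realType) (d : measure_display) (T : measurableType d).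
Variables (P : probability T R) (W : R -> {RV P >-> R}).
Hypothesis hW : brownian_motion W.
Variables (mu sigma : R).
Hypothesis sigma0 : 0 < sigma.

Let gamma := 2 * mu / sigma ^+ 2.
Let Y := extended_bm W mu sigma.
Let mY t : measurable_fun setT (Y t) := measurable_extended_bm W mu sigma t.
Let cY w : continuous (Y^~ w) := @continuous_extended_bm _ _ _ _ _ hW mu sigma w.

Variables (a : R) (f f1 f2 : R -> R).
Hypothesis a0 : 0 < a.
Hypothesis ff1 : forall x : R, is_derive x (1 : R) f (f1 x).
Hypothesis f1f2 : forall x : R, is_derive x (1 : R) f1 (f2 x).
Hypothesis cf2 : continuous f2.

Let mf : measurable_fun setT f.
Proof. by apply: continuous_measurable_fun; exact: (is_derive_continuous ff1). Qed.

Let mf1 : measurable_fun setT f1.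
Proof. by apply: continuous_measurable_fun; exact: (is_derive_continuous f1f2). Qed.

Lemma measurable_dd_depth n : measurable_fun setT (fun w => dd_depth (Y^~ w) a n).
Proof.
apply: measurable_funB; first exact: (measurable_dd_max mY cY a0).
exact: (measurable_path_eval mY cY (measurable_fine_dd_time mY cY a0 n)).
Qed.

Lemma measurable_stage_outcome n :
  measurable_fun setT (fun w => stage_outcome gamma a f f1 n (Y^~ w)).
Proof.
have mD : measurable_fun setT (fun w => dd_depth (Y^~ w) a n.+1 - a).
  by apply: measurable_funB => //; exact: measurable_dd_depth.
apply: measurable_fun_ifT => //.
  exact: (measurable_asbool (measurable_dd_record mY cY a0 n.+1)).
apply: measurable_funD; first exact: measurableT_comp.
by apply: measurable_funM => //; exact: measurableT_comp.
Qed.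

Let large s : \forall N \near \oo, (s : R) < N.+1%:R.
Proof.
exists (Num.truncn s).+1 => // N /= sN; apply: (lt_trans (truncnS_gt s)).
by rewrite ltr_nat.
Qed.

(** Almost every path completes the stage by some integer time, after which the truncated variables
    no longer change; they are bounded independently of the horizon, so the means converge. *)
Lemma stage_mean n r :
  let V0 w := if `[< dd_records (Y^~ w) a n = r >] then f (dd_depth (Y^~ w) a n) else 0 in
  let V1 w := if `[< dd_records (Y^~ w) a n = r >]
    then stage_outcome gamma a f f1 n (Y^~ w) else 0 in
  [/\ P.-integrable setT (EFin \o V0), P.-integrable setT (EFin \o V1) &
    \int[P]_w V0 w = \int[P]_w V1 w].
Proof.
move=> V0 V1; have [L sb] := stage_bounds_exist gamma a (n%:R * a) ff1 f1f2 cf2.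
have mR := measurable_asbool (measurable_dd_records mY cY a0 n r).
have mV0 : measurable_fun setT V0.
  by apply: measurable_fun_ifT => //; apply: measurableT_comp => //; exact: measurable_dd_depth.
have mV1 : measurable_fun setT V1.
  by apply: measurable_fun_ifT => //; exact: measurable_stage_outcome.
have fin := dd_time_lty_ae hW mu sigma0 a0.
have stage w : (forall n, (dd_time (Y^~ w) a n < +oo)%E) ->
    \forall N \near \oo, stage_init a f n r (Y^~ w) N.+1%:R = V0 w /\
      stage_final gamma a f f1 n r (Y^~ w) N.+1%:R = V1 w.
  move=> Fw; move: (Fw n) (Fw n.+1).
  have [->|[s s0 ns] _] := dd_time_fin n (@cY w) a0; first by rewrite ltxx.
  have [->|[e e0 ne] _] := dd_time_fin n.+1 (@cY w) a0; first by rewrite ltxx.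
  have se : s <= e.
    by have [s' [_ + ]] := dd_time_fin_le (@cY w) a0 (leqnSn n) ne; rewrite ns => /[swap] -[->].
  near=> N.
  have eN : e <= N.+1%:R by apply: ltW; near: N; exact: large.
  have nN : (dd_time (Y^~ w) a n <= N.+1%:R%:E)%E by rewrite ns lee_fin (le_trans se).
  have eE : stage_end a (Y^~ w) n N.+1%:R = e by rewrite /stage_end ne -EFin_min/= min_l.
  have sE : stage_start a (Y^~ w) n N.+1%:R = s.
    by rewrite /stage_start eE ns [fine _]/= min_l.
  have cond : ((dd_time (Y^~ w) a n <= N.+1%:R%:E)%E /\ dd_records (Y^~ w) a n = r) =
      (dd_records (Y^~ w) a n = r).
    by apply/propext; split=> [[]|].
  rewrite /stage_init /stage_final cond /V0 /V1 eE sE; split.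
    by rewrite /dd_depth ns.
  by rewrite (stage_valueE _ _ _ (@cY w) a0 ns ne).
have cv0 : {ae P, forall w, stage_init a f n r (Y^~ w) N.+1%:R @[N --> \oo] --> V0 w}.
  apply: filterS fin => w Fw; apply: cvg_near_cst.
  by apply: filterS (stage w Fw) => N [].
have cv1 : {ae P, forall w,
    stage_final gamma a f f1 n r (Y^~ w) N.+1%:R @[N --> \oo] --> V1 w}.
  apply: filterS fin => w Fw; apply: cvg_near_cst.
  by apply: filterS (stage w Fw) => N [].
have [i0 c0] := bounded_cvg_mean (fun N => measurable_stage_init mY cY a0 mf n r N.+1%:R) mV0
  (fun N w => stage_init_bound r a0 sb N.+1%:R (@cY w)) cv0.
have [i1 c1] := bounded_cvg_mean
  (fun N => measurable_stage_final mY cY gamma a0 mf mf1 n r N.+1%:R) mV1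
  (fun N w => stage_final_bound r a0 sb N.+1%:R (@cY w)) cv1.
split => //; apply: (cvg_unique _ c0) => //.
rewrite /mkset (_ : (fun N => _) = fun N : nat =>
    \int[P]_w stage_final gamma a f f1 n r (Y^~ w) N.+1%:R)//.
apply/funext => N; symmetry.
by apply: (stage_mean_bounded hW _ sigma0 a0 ff1 f1f2 cf2); exact: ltr0Sn.
Unshelve. all: by end_near. Qed.

End stage_mean_limit.

(** * The generalized Poisson recursion *)

Section gen_poisson_derivatives.
Context (R : realType).
Implicit Types (h dh : R -> R) (x c : R).

Lemma is_derive_shift h dh c x : (forall y : R, is_derive y (1 : R) h (dh y)) ->
  is_derive x (1 : R) (fun y : R => h (y + c)) (dh (x + c)).
Proof.
move=> hdh; have d1 := is_deriveD (is_derive_id x (1 : R)) (is_derive_cst c x (1 : R)).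
have := @is_derive1_comp _ h (fun y : R => y + c) x _ _ (hdh (x + c)) d1.
by rewrite addr0 mulr1.
Qed.

Lemma is_derive_expRN x : is_derive x (1 : R) (fun y : R => expR (- y)) (- expR (- x)).
Proof.
have := is_derive_expRM (-1) x; rewrite !mulN1r.
by congr is_derive; apply/funext => y; rewrite mulN1r.
Qed.

Lemma is_derive_expX q x : is_derive x (1 : R) (fun y : R => y ^+ q) (q%:R * x ^+ q.-1).
Proof.
have := is_deriveX q (is_derive_id x (1 : R)); rewrite /GRing.scale/= mulr1.
by congr is_derive; apply/funext => y; rewrite exprfctE.
Qed.

Variable lam : R.

Let gp (q : nat) (x : R) := gen_poisson_pmf x lam q.

Definition gen_poisson_shift (h : nat -> R -> R) q x : R :=
  if q is q'.+1 then h q' (x + lam) else 0.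

Definition gen_poisson_deriv (q : nat) (x : R) : R := gen_poisson_shift gp q x - gp q x.

Definition gen_poisson_deriv2 (q : nat) (x : R) : R :=
  gen_poisson_shift gen_poisson_deriv q x - gen_poisson_deriv q x.

(** With [c = lam * q.+1] and [q > 0], the derivative of [x * (x + c) ^+ q] is
    [(x + c) ^+ q.-1 * (q.+1 * x + c)], that is, [q.+1 * (x + lam) * (x + c) ^+ q.-1]. Divided by
    the factorial of [q.+1], this is the polynomial part of the mass at [q] with parameter
    [x + lam]. *)
Lemma is_derive_gen_poisson q x : is_derive x (1 : R) (gp q) (gen_poisson_deriv q x).
Proof.
case: q => [|q].
  have := is_derive_expRN x; congr is_derive.
    by apply/funext => y; rewrite /gp /gen_poisson_pmf mulr0 subr0 mul1r divr1.
  by rewrite /gen_poisson_deriv /gp /gen_poisson_pmf /= mulr0 subr0 mul1r divr1 sub0r.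
set c := lam * q.+1%:R; set K : R := (q.+1)`!%:R.
have d1 := is_derive_shift c x (is_derive_expX q).
have d2 := is_derive_shift c x is_derive_expRN.
have d3 := is_deriveM (is_deriveM (is_derive_id x (1 : R)) d1) d2.
have := is_deriveZ K^-1 d3; congr is_derive.
  apply/funext => y; rewrite /gp /gen_poisson_pmf -/c -/K -opprD.
  exact: mulrC.
have K0 : K != 0 by rewrite /K pnatr_eq0 -lt0n fact_gt0.
have KE : K = q.+1%:R * q`!%:R by rewrite /K factS natrM.
have q0 : q.+1%:R != 0 :> R by rewrite pnatr_eq0.
have f0 : q`!%:R != 0 :> R by rewrite pnatr_eq0 -lt0n fact_gt0.
rewrite [(id * _) x](_ : _ = x * (x + c) ^+ q)// /gen_poisson_deriv /gen_poisson_shift /gp /GRing.scale/=.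
have eE : expR (- (x + lam) - lam * q%:R) = expR (- (x + c)) :> R.
  by congr expR; rewrite /c -natr1; ring.
case: q => [|q] in c K d1 d2 d3 K0 KE q0 f0 eE *.
  rewrite /gen_poisson_pmf -/c -/K eE opprD.
  by rewrite KE; move: f0; set F := _%:R => f0; rewrite !expr0; field.
rewrite /gen_poisson_pmf -/c -/K eE opprD.
have -> : x + lam + lam * q.+1%:R = x + c by rewrite /c -[q.+2%:R]natr1; ring.
rewrite [(x + c) ^+ q.+1]exprS /= KE; set E := expR _; set Z := (x + c) ^+ q.
have -> : c = lam * q.+2%:R by [].
have -> : q.+2%:R = q.+1%:R + 1 :> R by rewrite natr1.
rewrite -[q.+2%:R]natr1 in q0.
by field; rewrite f0; move: q0; rewrite -[q.+1%:R]natr1 [q%:R + 1]addrC.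
Qed.

Lemma is_derive_gen_poisson_deriv q x :
  is_derive x (1 : R) (gen_poisson_deriv q) (gen_poisson_deriv2 q x).
Proof.
case: q => [|q].
  rewrite /gen_poisson_deriv2 /= sub0r.
  have := is_deriveN (is_derive_gen_poisson 0 x); congr is_derive.
  by apply/funext => y; rewrite /gen_poisson_deriv /= sub0r.
exact: is_deriveB (is_derive_shift lam x (is_derive_gen_poisson q)) (is_derive_gen_poisson q.+1 x).
Qed.

Lemma continuous_gen_poisson_deriv2 q : continuous (gen_poisson_deriv2 q).
Proof.
have cd q' : continuous (gen_poisson_deriv q').
  exact: is_derive_continuous (is_derive_gen_poisson_deriv q').
move=> x; apply: cvgB; last exact: cd.
case: q => [|q]; first exact: cvg_cst.
exact: is_derive_continuous (fun y => is_derive_shift lam y (is_derive_gen_poisson_deriv q)) x.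
Qed.

End gen_poisson_derivatives.

Lemma sum_asbool_eq (R : realType) (k s : nat) (p : pred nat) (F : nat -> R) :
  \sum_(r < k | p r) (if `[< s = r >] then F r else 0) = if (s < k)%N && p s then F s else 0.
Proof.
case: ifPn => [/andP[sk ps]|nsk].
  rewrite (bigD1 (Ordinal sk))//= asboolT// big1 ?addr0// => i /andP[_ si].
  by case: asboolP => // sE; move/eqP: si; case; apply: val_inj.
rewrite big1// => i pi; case: asboolP => // sE; move: nsk.
by rewrite sE pi ltn_ord.
Qed.

Section stage_pmf.
Context (R : realType).
Variables (gamma a : R).
Hypothesis a0 : 0 < a.

Let lam := dd_rate gamma a.
Let g := scale_fun gamma a.
Let rho := g^-1.

Let g0 : g != 0. Proof. by rewrite gt_eqF// scale_fun_gt0. Qed.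

(** In both cases of [dd_rate] the rate is [a / scale_fun gamma a], since at [gamma = 0] the scale
    function is the identity. *)
Lemma dd_rateE : lam = rho * a.
Proof.
rewrite /lam /rho /g /dd_rate /scale_fun; case: ifPn => [_|gamma0].
  by rewrite mulVf// gt_eqF.
by rewrite invf_div mulrAC.
Qed.

Lemma is_derive_affine (h dh : R -> R) (r c x : R) :
  (forall y : R, is_derive y (1 : R) h (dh y)) ->
  is_derive x (1 : R) (fun y : R => h (r * y + c)) (r * dh (r * x + c)).
Proof.
move=> hdh; have d1 := is_deriveZ r (is_derive_id x (1 : R)).
have d2 := is_deriveD d1 (is_derive_cst c x (1 : R)).
have := @is_derive1_comp _ h (fun y : R => r * y + c) x _ _ (hdh _) d2.
by rewrite addr0 /GRing.scale/= mulr1 mulrC.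
Qed.

(* Evaluated at the depth [D] of the path below its maximum at a drawdown time, this is the
   conditional probability that exactly [q] of the next drawdowns set no new maximum before
   the [j.+1]-st one that does. *)
Definition stage_pmf (j q : nat) (D : R) : R := gen_poisson_pmf (rho * D + lam * j%:R) lam q.

Definition stage_pmf1 (j q : nat) (D : R) : R :=
  rho * gen_poisson_deriv lam q (rho * D + lam * j%:R).

Definition stage_pmf2 (j q : nat) (D : R) : R :=
  rho * (rho * gen_poisson_deriv2 lam q (rho * D + lam * j%:R)).

Lemma is_derive_stage_pmf j q (D : R) : is_derive D (1 : R) (stage_pmf j q) (stage_pmf1 j q D).
Proof. exact: is_derive_affine (is_derive_gen_poisson lam q). Qed.

Lemma is_derive_stage_pmf1 j q (D : R) : is_derive D (1 : R) (stage_pmf1 j q) (stage_pmf2 j q D).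
Proof.
have := is_derive_affine rho (lam * j%:R) D (is_derive_gen_poisson_deriv lam q).
exact: is_deriveZ.
Qed.

Lemma continuous_stage_pmf2 j q : continuous (stage_pmf2 j q).
Proof.
move=> D; apply: cvgM; first exact: cvg_cst.
apply: cvgM; first exact: cvg_cst.
apply: (@cvg_comp _ _ _ (fun D => rho * D + lam * j%:R) (gen_poisson_deriv2 lam q)); last first.
  exact: continuous_gen_poisson_deriv2.
apply: cvgD; last exact: cvg_cst.
by apply: cvgM; [exact: cvg_cst|exact: cvg_id].
Qed.

(** The factor [rho] cancels [g] and leaves the previous mass with parameter raised by
    [lam = rho * a], which amounts to raising the depth by [a]. *)
Lemma stage_pmf_step j q (D : R) : stage_pmf j q D + stage_pmf1 j q D * g =
  if q is q'.+1 then stage_pmf j q' (D + a) else 0.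
Proof.
rewrite /stage_pmf1 [rho * _]mulrC mulfVK// /gen_poisson_deriv addrC subrK.
case: q => [//|q]; rewrite /gen_poisson_shift /stage_pmf mulrDr -dd_rateE addrAC //.
Qed.

(** A record trades one of the waiting periods to come, worth [lam] in the parameter, for the depth
    [a] that it leaves behind. *)
Lemma stage_pmf_record j q : stage_pmf j.+1 q 0 = stage_pmf j q a.
Proof. by rewrite /stage_pmf mulr0 add0r -dd_rateE -natr1 mulrDr mulr1 addrC. Qed.

Lemma stage_pmf00 q : stage_pmf 0 q 0 = (q == 0%N)%:R.
Proof.
rewrite /stage_pmf !mulr0 addr0 /gen_poisson_pmf; case: q => [|q] /=.
  by rewrite mulr0 subr0 oppr0 expR0 mul1r divr1.
by rewrite !mul0r.
Qed.

Variables (k m : nat).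

(* The conditional probability, given the path up to the [n]-th drawdown time, that the
   [k]-th drawdown with recovery is the [(k + m)]-th drawdown and has not occurred yet. *)
Definition success_martingale n (x : R -> R) : R :=
  \sum_(r < k | (n <= m + r)%N) if `[< dd_records x a n = r >]
    then stage_pmf (k - r.+1) (m + r - n) (dd_depth x a n) else 0.

(** The terms of [success_martingale], each carried through the stage by [stage_mean]. The sum over
    [r] is needed because [stage_mean] takes a fixed function, while the mass to be used depends on
    the number of records. *)
Definition success_martingale_next n (x : R -> R) : R :=
  \sum_(r < k | (n <= m + r)%N) if `[< dd_records x a n = r >]
    then stage_outcome gamma a (stage_pmf (k - r.+1) (m + r - n))
      (stage_pmf1 (k - r.+1) (m + r - n)) n x else 0.

Lemma success_martingaleE n x : success_martingale n x =
  if (dd_records x a n < k)%N && (n <= m + dd_records x a n)%N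
  then stage_pmf (k - (dd_records x a n).+1) (m + dd_records x a n - n) (dd_depth x a n) else 0.
Proof.
exact: (sum_asbool_eq k _ (fun r => n <= m + r)%N
  (fun r => stage_pmf (k - r.+1) (m + r - n) (dd_depth x a n))).
Qed.

Lemma success_martingale_nextE n x : success_martingale_next n x =
  if (dd_records x a n < k)%N && (n <= m + dd_records x a n)%N
  then stage_outcome gamma a (stage_pmf (k - (dd_records x a n).+1) (m + dd_records x a n - n))
    (stage_pmf1 (k - (dd_records x a n).+1) (m + dd_records x a n - n)) n x else 0.
Proof.
exact: (sum_asbool_eq k _ (fun r => n <= m + r)%N
  (fun r => stage_outcome gamma a (stage_pmf (k - r.+1) (m + r - n))
      (stage_pmf1 (k - r.+1) (m + r - n)) n x)).
Qed.

Lemma success_martingale_next_step n (x : R -> R) : continuous x ->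
  (dd_time x a n < +oo)%E -> (dd_time x a n.+1 < +oo)%E ->
  success_martingale_next n x = success_martingale n.+1 x +
    (if (n.+1 == k + m)%N && `[< dd_record_index x a k n.+1 >] then 1 else 0).
Proof.
move=> cx; have [->|[s s0 ns] _] := dd_time_fin n cx a0; first by rewrite ltxx.
have [->|[e e0 ne] _] := dd_time_fin n.+1 cx a0; first by rewrite ltxx.
have recE := dd_recordE cx a0 ns ne.
rewrite success_martingale_nextE success_martingaleE /dd_record_index dd_recordsS.
rewrite /stage_outcome (dd_depthS cx a0 ns ne) recE.
set r := dd_records x a n; set D := _ - running_max _ _ _.
have [rec|nrec] := ltP (dd_max x a n) (running_max x s e); last first.
  have nr : ~ dd_record x a n.+1.
    by move=> /asboolP; rewrite recE ltNge nrec.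
  have -> : `[< (r + false)%N = k /\ (n.+1 = 0%N \/ dd_record x a n.+1) >] = false.
    by apply/asboolP => -[_ []].
  rewrite andbF addr0 addn0 addrK stage_pmf_step; case: (ltnP r k) => //= rk.
  case: (leqP n (m + r)) => nmr; last by rewrite leqNgt (leqW nmr).
  (* With no drawdown without record left to spend, [stage_pmf_step] gives [0], and the next term is
     out of range. *)
  case: (posnP (m + r - n)) => [q0|q0]; first by rewrite q0 ltnNge -subn_eq0 q0.
  have -> : (n < m + r)%N by rewrite -subn_gt0.
  by rewrite (subnS _ n); case: (m + r - n)%N q0.
have -> : Num.max 0 D = 0 by rewrite max_l// subr_le0 ltW.
have yr : dd_record x a n.+1 by apply/asboolP; rewrite recE.
rewrite add0r addn1 addnS subSS ltnS.
have -> : `[< r.+1 = k /\ (n.+1 = 0%N \/ dd_record x a n.+1) >] = (r.+1 == k).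
  by apply/asboolP/eqP => [[]|->] //; split => //; right.
case: (ltngtP r.+1 k) => rk; last 2 first.
- by rewrite andbF addr0.
(* This record is the [k]-th. The law with [theta = 0] sits at [0], so the left-hand side indicates
   [m + r - n = 0], which within the range says that this is the [(k + m)]-th drawdown. *)
- rewrite -rk subnn stage_pmf00 add0r andbT andTb.
  rewrite subn_eq0 addSn eqSS [(r + m)%N]addnC eqn_leq.
  by case: leqP => //= _; case: leqP.
by rewrite andbF addr0 andTb -(subnSK rk) stage_pmf_record.
Qed.

End stage_pmf.

(** * The probability that a given drawdown is the [k]-th record *)

Section success_probability.
Context (R : realType) (d : measure_display) (T : measurableType d).
Variables (P : probability T R) (W : R -> {RV P >-> R}).
Hypothesis hW : brownian_motion W.
Variables (mu sigma a : R).
Hypotheses (sigma0 : 0 < sigma) (a0 : 0 < a).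

Let gamma := 2 * mu / sigma ^+ 2.
Let lam := dd_rate gamma a.
Let Y := extended_bm W mu sigma.
Let mY t : measurable_fun setT (Y t) := measurable_extended_bm W mu sigma t.
Let cY w : continuous (Y^~ w) := @continuous_extended_bm _ _ _ _ _ hW mu sigma w.

Definition success k n := [set w | (dd_time (Y^~ w) a n < +oo)%E /\
  dd_record_index (Y^~ w) a k n].

Lemma measurable_success k n : measurable (success k n).
Proof. exact: (measurable_dd_record_index mY cY a0). Qed.

Lemma success_martingale_mean k m n : [/\ P.-integrable setT (EFin \o (fun w => success_martingale gamma a k m n (Y^~ w))),
  P.-integrable setT (EFin \o (fun w => success_martingale_next gamma a k m n (Y^~ w))) &
  \int[P]_w success_martingale gamma a k m n (Y^~ w) = \int[P]_w success_martingale_next gamma a k m n (Y^~ w)].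
Proof.
have mean r := stage_mean hW mu sigma0 a0
  (is_derive_stage_pmf gamma a (k - r.+1) (m + r - n))
  (is_derive_stage_pmf1 gamma a (k - r.+1) (m + r - n))
  (continuous_stage_pmf2 (gamma := gamma) (a := a) (j := k - r.+1) (q := m + r - n)) n r.
split.
- by apply: integrable_fsum => r _; have [] := mean r.
- by apply: integrable_fsum => r _; have [] := mean r.
rewrite !Rintegral_fsum.
- by apply: eq_bigr => r _; have [] := mean r.
- by move=> r _; have [] := mean r.
- by move=> r _; have [] := mean r.
Qed.

Lemma success_martingale_mean_step k m n : \int[P]_w success_martingale gamma a k m n (Y^~ w) =
  \int[P]_w success_martingale gamma a k m n.+1 (Y^~ w) +
  (if (n.+1 == k + m)%N then fine (P (success k n.+1)) else 0).
Proof.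
have [_ inext ->] := success_martingale_mean k m n; have [iphi _ _] := success_martingale_mean k m n.+1.
have mS := measurable_success k n.+1.
pose ind (w : T) : R := (n.+1 == k + m)%N%:R * \1_(success k n.+1) w.
have i1 : P.-integrable setT (EFin \o \1_(success k n.+1)).
  by apply: (@integrable_bounded _ _ _ _ _ (1 : R)) => // w; rewrite indicE ger0_norm// lern1 leq_b1.
have iind : P.-integrable setT (EFin \o ind) by exact: integrable_EFinZl.
have -> : \int[P]_w success_martingale_next gamma a k m n (Y^~ w) =
    \int[P]_w (success_martingale gamma a k m n.+1 (Y^~ w) + ind w).
  apply: ae_eq_Rintegral.
  - exact/measurable_EFinP/(measurable_int P).
  - by apply: measurable_funD => //; exact/measurable_EFinP/(measurable_int P).
  apply: filterS (dd_time_lty_ae hW mu sigma0 a0) => w Fw.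
  rewrite (success_martingale_next_step _ a0 k m (@cY w) (Fw n) (Fw n.+1)); congr (_ + _).
  rewrite /ind indicE; case: eqP => _; rewrite ?mul0r// mul1r.
  by case: asboolP => ri; [rewrite mem_set|rewrite memNset// => -[]].
rewrite RintegralD//; congr (_ + _); rewrite RintegralZl// /Rintegral integral_indic// setIT.
by case: eqP; rewrite ?mul1r ?mul0r.
Qed.

(** The mean keeps its initial value, the mass at depth [0] with [k - 1] records to follow the first
    one, until the success indicator enters at the last step. *)
Lemma success_probability k m : (1 <= k)%N ->
  P (success k (k + m)) = (gen_poisson_pmf ((k%:R - 1) * lam) lam m)%:E.
Proof.
case: k => // k _.
have const n : (n < k.+1 + m)%N ->
    \int[P]_w success_martingale gamma a k.+1 m n (Y^~ w) = \int[P]_w success_martingale gamma a k.+1 m 0 (Y^~ w).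
  elim: n => [//|n IH nkm]; rewrite -IH; last exact: ltnW.
  by rewrite [RHS]success_martingale_mean_step ltn_eqF// addr0.
have mean0 : \int[P]_w success_martingale gamma a k.+1 m 0 (Y^~ w) =
    gen_poisson_pmf ((k.+1%:R - 1) * lam) lam m.
  rewrite -[RHS](Rintegral_prob_cst P); apply: eq_Rintegral => w _.
  rewrite success_martingaleE /dd_records big_ord0 /dd_depth /dd_max dd_time0 /=.
  rewrite running_max_id; last exact: cY.
  by rewrite subrr /stage_pmf mulr0 add0r subSS !subn0 addn0 -natr1 addrK mulrC.
(* Fewer than [k.+1] records is incompatible with the range condition at this index, so the whole
   mean has passed to the indicator. *)
have last0 : \int[P]_w success_martingale gamma a k.+1 m (k.+1 + m) (Y^~ w) = 0.
  rewrite -[RHS](Rintegral_prob_cst P); apply: eq_Rintegral => w _.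
  by rewrite success_martingaleE; case: ifP => // /andP[rk km]; exfalso; move: rk km; clear; lia.
have := success_martingale_mean_step k.+1 m (k + m).
rewrite const ?mean0 ?addSn// -addSn last0 eqxx add0r => ->.
by rewrite fineK// fin_num_measure//; exact: measurable_success.
Qed.

End success_probability.

(** For [m > 0] and [s = m + k - 1], the power lacks one factor [s * lam]; supplying it and dividing
    it out turns [theta] into [(k - 1) / s]. The case test reads [0 / 0] as [1]. *)
Lemma gen_poisson_pmfE (R : realType) (lam : R) (k m : nat) : (1 <= k)%N ->
  gen_poisson_pmf ((k%:R - 1) * lam) lam m =
  (if (k == 1%N) && (m == 0%N) then 1 else (k%:R - 1) / (m%:R + k%:R - 1)) *
  (((m%:R + k%:R - 1) * lam) ^+ m / m`!%:R) * expR (- ((m%:R + k%:R - 1) * lam)).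
Proof.
case: k => // k _; rewrite eqSS -natr1 addrK addrA addrK /gen_poisson_pmf.
have -> : - (k%:R * lam) - lam * m%:R = - ((m%:R + k%:R) * lam) by ring.
case: m => [|m].
  rewrite add0r andbT fact0 expr0 invr1 !mulr1 mul1r.
  by case: eqP => [->|/eqP k0]; rewrite ?mul1r// divff ?mul1r// pnatr_eq0.
rewrite andbF; have -> : k%:R * lam + lam * m.+1%:R = (m.+1%:R + k%:R) * lam by ring.
have f0 : (m.+1)`!%:R != 0 :> R by rewrite pnatr_eq0 -lt0n fact_gt0.
have s0 : m.+1%:R + k%:R != 0 :> R by rewrite -natrD pnatr_eq0.
rewrite exprS; move: s0 f0; set s := _ + _; set F := _`!%:R => s0 f0.
by field; rewrite s0 f0.
Qed.

Theorem theorem4p3 (R : realType) (d : measure_display) (T : measurableType d)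
    (P : probability T R) (W : R -> {RV P >-> R}) (hW : brownian_motion W)
    (mu sigma a : R) (hsigma : 0 < sigma) (ha : 0 < a)
    (k : nat) (hk : (1 <= k)%N) :
  let X := drifted_bm W mu sigma in
  let gamma := 2 * mu / sigma ^+ 2 in
  let lambda := dd_rate gamma a in
  let theta := (k%:R - 1) * lambda in
  let tau n w := dd_time (X^~ w) a n in
  let tau_rec n w := dd_time_rec (X^~ w) a n in
  let N t w := dd_count (X^~ w) a t in
  forall m : nat,
    [/\ P [set w | N (tau_rec k w) w = (k + m)%:R%:E] =
          (gen_poisson_pmf theta lambda m)%:E,
        P [set w | tau_rec k w = tau (k + m)%N w] =
          P [set w | N (tau_rec k w) w = (k + m)%:R%:E] &
        P [set w | N (tau_rec k w) w = (k + m)%:R%:E] =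
          ((if (k == 1%N) && (m == 0%N) then 1
            else (k%:R - 1) / (m%:R + k%:R - 1)) *
           (((m%:R + k%:R - 1) * lambda) ^+ m / m`!%:R) *
           expR (- ((m%:R + k%:R - 1) * lambda)))%:E].
Proof.
move=> X gamma lambda theta tau tau_rec N m.
(* Drawdown times look at nonnegative times only, so the process may be exchanged for its continuous
   extension. *)
pose Y := extended_bm W mu sigma.
have mY t : measurable_fun setT (Y t) := measurable_extended_bm W mu sigma t.
have cY w : continuous (Y^~ w) := @continuous_extended_bm _ _ _ _ _ hW mu sigma w.
have XY w t : 0 <= t -> X t w = Y t w by move=> t0; rewrite /Y extended_bmE.
have tauE n w : tau n w = dd_time (Y^~ w) a n by exact: eq_dd_time (XY w).
have recE n w : tau_rec n w = dd_time_rec (Y^~ w) a n by exact: eq_dd_time_rec (XY w).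
have NE t w : N t w = dd_count (Y^~ w) a t by exact: eq_dd_count (XY w).
have mS n := measurable_success hW mu sigma ha k n.
have -> : [set w | N (tau_rec k w) w = (k + m)%:R%:E] = success W mu sigma a k (k + m).
  by apply/seteqP; split=> w; rewrite /mkset recE NE => /(dd_count_recP k (k + m) (@cY w) ha).
have PS := success_probability hW mu hsigma ha m hk.
(* On [B] both times are infinite; it is the null event by which the two events of the theorem
   differ. *)
pose B := [set w | dd_time (Y^~ w) a (k + m) = +oo%E /\
  forall i, (i < k + m)%N -> ~ success W mu sigma a k i w].
have BE : B = ~` [set w | (dd_time (Y^~ w) a (k + m) < +oo)%E] `&`
    \bigcap_(i in `I_(k + m)) ~` success W mu sigma a k i.
  apply/seteqP; split=> w [].
    by move=> ny none; split=> [|i ik]; [rewrite /setC /mkset ny ltxx|exact: none].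
  by move=> /negP; rewrite -leNgt leye_eq => /eqP ny none; split=> // i ik; exact: none.
have mB : measurable B.
  rewrite BE; apply: measurableI.
    by apply: measurableC; exact: (measurable_dd_time_lty mY cY ha).
  by apply: fin_bigcap_measurable => // i _; exact: measurableC.
have B0 : P B = 0%E.
  apply/measure_negligible => //.
  apply: negligibleS (dd_time_lty_ae hW mu hsigma ha) => w [ny _] /= fin.
  by have := fin (k + m)%N; rewrite -/Y ny ltxx.
split; first exact: PS.
  have -> : [set w | tau_rec k w = tau (k + m)%N w] = success W mu sigma a k (k + m) `|` B.
    by apply/seteqP; split=> w; rewrite /mkset recE tauE => /(dd_time_recP k (k + m) (@cY w) ha).
  exact: measureU0.
by rewrite PS gen_poisson_pmfE.
Qed.
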